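(* For any angle $\omega\in(0,\pi/2)$, let $$K_\omega=\{\nu\in\mathbb{R}^{n-1}:\nu_1\ge\|\nu\|\cos\omega\},\qquad K_{\times,\omega}=K_\omega\times\mathbb{R}\subset\mathbb{R}^n .$$ For $K\in\{K_\omega,K_{\times,\omega}\}$ consider the two-sided likelihood ratio test of $H_0:\mu=0$ versus $H_1:\mu\in K$. (1) Let $K\in\{K_\omega,K_{\times,\omega}\}$. There exists some universal constant $C>0$ such that, under $\mu=0$, $$d_{\mathrm{TV}}\left(\frac{T(Y)-m_0}{\sigma_0},\mathcal{N}(0,1)\right)\le\frac{C}{\sqrt n}.$$ Consequently the test is asymptotically of size $\alpha$, with $\mathbb{E}_0\Psi_{\mathrm{ts}}(Y;m_0,\sigma_0)=\alpha+\mathcal{O}(n^{-1/2})$. (2) (a) For any $\mu\in K_\omega$, the test for $K=K_\omega$ is power consistent under $\mu$, i.e. $\mathbb{E}_\mu\Psi_{\mathrm{ts}}(Y;m_0,\sigma_0)\to1$, if and only if $\|\mu\|\gg1$. (b) For any $\mu=(\mu^1,\mu^2)\in K_{\times,\omega}$, where $\mu^1\in\mathbb{R}^{n-1}$ denotes the first $n-1$ components and $\mu^2\in\mathbb{R}$ the last, the test for $K=K_{\times,\omega}$ is power consistent under $\mu$, i.e. $\mathbb{E}_\mu\Psi_{\mathrm{ts}}(Y;m_0,\sigma_0)\to1$, if and only if $\|\mu^1\|\gg1$ or $|\mu^2|\gg n^{1/4}$.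
   Context: For a closed convex cone $K\subset\mathbb{R}^d$ ($d=n-1$ for $K_\omega$, $d=n$ for $K_{\times,\omega}$), the model is $Y=\mu+\xi$ with $\xi$ standard Gaussian in $\mathbb{R}^d$; $\mathbb{E}_\mu$ refers to mean $\mu$; $\|\cdot\|$ is the Euclidean norm and $\Pi_K$ the metric projection onto $K$. $T(Y)=\|Y\|^2-\|Y-\Pi_K(Y)\|^2$; $m_0,\sigma_0^2$ are the mean and variance of $T(Y)$ under $\mu=0$. For a level $\alpha\in(0,1)$, $\Psi_{\mathrm{ts}}(Y;m_0,\sigma_0)=\mathbf{1}\big(|(T(Y)-m_0)/\sigma_0|>z_{\alpha/2}\big)$, where $z_\alpha$ is defined by $\mathbb{P}(\mathcal{N}(0,1)\ge z_\alpha)=\alpha$. $d_{\mathrm{TV}}$ is total variation distance, $d_{\mathrm{TV}}(X,Z)=\sup_{B\text{ Borel}}|\mathbb{P}(X\in B)-\mathbb{P}(Z\in B)|$. Asymptotics are as $n\to\infty$, and the dependence of $\mu$ on $n$ is suppressed. For nonnegative sequences, $a_n\gg b_n$ means $a_n/b_n\to\infty$.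
   Formalization: In (2)(b) the ''or'' is taken at each n, i.e. max(‖μ¹‖, |μ²|/n^{1/4}) → ∞, since ''only if'' fails for means alternating between the two regimes; in (1) C may depend on ω (not on n), since no C works for all ω as ω → 0. *)

(* Defs.v *)
From HB Require Import structures.
From mathcomp Require Import all_boot all_order all_algebra.
From mathcomp Require Import all_classical all_reals all_analysis.

Set Implicit Arguments.
Unset Strict Implicit.
Unset Printing Implicit Defensive.

Import Order.TTheory GRing.Theory Num.Theory.
Import numFieldNormedType.Exports.

Local Open Scope classical_set_scope.
Local Open Scope ring_scope.

(* The norm [`|x|] of the library on row vectors is the sup norm. *)
Definition enorm (R : realType) d (x : 'rV[R]_d) : R :=
  Num.sqrt (\sum_(i < d) x 0 i ^+ 2).

(* The standard Gaussian law on [d.-tuple R] (with the product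
   sigma-algebra), built one coordinate at a time; [std_gauss_box] below
   characterizes it. *)
Section std_gauss.
Context {R : realType}.

Definition tcons d (p : measurableTypeR R * d.-tuple (measurableTypeR R)) :
    d.+1.-tuple (measurableTypeR R) := [tuple of p.1 :: p.2].

Lemma measurable_tcons d : measurable_fun [set: measurableTypeR R * d.-tuple (measurableTypeR R)] (@tcons d).
Proof. by apply: measurable_cons. Qed.

HB.instance Definition _ d :=
  isMeasurableFun.Build _ _ _ _ (@tcons d) (@measurable_tcons d).

Fixpoint std_gauss d : probability (d.-tuple (measurableTypeR R)) R :=
  match d with
  | 0 => dirac [tuple]
  | d'.+1 => distribution (normal_prob 0 1 \x std_gauss d')%E (@tcons d')
  end.

Lemma std_gauss_box d (A : 'I_d -> set (measurableTypeR R)) :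
    (forall i, measurable (A i)) ->
  std_gauss d [set t | forall i, A i (tnth t i)] =
  (\prod_(i < d) normal_prob 0 1 (A i))%E.
Proof.
elim: d A => [A _|d IH A mA] /=.
  by rewrite big_ord0 diracE mem_set//= => -[].
rewrite big_ord_recl /distribution /pushforward /=.
rewrite -IH => [|i]; last exact: mA.
rewrite -product_measure1E//.
- congr (_ _); apply/seteqP; split => -[x t] /=.
  + move=> h; split; first exact: (h ord0).
    by move=> i; have := h (lift ord0 i); rewrite tnthS.
  + move=> [h0 h] i; have [j ->|->] := unliftP ord0 i; last exact: h0.
    by rewrite tnthS; exact: h.
- rewrite (_ : [set _ | _] = \bigcap_(i in setT) ((@tnth _ _)^~ i @^-1` A (lift ord0 i))).
    apply: fin_bigcap_measurable => [|i _]; first exact: finite_finset.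
    rewrite -[X in measurable X]setTI.
    by apply: measurable_tnth.
  by apply/seteqP; split => t /= h i; [move=> _|]; apply: h.
Qed.
End std_gauss.

Section model.
Context {R : realType}.

Definition vec_of_tuple d (t : d.-tuple R) : 'rV[R]_d := \row_(i < d) tnth t i.

(* The observation Y = mu + xi, as a random vector on the probability space
   [(d.-tuple R, std_gauss d)]. *)
Definition obs d (mu : 'rV[R]_d) (t : d.-tuple R) : 'rV[R]_d :=
  mu + vec_of_tuple t.

(* The point of [K] nearest to [y]; it exists and is unique when [K] is
   nonempty, closed and convex. *)
Definition metric_proj d (K : set 'rV[R]_d) (y : 'rV[R]_d) : 'rV[R]_d :=
  xget 0 [set x | K x /\ forall z, K z -> enorm (y - x) <= enorm (y - z)].

Definition lrt_stat d (K : set 'rV[R]_d) (y : 'rV[R]_d) : R :=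
  enorm y ^+ 2 - enorm (y - metric_proj K y) ^+ 2.

Definition lrt_mean0 d (K : set 'rV[R]_d) : R :=
  fine 'E_(std_gauss d)[lrt_stat K \o obs 0].

Definition lrt_sd0 d (K : set 'rV[R]_d) : R :=
  Num.sqrt (fine 'V_(std_gauss d)[lrt_stat K \o obs 0]).

Definition lrt_std d (K : set 'rV[R]_d) (y : 'rV[R]_d) : R :=
  (lrt_stat K y - lrt_mean0 K) / lrt_sd0 K.

(* [z_alpha], the upper quantile of N(0,1), unique for [0 < alpha < 1]. *)
Definition normal_quantile (alpha : R) : R :=
  xget 0 [set z | normal_prob 0 1 `[z, +oo[ = alpha%:E].

Definition psi_ts d (K : set 'rV[R]_d) (alpha : R) (y : 'rV[R]_d) : R :=
  (normal_quantile (alpha / 2) < `|lrt_std K y|)%R%:R.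

Definition power_ts d (K : set 'rV[R]_d) (alpha : R) (mu : 'rV[R]_d) : R :=
  fine 'E_(std_gauss d)[psi_ts K alpha \o obs mu].

Definition tv_dist (P Q : set (measurableTypeR R) -> \bar R) : \bar R :=
  ereal_sup [set `|P B - Q B|%E | B in measurable].

Definition tv_lrt_normal d (K : set 'rV[R]_d) : \bar R :=
  tv_dist (pushforward (std_gauss d) (lrt_std K \o obs 0)) (normal_prob 0 1).

Definition circ_cone (omega : R) m : set 'rV[R]_m.+1 :=
  [set nu | enorm nu * cos omega <= nu 0 0].

Definition prod_circ_cone (omega : R) m : set 'rV[R]_(m.+1 + 1) :=
  [set nu | circ_cone omega (lsubmx nu)].

(* a >> b *)
Definition dominates (a b : nat -> R) := a n / b n @[n --> \oo] --> +oo.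

(* "a >> b or a' >> b'".  The alternative is taken at each index [n]: which of the two ratios is large
   may vary with [n], as for a mean vector that alternates between two regimes
   along even and odd [n]. *)
Definition dominates_either (a b a' b' : nat -> R) :=
  forall M : R, \forall n \near \oo, M <= a n / b n \/ M <= a' n / b' n.

End model.

(* Main.v *)
From HB Require Import structures.
Require Import Defs.
From mathcomp Require Import all_boot all_order all_algebra.
From mathcomp Require Import all_classical all_reals all_analysis.
From mathcomp Require Import measurable_realfun ring lra.

(** Split an observation [y] of either cone into its first coordinate [a], a
block [w] of [m] further coordinates, and the rest: nothing for the circular
cone, the last coordinate for the product cone.  The projection leaves the
rest alone and acts on [(a, r)], with [r] the norm of [w], as the projection
of the half plane [0 <= r] onto the sector below the ray of direction
[(c, s) = (cos omega, sin omega)].  Hence (lemma [lrt_stat_coneJ])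
    [T y = max (a c + r s) 0 ^ 2 + max (a s - r c) 0 ^ 2 + sum of rest],
a sum of squares over the rest.  Under mean zero [r] is close to [sqrt m], so
the first positive part is active, the second one contributes [O(1)], and
expanding the square gives [T = s ^ 2 m + L + O(1)] in mean square, with
    [L = s ^ 2 (r ^ 2 - m) + 2 s c (sqrt m) a]
centred, of variance [m (2 s ^ 4 + 4 s ^ 2 c ^ 2)].

Normal approximation is Stein's method.  The gradient of [T] is twice the
projection, and [L] is the Gaussian divergence of the field
[v = s ^ 2 w + 2 s c (sqrt m) e_0]; integration by parts gives
[E (phi(T) L) = E (phi'(T) W)] with the kernel [W = < v, 2 P y >]
([stein_identity]).  By the same expansion [W] is within [O(sqrt m)] of the
variance in mean, so the Stein equation bounds the error for continuous test
functions by [O(1 / sqrt m)] ([stein_test_rate]).  That is a bound in total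
variation, because Borel sets are approximated in mean by continuous functions
([tv_test_fun]).  The size of the test is the case of the rejection region.

For the power, let [mu1] be the part of [mu] on [a] and [w], and [mu2] the
rest.  As [T] is the supremum over [v] in the cone of [2 < y, v > - |v| ^ 2],
it is convex with gradient [2 P], so
    [T(mu + xi) = T(xi) + 2 < mu1, P xi > + 2 mu2 xi_n + mu2 ^ 2]
up to an error in [[0, 2 |mu1| ^ 2]] ([lrt_axial_lb], [lrt_axial_ub]), and
[< mu1, P xi >] is [s c (sqrt m) mu_0] up to a noise of second moment
[O(|mu1| ^ 2)] ([Ex_axial_noise2]).  The standard deviation of [T] is of order
[sqrt m], and [mu_0 >= c |mu1|] on the cone.  So when [|mu1|] or
[|mu2| / n ^ (1/4)] is large the standardized statistic is shifted by a large
amount that dominates the noise, and Chebyshev's inequality gives power close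
to 1 ([power_ge]).  Along indices where both stay bounded, the shift stays
bounded and the noise vanishes, so that, by the normal limit, acceptance keeps
a probability bounded below ([power_le]). *)

Set Implicit Arguments.
Unset Strict Implicit.
Unset Printing Implicit Defensive.

Import Order.TTheory GRing.Theory Num.Theory.
Import numFieldNormedType.Exports.

Local Open Scope classical_set_scope.
Local Open Scope ring_scope.

(** * Integration by parts against the standard normal density *)

Section normal_line.
Context {R : realType}.
Local Notation mu := (@lebesgue_measure R).
Local Notation gam := (normal_prob (0:R) 1).
Local Notation pdf := (normal_pdf (0:R) 1).

(** The change of variables of the Radon-Nikodym theorem: the derivative of the
normal law agrees almost everywhere with its density, since both integrate to
it over every Borel set. *)
Lemma ge0_integral_normal (f : R -> \bar R) :
  measurable_fun setT f -> (forall x, 0 <= f x)%E ->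
  (\int[gam]_x f x = \int[mu]_x (f x * (pdf x)%:E))%E.
Proof.
move=> mf f0.
have dom := @normal_prob_dominates R 0 1.
rewrite -(Radon_Nikodym_SigmaFinite.change_of_variables dom f0 measurableT mf).
have mpdf : measurable_fun [set: R] (EFin \o pdf).
  by apply/measurable_EFinP; exact: measurable_normal_pdf.
apply: ge0_ae_eq_integral => //.
- apply: emeasurable_funM => //.
  by apply: (measurable_int mu); exact: Radon_Nikodym_SigmaFinite.f_integrable.
- exact: emeasurable_funM.
- by move=> x _; rewrite mule_ge0 ?f0// Radon_Nikodym_SigmaFinite.f_ge0.
- by move=> x _; rewrite mule_ge0 ?f0// lee_fin normal_pdf_ge0.
apply: ae_eqe_mul2l; apply: integral_ae_eq => //.
- exact: Radon_Nikodym_SigmaFinite.f_integrable.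
- by move=> E _ mE; rewrite -Radon_Nikodym_SigmaFinite.f_integral.
Qed.

Lemma derivable1_continuous (f : R -> R) (x : R) : derivable f x 1 -> {for x, continuous f}.
Proof. by move=> d; apply/differentiable_continuous/derivable1_diffP. Qed.

Lemma pdfE (x : R) : pdf x = (Num.sqrt (pi *+ 2))^-1 * expR (- x ^+ 2 / 2).
Proof.
by rewrite normal_pdfE ?oner_neq0// /normal_peak /normal_fun subr0 expr1n mul1r.
Qed.

(** With [u = 1 + x ^ 2], apply [1 + t <= exp t] at [t = u / (4 k)] and raise to
the power [k]. *)
Lemma polyexp_le (k : nat) (x : R) : (1 + x ^+ 2) ^+ k <= (4 * k%:R + 1) ^+ k * expR ((1 + x ^+ 2) / 4).
Proof.
case: k => [|k]; first by rewrite !expr0 mul1r -expR0 ler_expR divr_ge0 ?addr_ge0 ?sqr_ge0.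
set u := 1 + x ^+ 2; have u0 : 0 <= u by rewrite addr_ge0 ?sqr_ge0.
have -> : u / 4 = k.+1%:R * (u / (4 * k.+1%:R)).
  by field; rewrite -?natr1 ?nat1r pnatr_eq0.
rewrite expRM_natl -exprMn; apply: lerXn2r; rewrite ?nnegrE//.
rewrite mulrDl mul1r -[leLHS]addr0; apply: lerD; last exact: expR_ge0.
have k0 : 0 < 4 * k.+1%:R :> R by rewrite mulr_gt0 ?ltr0n.
rewrite -ler_pdivrMl// mulrC; apply: le_trans (expR_ge1Dx _).
by rewrite ler_wpDl.
Qed.

(** Polynomial growth, in a form closed under products; it is the integrability
condition used throughout, because it also passes to slices of functions of
several variables. *)
Definition pbound (f : R -> R) := exists C k, forall x, `|f x| <= C * (1 + x ^+ 2) ^+ k.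

(** A polynomial is absorbed by part of the Gaussian decay, leaving the density
of a normal law with twice the variance: an explicit integrable dominant. *)
Lemma pbound_pdf (f : R -> R) : pbound f ->
  exists2 D, 0 <= D & forall x, `|f x * pdf x| <= D * normal_pdf 0 (Num.sqrt 2) x.
Proof.
move=> [C [k fC]].
exists (C * (4 * k%:R + 1) ^+ k * expR (1 / 4) * normal_peak 1 / normal_peak (Num.sqrt 2)).
  have := fC 0; rewrite expr0n/= addr0 expr1n mulr1 => C0.
  rewrite divr_ge0 ?normal_peak_ge0// !mulr_ge0 ?expR_ge0 ?normal_peak_ge0 ?exprn_ge0//.
  exact: le_trans C0.
move=> x; set D := (D in D * _).
have pk2 : 0 < normal_peak (Num.sqrt 2) :> R.
  by rewrite normal_peak_gt0// gt_eqF// sqrtr_gt0.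
have s20 : Num.sqrt 2 != 0 :> R by rewrite gt_eqF// sqrtr_gt0.
rewrite normrM [`|pdf x|]ger0_norm ?normal_pdf_ge0//.
rewrite !normal_pdfE ?oner_neq0//.
apply: le_trans (_ : C * (4 * k%:R + 1) ^+ k * expR ((1 + x ^+ 2) / 4) * (normal_peak 1 * normal_fun 0 1 x) <= _).
  apply: ler_wpM2r; first by rewrite mulr_ge0 ?normal_peak_ge0 ?normal_fun_ge0.
  apply: le_trans (fC x) _; rewrite -mulrA ler_wpM2l ?polyexp_le//.
  by have := fC 0; rewrite expr0n/= addr0 expr1n mulr1; apply: le_trans.
rewrite le_eqVlt; apply/orP; left; apply/eqP.
rewrite /D [RHS]mulrA [in RHS]mulfVK ?gt_eqF// /normal_fun subr0.
rewrite expr1n sqr_sqrtr//.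
rewrite -!mulrA; congr (_ * (_ * _)); rewrite mulrCA [RHS]mulrCA -!expRD.
by congr (_ * expR _); field.
Qed.

Lemma integrable_pbound_pdf (f : R -> R) : measurable_fun [set: R] f -> pbound f ->
  mu.-integrable [set: R] (fun x => (f x * pdf x)%:E).
Proof.
move=> mf /pbound_pdf[D D0 fD].
apply: (@le_integrable _ _ _ mu _ measurableT _ (fun x => (D%:E * (normal_pdf 0 (Num.sqrt 2) x)%:E)%E)).
- apply/measurable_EFinP; apply: measurable_funM => //.
  exact: measurable_normal_pdf.
- by move=> x _ /=; rewrite lee_fin; apply: le_trans (fD x) (ler_norm _).
- apply: integrableZl => //; exact: integrable_normal_pdf.
Qed.

Lemma pbound_pdf_cvg0 (f : R -> R) (u : nat -> R) : pbound f -> (forall n, `|u n| = n%:R) ->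
  f (u n) * pdf (u n) @[n --> \oo] --> 0.
Proof.
move=> /pbound_pdf[D D0 fD] un.
have s20 : Num.sqrt 2 != 0 :> R by rewrite gt_eqF// sqrtr_gt0.
apply/norm_cvg0P.
(* [n ^ 2 / 4 >= n - 1] turns the Gaussian bound into an exponential one. *)
pose E := D * (normal_peak (Num.sqrt 2) * expR 1).
apply: (@squeeze_cvgr _ _ _ _ (fun=> 0) (fun n => E * expR (- n%:R))).
- near=> n; rewrite normr_ge0/=; apply: le_trans (fD _) _.
  rewrite -mulrA ler_wpM2l// normal_pdfE// -mulrA ler_wpM2l ?normal_peak_ge0//.
  rewrite /normal_fun subr0 -expRD ler_expR sqr_sqrtr// -real_normK ?num_real// un.
  have : 0 <= (n%:R - 2 : R) ^+ 2 by exact: sqr_ge0.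
  by nra.
- exact: cvg_cst.
- by rewrite -[0](mulr0 E); apply: cvgM; [exact: cvg_cst|exact: cvgn_expR].
Unshelve. all: by end_near. Qed.

Lemma integrable_pbound (f : R -> R) : measurable_fun [set: R] f -> pbound f ->
  gam.-integrable [set: R] (EFin \o f).
Proof.
move=> mf fC; apply/integrableP; split; first exact/measurable_EFinP.
rewrite ge0_integral_normal//; last by do 2 apply: measurableT_comp => //.
have /integrableP[_] := integrable_pbound_pdf mf fC.
apply: le_lt_trans; rewrite le_eqVlt; apply/orP; left; apply/eqP.
apply: eq_integral => x _ /=.
by rewrite normrM EFinM [`|pdf x|]ger0_norm// normal_pdf_ge0.
Qed.

Lemma integral_normal (f : R -> R) : measurable_fun [set: R] f ->
  (\int[gam]_x f x = \int[mu]_x (f x * pdf x))%R.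
Proof.
move=> /measurable_EFinP mf; rewrite /Rintegral; congr fine.
rewrite [LHS]integralE [RHS]integralE.
rewrite !ge0_integral_normal//; try exact: measurable_funepos; try exact: measurable_funeneg.
congr (_ - _)%E; apply: eq_integral => x _; have p0 := normal_pdf_ge0 0 1 x.
  by rewrite !funeposE/= -!EFin_max -EFinM maxr_pMl// mul0r.
by rewrite !funenegE/= -!EFin_max -EFinM maxr_pMl// mul0r mulNr.
Qed.

(** The integral over [[-n, n]] is [F n - F (- n)] by the fundamental theorem;
let [n] tend to infinity by dominated convergence. *)
Lemma integral_derive_eq0 (F f : R -> R) :
  (forall x : R, is_derive x (1:R) F (f x)) -> continuous f ->
  mu.-integrable [set: R] (EFin \o f) ->
  F n%:R @[n --> \oo] --> 0 -> F (- n%:R) @[n --> \oo] --> 0 ->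
  (\int[mu]_x f x = 0)%R.
Proof.
move=> dF cf intf Fy FNy.
have mf : measurable_fun [set: R] f by exact: continuous_measurable_fun.
pose f_ n x := ((f \_ `[- n%:R, n%:R]) x)%:E.
have [] := @dominated_convergence _ _ _ mu _ measurableT f_ (EFin \o f) (fun x => `|f x|%:E).
- move=> n; apply/measurable_EFinP; apply/(measurable_restrictT f) => //.
  exact: measurable_funTS.
- exact/measurable_EFinP.
- apply: aeW => x _ /=; apply: cvg_near_cst.
  exists (Num.bound `|x|) => // n /= xn; rewrite /f_ patchE mem_set//= in_itv/= -ler_norml.
  by apply: le_trans (ltW (archi_boundP (normr_ge0 x))) _; rewrite ler_nat.
- exact: integrable_abse intf.
- apply: aeW => x n _; rewrite /f_ lee_fin patchE; case: ifPn => // _.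
  by rewrite normr0.
move=> _ _ cvf.
have Fcv : (F n%:R - F (- n%:R))%:E @[n --> \oo] --> 0%:E.
  by apply: cvg_EFin; [exact: nearW|rewrite -[0]subr0; exact: cvgB].
have eqn : \forall n \near \oo, (\int[mu]_x f_ n x)%E = (F n%:R - F (- n%:R))%:E.
  exists 1%N => // n /= n0.
  rewrite EFinB -(@continuous_FTC2 _ f F (- n%:R) n%:R).
  - rewrite [RHS]integral_mkcond; apply: eq_integral => x _.
    by rewrite /f_ restrict_EFin.
  - by rewrite -subr_gt0 opprK addr_gt0// ltr0n.
  - by apply: continuous_subspaceT.
  - split.
    + by move=> x _; have [] := dF x.
    + apply: cvg_at_right_filter; have [d _] := dF (- n%:R).
      exact: derivable1_continuous d.
    + apply: cvg_at_left_filter; have [d _] := dF n%:R.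
      exact: derivable1_continuous d.
  - by move=> x _; rewrite derive1E; have [_] := dF x.
have : (\int[mu]_x f_ n x)%E @[n --> \oo] --> 0%:E.
  apply: cvg_trans Fcv; apply: near_eq_cvg.
  by apply: filterS eqn => n ->.
move=> /(cvg_unique (@ereal_hausdorff R) cvf) h.
by rewrite /Rintegral h.
Qed.

Lemma is_derive_pdf (x : R) : is_derive x (1:R) pdf (- x * pdf x).
Proof.
pose peak : R := (Num.sqrt (pi *+ 2))^-1.
have -> : pdf = (fun x => peak * expR (- x ^+ 2 / 2)) by apply/funext => y; rewrite pdfE.
by apply: is_derive_eq; rewrite /GRing.scale/=; lra.
Qed.

Lemma pboundM f g : pbound f -> pbound g -> pbound (f \* g).
Proof.
move=> [C [k fC]] [D [l gD]]; exists (C * D), (k + l)%N => x.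
by rewrite normrM exprD mulrACA ler_pM.
Qed.

Lemma pboundB f g : pbound f -> pbound g -> pbound (f \- g).
Proof.
move=> [C [k fC]] [D [l gD]]; exists (C + D), (k + l)%N => x.
have C0 : 0 <= C.
  by have := fC 0; rewrite expr0n/= addr0 expr1n mulr1; apply: le_trans.
have D0 : 0 <= D.
  by have := gD 0; rewrite expr0n/= addr0 expr1n mulr1; apply: le_trans.
have u1 : 1 <= 1 + x ^+ 2 by rewrite lerDl sqr_ge0.
apply: le_trans (ler_normB _ _) _; rewrite mulrDl; apply: lerD.
  apply: le_trans (fC x) _; rewrite ler_wpM2l// exprD ler_peMr ?exprn_ege1//.
  by rewrite exprn_ge0// (le_trans ler01).
apply: le_trans (gD x) _; rewrite ler_wpM2l// exprD ler_peMl ?exprn_ege1//.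
by rewrite exprn_ge0// (le_trans ler01).
Qed.

Lemma pbound_id : pbound id.
Proof.
exists 1, 1%N => x; rewrite mul1r expr1.
have : 0 <= (`|x| - 1) ^+ 2 by exact: sqr_ge0.
by rewrite -[x ^+ 2]real_normK ?num_real//; nra.
Qed.

(** The integrand [g' x - x g x], multiplied by the density, is the derivative of
[g] times the density. *)
Lemma normal_ibp (g g' : R -> R) : (forall x : R, is_derive x (1:R) g (g' x)) ->
  continuous g' -> pbound g -> pbound g' ->
  (\int[gam]_x g' x = \int[gam]_x (x * g x))%R.
Proof.
move=> dg cg' bg bg'.
have cg : continuous g.
  by move=> x; have [d _] := dg x; exact: derivable1_continuous d.
have mg : measurable_fun [set: R] g by exact: continuous_measurable_fun.
have mg' : measurable_fun [set: R] g' by exact: continuous_measurable_fun.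
have bh : pbound (g' \- id \* g) by apply: pboundB => //; apply: pboundM => //; exact: pbound_id.
have mxg : measurable_fun [set: R] (fun x : R => x * g x) by exact: measurable_funM.
have mh : measurable_fun [set: R] (g' \- id \* g) by exact: measurable_funB.
apply/eqP; rewrite -subr_eq0 -RintegralB//.
- rewrite integral_normal//.
  apply/eqP; apply: (@integral_derive_eq0 (fun x => g x * pdf x)).
  + move=> x; have := is_derive_pdf x => dp.
    by apply: is_derive_eq; rewrite /GRing.scale/=; lra.
  + move=> x; apply: cvgM; last exact: continuous_normal_pdf.
    by apply: cvgB; [exact: cg'|apply: cvgM; [exact: cvg_id|exact: cg]].
  + exact: integrable_pbound_pdf.
  + by apply: pbound_pdf_cvg0 => // n; rewrite ger0_norm.
  + by apply: pbound_pdf_cvg0 => // n; rewrite normrN ger0_norm.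
- exact: integrable_pbound.
- by apply: integrable_pbound => //; apply: pboundM => //; exact: pbound_id.
Qed.

End normal_line.

(** * The Stein equation *)

Section stein_solution.
Context {R : realType}.
Local Notation mu := (@lebesgue_measure R).
Local Notation gam := (normal_prob (0:R) 1).
Local Notation pdf := (normal_pdf (0:R) 1).

Lemma pdf_gt0 (x : R) : 0 < pdf x.
Proof. by rewrite pdfE mulr_gt0 ?expR_gt0// invr_gt0 sqrtr_gt0 mulrn_wgt0// pi_gt0. Qed.

Lemma pdf_even (x : R) : pdf (- x) = pdf x.
Proof. by rewrite !pdfE sqrrN. Qed.

Lemma continuous_pdf : continuous pdf.
Proof. by apply: continuous_normal_pdf; exact: oner_neq0. Qed.

Lemma normal_prob_lray (x : R) : gam `]-oo, x] = gam `[- x, +oo[.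
Proof.
rewrite /normal_prob -[in LHS](opprK x) ge0_integration_by_substitutionNy.
- by apply: eq_integral => y _ /=; rewrite pdf_even.
- by apply: continuous_subspaceT; exact: continuous_pdf.
- by move=> y _; rewrite normal_pdf_ge0.
Qed.

Definition gtail (x : R) := fine (gam `[x, +oo[).

Lemma gtailE (x : R) : gam `[x, +oo[ = (gtail x)%:E.
Proof. by rewrite /gtail fineK// fin_num_measure. Qed.

Lemma pdf_cvg_pinfty : pdf x @[x --> +oo] --> 0.
Proof.
apply: (@squeeze_cvgr _ _ _ _ (fun=> 0) (fun x : R => (normal_peak 1 * expR 1) * expR (- x))).
- near=> x; rewrite normal_pdf_ge0/= normal_pdfE ?oner_neq0// -mulrA ler_wpM2l ?normal_peak_ge0//.
  rewrite /normal_fun subr0 expr1n -expRD ler_expR.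
  have : 0 <= (x - 1) ^+ 2 by exact: sqr_ge0.
  by nra.
- exact: cvg_cst.
- by rewrite -[0](mulr0 (normal_peak 1 * expR 1)); apply: cvgM; [exact: cvg_cst|exact: cvgr_expR].
Unshelve. all: by end_near. Qed.

Lemma gtail_le1 (x : R) : gtail x <= 1.
Proof. by rewrite -lee_fin -gtailE probability_le1. Qed.

(** [x pdf t <= t pdf t] beyond [x], and [t pdf t] has primitive [- pdf]. *)
Lemma gtail_mills (x : R) : 0 <= x -> x * gtail x <= pdf x.
Proof.
move=> x0; rewrite -lee_fin EFinM -gtailE /normal_prob.
have cxp : continuous (fun t : R => t * pdf t).
  by move=> t; apply: cvgM; [exact: cvg_id|exact: continuous_pdf].
have mpdf : measurable_fun [set: R] pdf by exact: measurable_normal_pdf.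
rewrite -ge0_integralZl//; last 2 first.
- by apply/measurable_EFinP; exact: measurable_funTS.
- by move=> t _; rewrite lee_fin normal_pdf_ge0.
apply: (@le_trans _ _ (\int[mu]_(t in `[x, +oo[) (t * pdf t)%:E)%E).
  apply: ge0_le_integral => //.
  - by move=> t _; rewrite -EFinM lee_fin mulr_ge0 ?normal_pdf_ge0.
  - by apply/measurable_EFinP/measurable_funTS; exact: measurable_funM.
  - by apply/measurable_EFinP/measurable_funTS; exact: measurable_funM.
  - move=> t; rewrite /= in_itv/= andbT => xt.
    by rewrite -EFinM lee_fin ler_wpM2r ?normal_pdf_ge0.
rewrite (@ge0_continuous_FTC2y _ _ (fun t => - pdf t) x 0).
- by rewrite sub0e EFinN oppeK.
- by move=> t xt; rewrite mulr_ge0 ?normal_pdf_ge0// (le_trans x0).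
- exact: continuous_subspaceT.
- by rewrite -[X in _ --> X]oppr0; apply: cvgN; exact: pdf_cvg_pinfty.
- by move=> t _; apply: derivableN; have [] := is_derive_pdf t.
- by apply: cvg_at_right_filter; apply: cvgN; exact: continuous_pdf.
- move=> t _; rewrite derive1E deriveN; last by have [] := is_derive_pdf t.
  by have [_ ->] := is_derive_pdf t; rewrite mulNr opprK.
Qed.

Section solution.
Variable h : R -> R.
Hypotheses (ch : continuous h) (h01 : forall x, 0 <= h x <= 1).

Let Nh : R := (\int[gam]_x h x)%R.
Let u x := (h x - Nh) * pdf x.
Let G x := (\int[mu]_(t in `]-oo, x]) u t)%R.

Let mh : measurable_fun [set: R] h. Proof. exact: continuous_measurable_fun. Qed.

Let bh : pbound h.
Proof.
exists 1, 0%N => x; rewrite expr0 mulr1.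
by have /andP[? ?] := h01 x; rewrite ger0_norm.
Qed.

Let ih : gam.-integrable [set: R] (EFin \o h). Proof. exact: integrable_pbound. Qed.

Let Nh01 : 0 <= Nh <= 1.
Proof.
apply/andP; split.
  by apply: Rintegral_ge0 => x _; have /andP[] := h01 x.
have -> : 1 = \int[gam]_x (cst 1 x) :> R.
  by rewrite Rintegral_cst//= probability_setT/= mulr1.
apply: le_Rintegral => //.
  by apply: integrable_pbound => //; exists 1, 0%N => x; rewrite normr1 expr0 mulr1.
by move=> x _; have /andP[] := h01 x.
Qed.

Let hN x : `|h x - Nh| <= 1.
Proof.
have /andP[? ?] := h01 x; have /andP[? ?] := Nh01.
by rewrite ler_norml; apply/andP; split; lra.
Qed.

Let cu : continuous u.
Proof.
by move=> x; apply: cvgM; [apply: cvgB; [exact: ch|exact: cvg_cst]|exact: continuous_pdf].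
Qed.

Let mu' : measurable_fun [set: R] u. Proof. exact: continuous_measurable_fun. Qed.

Let iu : mu.-integrable [set: R] (EFin \o u).
Proof.
apply: integrable_pbound_pdf; first exact: measurable_funB.
by exists 1, 0%N => x; rewrite expr0 mulr1.
Qed.

Let iuS (D : set (measurableTypeR R)) : measurable D -> mu.-integrable D (EFin \o u).
Proof. by move=> mD; apply: integrableS iu. Qed.

Let intu0 : (\int[mu]_x u x = 0)%R.
Proof.
rewrite -(@integral_normal _ (fun x => h x - Nh)); last exact: measurable_funB.
rewrite RintegralB//.
  by rewrite Rintegral_cst//= probability_setT/= mulr1 subrr.
apply: integrable_pbound => //; exists `|Nh|, 0%N => x.
by rewrite expr0 mulr1.
Qed.

Let intu_le (D : set (measurableTypeR R)) : measurable D -> `|\int[mu]_(t in D) u t| <= fine (gam D).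
Proof.
move=> mD; apply: le_trans; first exact: (le_normr_Rintegral mD (iuS mD)).
rewrite -[leRHS]/(\int[mu]_(t in D) pdf t)%R; apply: le_Rintegral => //.
- exact: integrable_norm (iuS mD).
- by apply: integrableS (integrable_normal_pdf 0 1).
- move=> x _; rewrite normrM [`|pdf x|]ger0_norm ?normal_pdf_ge0//.
  by rewrite ler_piMl ?normal_pdf_ge0.
Qed.

Let Gtail x : `|G x| <= gtail `|x|.
Proof.
have [x0|x0] := leP 0 x.
  have -> : G x = - \int[mu]_(t in `]x, +oo[) u t.
    apply/eqP; rewrite -addr_eq0 -intu0; apply/eqP.
    have -> : [set: R] = `]-oo, x] `|` `]x, +oo[ by rewrite -setCitvl setUv.
    rewrite Rintegral_setU//.
    - exact: iuS (measurableU _ _ _ _).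
    - by apply/disj_setPS => y []; rewrite /= !in_itv/= andbT leNgt => /negbTE ->.
  rewrite normrN; apply: le_trans (intu_le _) _ => //.
  rewrite (ger0_norm x0) /gtail fine_le ?fin_num_measure//.
  by apply: le_measure; rewrite ?inE// => t /=; rewrite !in_itv/= !andbT; exact: ltW.
rewrite (ltr0_norm x0) /gtail -normal_prob_lray.
exact: intu_le.
Qed.

(** The solution is [f = G / pdf] with [G x] the integral of
[(h - E h) pdf] up to [x].  As the total integral vanishes, [G] is bounded by
the normal tail on either side, and the Mills bound then controls [x f x],
hence [f' = h - E h + x f].  Near the origin [f] is bounded by [1 / pdf 1]. *)
Lemma stein_solution : exists f f' : R -> R,
  [/\ forall x : R, is_derive x (1:R) f (f' x), continuous f',
      forall x, f' x - x * f x = h x - \int[gam]_t h t,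
      forall x, `|f x| <= 1 + (pdf 1)^-1 & forall x, `|f' x| <= 2].
Proof.
pose f x := G x / pdf x.
have p0 x : pdf x != 0 by rewrite gt_eqF// pdf_gt0.
have dG x : is_derive x (1:R) G (u x).
  have x1 : x < x + 1 by rewrite ltrDl.
  have ix : mu.-integrable [set` Interval -oo%O (BRight (x + 1))] (EFin \o u) by exact: iuS.
  have [] := @continuous_FTC1 R u -oo%O x (x + 1) x1 ix _ (@cu x); first by rewrite ltNyr.
  by move=> d; rewrite derive1E => dE; split.
(* The Mills bound cancels the division by the density. *)
have xf x : `|x * f x| <= 1.
  rewrite /f mulrA normrM normfV ler_pdivrMr ?normr_gt0// mul1r normrM.
  rewrite [`|pdf x|]ger0_norm ?normal_pdf_ge0//.
  have -> : pdf x = pdf `|x| by rewrite !pdfE real_normK ?num_real.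
  apply: le_trans (gtail_mills (normr_ge0 x)).
  by rewrite ler_wpM2l.
have df x : is_derive x (1:R) f (h x - Nh + x * f x).
  have dp := is_derive_pdf x.
  have dV : is_derive x (1:R) (fun t => (pdf t)^-1) (x / pdf x).
    have /is_derive_eq := is_deriveV (p0 x) dp; apply.
    by rewrite /GRing.scale/=; field; exact: p0.
  apply: is_derive_eq; rewrite /GRing.scale/= /f /u; field.
  exact: p0.
exists f, (fun x => h x - Nh + x * f x); split => //.
- move=> x; apply: cvgD; first by apply: cvgB; [exact: ch|exact: cvg_cst].
  apply: cvgM; first exact: cvg_id.
  by have [d _] := df x; exact: derivable1_continuous d.
- by move=> x; rewrite addrK.
- move=> x; have [x1|x1] := leP 1 `|x|.
    apply: (@le_trans _ _ 1); last by rewrite lerDl invr_ge0 normal_pdf_ge0.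
    by apply: le_trans (xf x); rewrite [leRHS]normrM ler_peMl.
  apply: (@le_trans _ _ (pdf 1)^-1); last by rewrite lerDr.
  rewrite /f normrM normfV -[leRHS]mul1r; apply: ler_pM => //.
  - by apply: le_trans (Gtail x) _; exact: gtail_le1.
  - rewrite [`|pdf x|]ger0_norm ?normal_pdf_ge0// lef_pV2 ?posrE ?pdf_gt0//.
    rewrite !pdfE ler_wpM2l ?invr_ge0 ?sqrtr_ge0// ler_expR.
    have : `|x| ^+ 2 <= 1 by rewrite expr_le1// ltW.
    by rewrite real_normK ?num_real// expr1n => ?; lra.
- move=> x; apply: le_trans (ler_normD _ _) _.
  by have := hN x; have := xf x; lra.
Qed.

End solution.
End stein_solution.

(** * Total variation through continuous test functions *)

Section continuous_test.
Context {R : realType}.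
Local Notation TR := (measurableTypeR R).

(** Bounds by 0 and 1 make maxima and complements of test functions test
functions, mirroring unions and complements of sets. *)
Definition test_fun (h : R -> R) := continuous h /\ forall x, 0 <= h x <= 1.

Lemma measurable_test_fun h : test_fun h -> measurable_fun [set: TR] (h : TR -> TR).
Proof. by move=> [ch _]; exact: continuous_measurable_fun. Qed.

Section density.
Variable nu : {measure set TR -> \bar R}.
Hypothesis nufin : fin_num_fun nu.

(** Measurability is part of the property, so that the sets with it form a
sigma-algebra and the generators suffice. *)
Definition approx_by_test (A : set TR) := measurable A /\
  forall e : R, 0 < e -> exists2 h, test_fun h &
    (\int[nu]_x (`|\1_A x - h x|)%:E <= e%:E)%E.

Lemma measurable_approx (A : set TR) h : measurable A -> test_fun h ->
  measurable_fun [set: TR] (fun x => (`|\1_A x - h x|)%:E).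
Proof.
move=> mA th; apply/measurable_EFinP; apply: measurableT_comp => //.
by apply: measurable_funB => //; exact: measurable_test_fun.
Qed.

Lemma approx_set0 : approx_by_test set0.
Proof.
split=> // e e0; exists (fun=> 0).
  by split; [move=> x; exact: cvg_cst|move=> x; rewrite lexx ler01].
by rewrite integral0_eq ?lee_fin ?ltW// => x _; rewrite indicE in_set0 subrr normr0.
Qed.

Lemma approx_setC A : approx_by_test A -> approx_by_test (~` A).
Proof.
move=> [mA hA]; split; first exact: measurableC.
move=> e /hA[h [ch h01] hle]; exists (fun x => 1 - h x).
  split; first by move=> x; apply: cvgB; [exact: cvg_cst|exact: ch].
  by move=> x; have := h01 x; lra.
rewrite (eq_integral (fun x => (`|\1_A x - h x|)%:E))// => x _.
congr (_%:E); rewrite -normrN; congr (`|_|).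
by rewrite !indicE in_setC; case: (x \in A) => /=; lra.
Qed.

Lemma approx_setU A B : approx_by_test A -> approx_by_test B -> approx_by_test (A `|` B).
Proof.
move=> [mA hA] [mB hB]; split; first exact: measurableU.
move=> e e0; have e20 : 0 < e / 2 by rewrite divr_gt0.
have [h th hle] := hA _ e20; have [k tk kle] := hB _ e20.
have tm : test_fun (fun x => Num.max (h x) (k x)).
  have [ch h01] := th; have [ck k01] := tk.
  split; first by move=> x; apply: continuous_max; [exact: ch|exact: ck].
  by move=> x; have := h01 x; have := k01 x; case: (leP (h x) (k x)).
exists (fun x => Num.max (h x) (k x)) => //.
apply: (@le_trans _ _ (\int[nu]_x ((`|\1_A x - h x|)%:E + (`|\1_B x - k x|)%:E))%E).
  apply: ge0_le_integral => //.
  - by apply: measurable_approx => //; exact: measurableU.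
  - by apply: emeasurable_funD; exact: measurable_approx.
  move=> x _; rewrite -EFinD lee_fin !indicE in_setU.
  have [_ /(_ x)] := th; have [_ /(_ x)] := tk => /andP[k0 k1] /andP[h0 h1].
  have -> : `|(x \in A)%:R - h x| = if x \in A then 1 - h x else h x.
    by case: ifP => _; [rewrite /= mulr1n ger0_norm// subr_ge0|rewrite sub0r normrN ger0_norm].
  have -> : `|(x \in B)%:R - k x| = if x \in B then 1 - k x else k x.
    by case: ifP => _; [rewrite /= mulr1n ger0_norm// subr_ge0|rewrite sub0r normrN ger0_norm].
  rewrite ler_norml.
  by case: (x \in A); case: (x \in B); case: (leP (h x) (k x)) => /=; lra.
rewrite ge0_integralD//; try exact: measurable_approx.
by rewrite [e]splitr EFinD leeD.
Qed.

(** By continuity of the measure a finite union already has nearly full measure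
in the countable union. *)
Lemma approx_bigcup (F : (set TR)^nat) : (forall i, approx_by_test (F i)) ->
  approx_by_test (\bigcup_i F i).
Proof.
move=> hF; have mF i : measurable (F i) by have [] := hF i.
have mU : measurable (\bigcup_i F i) by exact: bigcupT_measurable.
split => // e e0; have e20 : 0 < e / 2 by rewrite divr_gt0.
(* Finite unions are approximable by induction. *)
pose G n := \big[setU/set0]_(i < n) F i.
have hG n : approx_by_test (G n).
  rewrite /G; elim: n => [|n IH]; first by rewrite big_ord0; exact: approx_set0.
  by rewrite big_ord_recr/=; exact: approx_setU.
have mG n : measurable (G n) by have [] := hG n.
have cG : nu (G n) @[n --> \oo] --> nu (\bigcup_i F i).
  have -> : \bigcup_i F i = \bigcup_n G n.
    apply/seteqP; split => [x [i _ Fx]|x [n _ Gx]]; last exact: bigsetU_bigcup Gx.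
    by exists i.+1 => //; rewrite /G big_ord_recr/=; right.
  apply: nondecreasing_cvg_mu => //; first exact: bigcupT_measurable.
  by move=> m n mn; apply/subsetPset; exact: subset_bigsetU.
have [n Gn] : exists n, (nu (\bigcup_i F i `\` G n) <= (e / 2)%:E)%E.
  have fU := nufin mU.
  move: cG; rewrite -(fineK fU) => /fine_cvgP[_ /cvgrPdist_le /(_ _ e20)[n _ /(_ n (leqnn _))]] /= h.
  exists n; rewrite measureD//; last by rewrite ltey_eq nufin.
  have -> : \bigcup_i F i `&` G n = G n.
    by apply/setIidPr; rewrite /G; exact: bigsetU_bigcup.
  rewrite -[X in (X - _)%E]fineK// -[X in (_ - X)%E]fineK ?nufin// -EFinB lee_fin.
  exact: le_trans (ler_norm _) h.
have [_ /(_ _ e20)[h th hle]] := hG n; exists h => //.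
apply: (@le_trans _ _ (\int[nu]_x ((\1_(\bigcup_i F i `\` G n) x)%:E + (`|\1_(G n) x - h x|)%:E))%E).
  apply: ge0_le_integral => //.
  - exact: measurable_approx.
  - apply: emeasurable_funD; last exact: measurable_approx.
    by apply/measurable_EFinP; apply: measurable_indic; exact: measurableD.
  move=> x _; rewrite -EFinD lee_fin !indicE in_setD.
  have GU : x \in G n -> x \in \bigcup_i F i by rewrite !inE; exact: bigsetU_bigcup.
  case: (boolP (x \in G n)) => [/GU ->|_] /=; first by rewrite add0r.
  rewrite andbT sub0r normrN; apply: le_trans (ler_normB _ _) _.
  by rewrite [`|_%:R|]ger0_norm.
rewrite ge0_integralD//; last 2 first.
- by apply/measurable_EFinP; apply: measurable_indic; exact: measurableD.
- exact: measurable_approx.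
rewrite integral_indic//; last exact: measurableD.
by rewrite setIT [e]splitr EFinD leeD.
Qed.

(** The ramps [min 1 (max 0 (k (x - a)))] converge pointwise to the indicator of
the ray; the ray has to be open for this to hold at [a]. *)
Lemma approx_oray (a : R) : approx_by_test `]a, +oo[.
Proof.
split; first exact: measurable_itv.
move=> e e0.
pose h (k : nat) (x : R) := Num.min 1 (Num.max 0 (k%:R * (x - a))).
have th k : test_fun (h k).
  split; last by move=> x; rewrite /h le_min ge_min le_max !lexx ler01.
  move=> x; apply: (@continuous_min _ _ (fun=> 1) (fun y : R => Num.max 0 (k%:R * (y - a)))); first exact: cvg_cst.
  apply: (@continuous_max _ _ (fun=> 0) (fun y : R => k%:R * (y - a))); first exact: cvg_cst.
  by apply: cvgM; [exact: cvg_cst|apply: cvgB; [exact: cvg_id|exact: cvg_cst]].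
pose f_ k (x : TR) : \bar R := (`|\1_(`]a, +oo[) x - h k x|)%:E.
have [] := @dominated_convergence _ _ _ nu _ measurableT f_ (cst 0%E) (cst 1%E).
- by move=> k; exact: measurable_approx.
- exact: measurable_cst.
- apply: aeW => x _; apply: cvg_near_cst.
  have [xa|xa] := leP x a.
    near=> k; rewrite /f_ indicE memNset/=; last by rewrite in_itv/= andbT; apply/negP; rewrite -leNgt.
    rewrite /h max_l; last by rewrite mulr_ge0_le0// subr_le0.
    by rewrite min_r ?ler01// subrr normr0.
  exists (Num.bound (x - a)^-1) => // k /= ka.
  rewrite /f_ indicE mem_set/=; last by rewrite in_itv/= andbT.
  have xa0 : 0 < x - a by rewrite subr_gt0.
  have kx : 1 <= k%:R * (x - a).
    rewrite -ler_pdivrMr// div1r.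
    have /archi_boundP/ltW/le_trans : 0 <= (x - a)^-1 by rewrite invr_ge0 ltW.
    by apply; rewrite ler_nat.
  by rewrite /h max_r ?(le_trans ler01)// min_l// subrr normr0.
- apply/integrableP; split; first exact: measurable_cst.
  by rewrite integral_cst//= normr1 mul1e ltey_eq nufin.
- apply: aeW => x k _; rewrite /f_ gee0_abs ?lee_fin//.
  have [_ /(_ x)] := th k; rewrite indicE ler_norml.
  by case: (_ \in _) => /=; lra.
move=> _ _; rewrite integral_cst// mul0e => /fine_cvgP[fn /cvgrPdist_le /(_ _ e0) H].
near \oo => k; exists (h k) => //.
have fk : (\int[nu]_x f_ k x)%E \is a fin_num by near: k.
rewrite -[leLHS]fineK// lee_fin.
have : `|0 - fine (\int[nu]_x f_ k x)%E| <= e by near: k.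
by rewrite sub0r normrN; apply: le_trans (ler_norm _).
Unshelve. all: by end_near. Qed.

Lemma approx_measurable (A : set TR) : measurable A -> approx_by_test A.
Proof.
rewrite RGenOInfty.measurableE; move: A.
apply: smallest_sub; last by move=> _ [x ->]; exact: approx_oray.
split; first exact: approx_set0.
- by move=> B hB; rewrite setTD; exact: approx_setC.
- exact: approx_bigcup.
Qed.

End density.

(** Approximate the indicator of a Borel set under the sum of the two laws, so
that the same test function is close to it for both. *)
Lemma tv_test_fun (P Q : probability TR R) (e : R) :
  (forall h, test_fun h -> `|\int[P]_x h x - \int[Q]_x h x| <= e) ->
  (tv_dist P Q <= e%:E)%E.
Proof.
move=> hPQ; apply: ge_ereal_sup => _ [A mA <-].
rewrite -[P A]fineK ?fin_num_measure// -[Q A]fineK ?fin_num_measure// -EFinB abse_EFin lee_fin.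
apply/ler_addgt0Pr => d d0.
have fPQ : fin_num_fun (measure_add P Q).
  by move=> B mB; rewrite measure_addE fin_numD !fin_num_measure.
have [_ /(_ _ d0)[h th hle]] := approx_measurable fPQ mA.
have bnd (S : probability TR R) : `|fine (S A) - \int[S]_x h x| <= fine (\int[S]_x (`|\1_A x - h x|)%:E)%E.
  have -> : fine (S A) = \int[S]_x (\1_A x) by rewrite /Rintegral integral_indic// setIT.
  have iA : S.-integrable [set: TR] (EFin \o \1_A) by exact: integrable_indic.
  have ih : S.-integrable [set: TR] (EFin \o h).
    apply: (@le_integrable _ _ _ S _ measurableT _ (EFin \o cst 1)).
    - by apply/measurable_EFinP; exact: measurable_test_fun.
    - move=> x _; rewrite lee_fin normr1; have [_ /(_ x)/andP[? ?]] := th.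
      by rewrite ger0_norm.
    - exact: finite_measure_integrable_cst.
  rewrite -RintegralB//; apply: le_normr_Rintegral => //.
  by apply: eq_integrable (integrableB measurableT iA ih).
have fin (S : probability TR R) : (\int[S]_x (`|\1_A x - h x|)%:E)%E \is a fin_num.
  rewrite ge0_fin_numE; last by apply: integral_ge0 => x _; rewrite lee_fin.
  apply: (@le_lt_trans _ _ (\int[S]_x (cst 1 x))%E); last first.
    by rewrite integral_cst//= probability_setT mul1e ltry.
  apply: ge0_le_integral => //; first exact: measurable_approx.
  move=> x _; rewrite lee_fin; have [_ /(_ x)] := th; rewrite indicE ler_norml.
  by case: (_ \in _) => /=; lra.
have : fine (\int[P]_x (`|\1_A x - h x|)%:E)%E + fine (\int[Q]_x (`|\1_A x - h x|)%:E)%E <= d.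
  rewrite -lee_fin EFinD !fineK//; move: hle.
  by rewrite ge0_integral_measure_add//; exact: measurable_approx.
have := bnd P; have := bnd Q; have := hPQ _ th.
rewrite !ler_norml => /andP[? ?] /andP[? ?] /andP[? ?] ?.
by apply/andP; split; lra.
Qed.

End continuous_test.

(** * Expectations under the standard Gaussian vector *)

Section gauss_expectation.
Context {R : realType}.
Local Notation TR := (measurableTypeR R).
Local Notation gam := (normal_prob (0:R) 1).

(** Multiplicative over the coordinates, so that its Gaussian integral factorizes
and freezing a coordinate only changes the constant in a bound. *)
Definition pweight (t : seq R) : R := \prod_(x <- t) (1 + x ^+ 2).

Lemma pweight_cons x t : pweight (x :: t) = (1 + x ^+ 2) * pweight t.
Proof. by rewrite /pweight big_cons. Qed.

Lemma pweight_ge1 t : 1 <= pweight t.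
Proof.
elim: t => [|x t IH]; first by rewrite /pweight big_nil.
by rewrite pweight_cons mulr_ege1// lerDl sqr_ge0.
Qed.

Lemma pweight_gt0 t : 0 < pweight t.
Proof. exact: lt_le_trans (pweight_ge1 t). Qed.

Lemma measurable_pweight d : measurable_fun [set: d.-tuple TR] (fun t : d.-tuple TR => pweight t : TR).
Proof.
rewrite [X in measurable_fun _ X](_ : _ = fun t : d.-tuple TR => \prod_(i < d) (1 + tnth t i ^+ 2)).
  apply: measurable_prod => i _; apply: measurable_funD => //.
  by apply: measurable_funX; exact: measurable_tnth.
by apply/funext => t; rewrite /pweight big_tuple.
Qed.

(** Measurable functions of polynomial growth: everything that is integrated
below belongs to this class, which is stable under algebra and under freezing a
coordinate. *)
Definition tame d (f : d.-tuple TR -> R) :=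
  measurable_fun [set: d.-tuple TR] (f : d.-tuple TR -> TR) /\
  exists C k, forall t, `|f t| <= C * pweight t ^+ k.

Lemma tame_le d (f g : d.-tuple TR -> R) : measurable_fun [set: d.-tuple TR] (f : d.-tuple TR -> TR) ->
  tame g -> (forall t, `|f t| <= g t) -> tame f.
Proof.
move=> mf [_ [C [k gC]]] fg; split => //; exists C, k => t.
by apply: le_trans (fg t) _; apply: le_trans (ler_norm _) (gC t).
Qed.

Lemma tame_bnd_ge0 d (f : d.-tuple TR -> R) C k : (forall t, `|f t| <= C * pweight t ^+ k) -> 0 <= C.
Proof.
move=> /(_ [tuple of nseq d 0]) h.
rewrite -(@pmulr_lge0 _ (pweight [tuple of nseq d 0] ^+ k)); first exact: le_trans h.
by rewrite exprn_gt0// pweight_gt0.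
Qed.

Lemma tame_cst d (c : R) : @tame d (fun=> c).
Proof. by split; [exact: measurable_cst|exists `|c|, 0%N => t; rewrite expr0 mulr1]. Qed.

Lemma tame_tnth d (i : 'I_d) : @tame d (fun t => tnth t i).
Proof.
split; first exact: measurable_tnth.
exists 1, 1%N => t; rewrite mul1r expr1.
have h x : `|x| <= 1 + x ^+ 2 :> R.
  have : 0 <= (`|x| - 1) ^+ 2 by exact: sqr_ge0.
  by rewrite -[x ^+ 2]real_normK ?num_real//; nra.
rewrite /pweight big_tuple (bigD1 i)//=; apply: le_trans (h _) _.
rewrite ler_peMr ?addr_ge0 ?sqr_ge0//.
elim/big_rec: _ => // j x _ x1.
by rewrite mulr_ege1// lerDl sqr_ge0.
Qed.

Lemma tameD d (f g : d.-tuple TR -> R) : tame f -> tame g -> tame (fun t => f t + g t).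
Proof.
move=> [mf [C [k fC]]] [mg [D [l gD]]]; split; first exact: measurable_funD.
have C0 := tame_bnd_ge0 fC; have D0 := tame_bnd_ge0 gD.
exists (C + D), (k + l)%N => t; have u1 := pweight_ge1 t; have u0 := pweight_gt0 t.
apply: le_trans (ler_normD _ _) _; rewrite mulrDl; apply: lerD.
  apply: le_trans (fC t) _; rewrite ler_wpM2l// exprD ler_peMr ?exprn_ege1//.
  by rewrite exprn_ge0// ltW.
apply: le_trans (gD t) _; rewrite ler_wpM2l// exprD ler_peMl ?exprn_ege1//.
by rewrite exprn_ge0// ltW.
Qed.

Lemma tameM d (f g : d.-tuple TR -> R) : tame f -> tame g -> tame (fun t => f t * g t).
Proof.
move=> [mf [C [k fC]]] [mg [D [l gD]]]; split; first exact: measurable_funM.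
exists (C * D), (k + l)%N => t.
by rewrite normrM exprD mulrACA ler_pM.
Qed.

Lemma tameZ d (c : R) (f : d.-tuple TR -> R) : tame f -> tame (fun t => c * f t).
Proof. by apply: tameM; exact: tame_cst. Qed.

Lemma tameN d (f : d.-tuple TR -> R) : tame f -> tame (fun t => - f t).
Proof. by move=> /(tameZ (-1)) h; under eq_fun do rewrite -mulN1r. Qed.

Lemma tameB d (f g : d.-tuple TR -> R) : tame f -> tame g -> tame (fun t => f t - g t).
Proof. by move=> tf tg; apply: tameD => //; exact: tameN. Qed.

Lemma tameX d (f : d.-tuple TR -> R) n : tame f -> tame (fun t => f t ^+ n).
Proof.
move=> tf; elim: n => [|n IH]; first exact: tame_cst.
by under eq_fun do rewrite exprS; exact: tameM.
Qed.

Lemma tame_sum d (I : Type) (r : seq I) (P : pred I) (F : I -> d.-tuple TR -> R) :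
  (forall i, P i -> tame (F i)) -> tame (fun t => \sum_(i <- r | P i) F i t).
Proof.
move=> tF; elim: r => [|i r IH]; first by under eq_fun do rewrite big_nil; exact: tame_cst.
have [Pi|/negbTE Pi] := boolP (P i); last by under eq_fun do rewrite big_cons Pi.
by under eq_fun do rewrite big_cons Pi; apply: tameD => //; exact: tF.
Qed.

Lemma tame_norm d (f : d.-tuple TR -> R) : tame f -> tame (fun t => `|f t|).
Proof.
move=> [mf [C [k fC]]]; split; first exact: measurableT_comp.
by exists C, k => t; rewrite normr_id.
Qed.

Lemma tame_max0 d (f : d.-tuple TR -> R) : tame f -> tame (fun t => Num.max (f t) 0).
Proof.
move=> tf; apply: tame_le (tame_norm tf) _.
  by case: tf => mf _; exact: measurable_funrpos.
by move=> t; case: (leP (f t) 0); rewrite ?normr0 ?lexx.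
Qed.

Lemma tame_sqrt d (f : d.-tuple TR -> R) : tame f -> tame (fun t => Num.sqrt (f t)).
Proof.
move=> tf; apply: (tame_le _ (tameD (tame_cst d 1) (tame_norm tf))).
  have ms : measurable_fun [set: R] (@Num.sqrt R) by apply: continuous_measurable_fun => x; exact: sqrt_continuous.
  by case: tf => mf _; exact: measurableT_comp ms mf.
move=> t; rewrite ger0_norm ?sqrtr_ge0//; have [f0|f0] := leP 0 (f t).
  have := sqr_sqrtr f0; have := sqrtr_ge0 (f t); set s := Num.sqrt _ => s0 sf.
  by rewrite ger0_norm// -sf; nra.
by rewrite ltr0_sqrtr// addr_ge0.
Qed.

Lemma tame_comp_bounded d (f : d.-tuple TR -> R) (h : R -> R) (K : R) : tame f ->
  measurable_fun [set: TR] (h : TR -> TR) -> (forall x, `|h x| <= K) -> tame (fun t => h (f t)).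
Proof.
move=> [mf _] mh hK; apply: tame_le (tame_cst d K) _ => //.
exact: measurableT_comp.
Qed.

Lemma tame_eq d (f g : d.-tuple TR -> R) : f =1 g -> tame f -> tame g.
Proof. by move=> /funext ->. Qed.

Lemma tame_slice d (f : d.+1.-tuple TR -> R) (x : R) : tame f -> tame (fun t : d.-tuple TR => f [tuple of x :: t]).
Proof.
move=> [mf [C [k fC]]]; split.
  by apply: measurableT_comp mf _; apply: measurable_cons.
exists (C * (1 + x ^+ 2) ^+ k), k => t.
by apply: le_trans (fC _) _; rewrite /= pweight_cons exprMn mulrA.
Qed.

Lemma pbound_slice d (f : d.+1.-tuple TR -> R) (t : d.-tuple TR) : tame f ->
  pbound (fun x : R => f [tuple of x :: t]).
Proof.
move=> [mf [C [k fC]]]; exists (C * pweight t ^+ k), k => x.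
by apply: le_trans (fC _) _; rewrite /= pweight_cons exprMn mulrAC mulrA.
Qed.

Lemma measurable_slice d (f : d.+1.-tuple TR -> R) (t : d.-tuple TR) : tame f ->
  measurable_fun [set: TR] (fun x : TR => f [tuple of x :: t] : TR).
Proof.
by move=> [mf _]; apply: measurableT_comp mf _; apply: measurable_cons.
Qed.

Lemma ge0_integral_gauss d (f : d.+1.-tuple TR -> \bar R) : measurable_fun setT f ->
  (forall t, 0 <= f t)%E ->
  (\int[std_gauss d.+1]_t f t = \int[gam]_x \int[std_gauss d]_t f [tuple of x :: t])%E.
Proof.
move=> mf f0 /=; rewrite ge0_integral_distribution// fubini_tonelli1//.
- by apply: measurableT_comp => //; exact: measurable_tcons.
- by move=> x; exact: f0.
Qed.

Lemma integral_pweight d k : (\int[std_gauss d]_t (pweight t ^+ k)%:E < +oo)%E.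
Proof.
elim: d => [|d IH].
  rewrite (eq_integral (cst 1%E)) ?integral_cst ?probability_setT ?mul1e ?ltry// => t _.
  by rewrite tuple0 /pweight big_nil expr1n.

rewrite ge0_integral_gauss; last 2 first.
- by apply/measurable_EFinP/measurable_funX; exact: measurable_pweight.
- by move=> t; rewrite lee_fin exprn_ge0// ltW// pweight_gt0.
have mpw : measurable_fun [set: d.-tuple TR] (fun t : d.-tuple TR => (pweight t ^+ k)%:E).
  by apply/measurable_EFinP/measurable_funX; exact: measurable_pweight.
have mp : measurable_fun [set: TR] (fun x : TR => (1 + x ^+ 2) ^+ k : TR).
  by apply: measurable_funX; apply: measurable_funD => //; exact: measurable_funX.
have u0 (x : R) : 0 <= (1 + x ^+ 2) ^+ k by rewrite exprn_ge0// addr_ge0 ?sqr_ge0.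
rewrite (eq_integral (fun x : TR => ((1 + (x : R) ^+ 2) ^+ k)%:E * \int[std_gauss d]_t (pweight t ^+ k)%:E)%E).
  rewrite ge0_integralZr//.
  - apply: lte_mul_pinfty => //.
    + by apply: integral_ge0 => x _; rewrite lee_fin.
    + rewrite ge0_fin_numE; last by apply: integral_ge0 => x _; rewrite lee_fin.
      have : gam.-integrable [set: R] (EFin \o (fun x : R => (1 + x ^+ 2) ^+ k)).
        by apply: integrable_pbound => //; exists 1, k => x; rewrite mul1r ger0_norm.
      by move/integrable_lty; apply.
  - exact/measurable_EFinP.
  - by move=> x _; rewrite lee_fin.
  - by apply: integral_ge0 => t _; rewrite lee_fin exprn_ge0// ltW// pweight_gt0.
move=> x _; rewrite -ge0_integralZl//.
- by apply: eq_integral => t _; rewrite /= pweight_cons exprMn EFinM.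
- by move=> t _; rewrite lee_fin exprn_ge0// ltW// pweight_gt0.
- by rewrite lee_fin.
Qed.

Lemma integrable_tame d (f : d.-tuple TR -> R) : tame f ->
  (std_gauss d).-integrable setT (EFin \o f).
Proof.
move=> [mf [C [k fC]]].
have C0 := tame_bnd_ge0 fC.
apply: (@le_integrable _ _ _ (std_gauss d) _ measurableT _ (fun t => C%:E * (pweight t ^+ k)%:E)%E).
- exact/measurable_EFinP.
- by move=> t _ /=; rewrite lee_fin; apply: le_trans (fC t) (ler_norm _).
apply: integrableZl => //; apply/integrableP; split.
  by apply/measurable_EFinP/measurable_funX; exact: measurable_pweight.
under eq_integral => t _ do rewrite gee0_abs ?lee_fin ?exprn_ge0 ?(ltW (pweight_gt0 _))//.
exact: integral_pweight.
Qed.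

Definition Ex d (f : d.-tuple TR -> R) : R := (\int[std_gauss d]_t f t)%R.

Lemma ExE d (f : d.-tuple TR -> R) : tame f -> (\int[std_gauss d]_t (f t)%:E = (Ex f)%:E)%E.
Proof. by move=> tf; rewrite /Ex /Rintegral fineK//; apply: integrable_fin_num => //; exact: integrable_tame. Qed.

Lemma ExD d (f g : d.-tuple TR -> R) : tame f -> tame g -> Ex (fun t => f t + g t) = Ex f + Ex g.
Proof. by move=> tf tg; rewrite /Ex RintegralD//; exact: integrable_tame. Qed.

Lemma ExB d (f g : d.-tuple TR -> R) : tame f -> tame g -> Ex (fun t => f t - g t) = Ex f - Ex g.
Proof. by move=> tf tg; rewrite /Ex RintegralB//; exact: integrable_tame. Qed.

Lemma ExZ d c (f : d.-tuple TR -> R) : tame f -> Ex (fun t => c * f t) = c * Ex f.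
Proof. by move=> tf; rewrite /Ex RintegralZl//; exact: integrable_tame. Qed.

Lemma Ex_cst d (c : R) : Ex (fun _ : d.-tuple TR => c) = c.
Proof. by rewrite /Ex Rintegral_cst//= probability_setT mulr1. Qed.

Lemma le_Ex d (f g : d.-tuple TR -> R) : tame f -> tame g -> (forall t, f t <= g t) -> Ex f <= Ex g.
Proof. by move=> tf tg fg; apply: le_Rintegral => //; exact: integrable_tame. Qed.

Lemma eq_Ex d (f g : d.-tuple TR -> R) : f =1 g -> Ex f = Ex g.
Proof. by move=> /funext ->. Qed.

Lemma Ex_ge0 d (f : d.-tuple TR -> R) : (forall t, 0 <= f t) -> 0 <= Ex f.
Proof. by move=> f0; apply: Rintegral_ge0 => t _; exact: f0. Qed.

Lemma Ex_sum d (I : Type) (r : seq I) (P : pred I) (F : I -> d.-tuple TR -> R) :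
  (forall i, P i -> tame (F i)) ->
  Ex (fun t => \sum_(i <- r | P i) F i t) = \sum_(i <- r | P i) Ex (F i).
Proof.
move=> tF; elim: r => [|i r IH].
  by under eq_Ex do rewrite big_nil; rewrite Ex_cst big_nil.
rewrite big_cons; under eq_Ex do rewrite big_cons; case: ifP => // Pi.
by rewrite ExD ?IH//; [exact: tF|exact: tame_sum].
Qed.

Lemma le_norm_Ex d (f : d.-tuple TR -> R) : tame f -> `|Ex f| <= Ex (fun t => `|f t|).
Proof. by move=> tf; apply: le_normr_Rintegral => //; exact: integrable_tame. Qed.

Lemma integrable_tcons d (f : d.+1.-tuple TR -> R) : tame f ->
  (gam \x std_gauss d)%E.-integrable setT (EFin \o f \o @tcons R d).
Proof.
move=> tf; have /integrableP[mf fi] := integrable_tame tf.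
have mfc : measurable_fun setT (EFin \o f \o @tcons R d).
  by apply: measurableT_comp => //; exact: measurable_tcons.
apply/integrableP; split => //; move: fi.
rewrite /= ge0_integral_distribution//.
apply/measurable_EFinP; apply: measurableT_comp => //; by case: tf.
Qed.

(** Fubini's theorem, with the first coordinate outermost; [Ex_consC] has it
innermost. *)
Lemma Ex_cons d (f : d.+1.-tuple TR -> R) : tame f ->
  Ex f = (\int[gam]_x Ex (fun t => f [tuple of x :: t]))%R.
Proof.
move=> tf; have ic := integrable_tcons tf.
rewrite /Ex {1}/Rintegral /= integral_distribution//; last first.
  by have /integrable_tame/measurable_int := tf.
rewrite -integral12_prod_meas1//; congr fine; apply: eq_integral => x _.
by rewrite /= -ExE//; exact: tame_slice.
Qed.

Lemma Ex_consC d (f : d.+1.-tuple TR -> R) : tame f ->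
  Ex f = Ex (fun t => (\int[gam]_x f [tuple of x :: t])%R).
Proof.
move=> tf; have ic := integrable_tcons tf.
rewrite /Ex {1}/Rintegral /= integral_distribution//; last first.
  by have /integrable_tame/measurable_int := tf.
rewrite -integral21_prod_meas1//; congr fine; apply: eq_integral => t _.
rewrite /= /Rintegral fineK//; apply: integrable_fin_num => //.
by apply: integrable_pbound; [exact: measurable_slice|exact: pbound_slice].
Qed.

Definition upd d (t : d.-tuple R) (i : 'I_d) (x : R) : d.-tuple R :=
  [tuple if j == i then x else tnth t j | j < d].

Lemma upd_cons0 d (t : d.-tuple R) (y x : R) : upd [tuple of y :: t] ord0 x = [tuple of x :: t].
Proof.
apply: eq_from_tnth => j; rewrite tnth_mktuple; case: (unliftP ord0 j) => [k ->|->].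
  by rewrite [_ == ord0]eq_sym (negbTE (neq_lift _ _)) !tnthS.
by rewrite eqxx tnth0.
Qed.

Lemma upd_consS d (t : d.-tuple R) (y x : R) (i : 'I_d) :
  upd [tuple of y :: t] (lift ord0 i) x = [tuple of y :: upd t i x].
Proof.
apply: eq_from_tnth => j; rewrite tnth_mktuple; case: (unliftP ord0 j) => [k ->|->].
  by rewrite (inj_eq lift_inj) !tnthS tnth_mktuple.
by rewrite (negbTE (neq_lift _ _)) !tnth0.
Qed.

(** Integrate over the coordinate [i] first.  The recursion on the dimension peels
off the coordinates that precede it, so the partial derivative is phrased
through [upd], the replacement of one coordinate. *)
Lemma Ex_ibp d (i : 'I_d) (g g' : d.-tuple TR -> R) : tame g -> tame g' ->
  (forall t (x : R), is_derive x (1:R) (fun y : R => g (upd t i y)) (g' (upd t i x))) ->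
  (forall t, continuous (fun x : R => g' (upd t i x))) ->
  Ex (fun t => tnth t i * g t) = Ex g'.
Proof.
elim: d i g g' => [[]//|d IH] i g g' tg tg' dg cg'.
have tig : tame (fun t => tnth t i * g t) by apply: tameM => //; exact: tame_tnth.
case: (unliftP ord0 i) => [j|] ij; rewrite {}ij in tig dg cg' *.
  rewrite Ex_cons// [RHS]Ex_cons//; apply: eq_Rintegral => x _.
  under eq_Ex do rewrite tnthS.
  apply: IH => //; try exact: tame_slice.
  - move=> t y; have := dg [tuple of x :: t] y; rewrite upd_consS.
    by under eq_fun do rewrite upd_consS.
  - by move=> t; have := cg' [tuple of x :: t]; under eq_fun do rewrite upd_consS.
rewrite Ex_consC// [RHS]Ex_consC//; apply: eq_Ex => t.
apply: etrans (esym (@normal_ibp _ (fun x => g [tuple of x :: t]) (fun x => g' [tuple of x :: t]) _ _ _ _)).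
- by apply: eq_Rintegral => x _; rewrite tnth0.
- move=> x; have := dg [tuple of 0 :: t] x; rewrite upd_cons0.
  by under eq_fun do rewrite upd_cons0.
- by have := cg' [tuple of 0 :: t]; under eq_fun do rewrite upd_cons0.
- exact: pbound_slice.
- exact: pbound_slice.
Qed.

End gauss_expectation.

(** * The squared norm of the projection onto a cone *)

Section projection_geometry.
Context {R : realType} {d : nat}.
Implicit Types x y z v h : 'rV[R]_d.

Definition dot x y : R := \sum_(i < d) x 0 i * y 0 i.

Lemma dotC x y : dot x y = dot y x.
Proof. by apply: eq_bigr => i _; rewrite mulrC. Qed.

Lemma dotDl x y z : dot (x + y) z = dot x z + dot y z.
Proof. by rewrite -big_split; apply: eq_bigr => i _; rewrite !mxE mulrDl. Qed.

Lemma dotNl x z : dot (- x) z = - dot x z.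
Proof. by rewrite -sumrN; apply: eq_bigr => i _; rewrite !mxE mulNr. Qed.

Lemma dotBl x y z : dot (x - y) z = dot x z - dot y z.
Proof. by rewrite dotDl dotNl. Qed.

Lemma dotDr x y z : dot z (x + y) = dot z x + dot z y.
Proof. by rewrite dotC dotDl ![dot _ z]dotC. Qed.

Lemma dotBr x y z : dot z (x - y) = dot z x - dot z y.
Proof. by rewrite dotC dotBl ![dot _ z]dotC. Qed.

Lemma dot_ge0 x : 0 <= dot x x.
Proof. by apply: sumr_ge0 => i _; rewrite -expr2 sqr_ge0. Qed.

Lemma dot_eq0 x : dot x x = 0 -> x = 0.
Proof.
move=> /eqP; rewrite psumr_eq0 => [/allP h|i _]; last by rewrite -expr2 sqr_ge0.
apply/rowP => i; rewrite mxE; apply/eqP.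
by have := h i (mem_index_enum _); rewrite /= mulf_eq0 orbb.
Qed.

Lemma enorm_sqr x : enorm x ^+ 2 = dot x x.
Proof.
rewrite sqr_sqrtr; first by apply: eq_bigr => i _; rewrite expr2.
by apply: sumr_ge0 => i _; rewrite sqr_ge0.
Qed.

Lemma dot_delta (w : R) (i : 'I_d) y : dot (w *: delta_mx 0 i) y = w * y 0 i.
Proof.
rewrite /dot (bigD1 i)//= !mxE !eqxx mulr1 big1 ?addr0// => j ji.
by rewrite !mxE eqxx (negbTE ji) mulr0 mul0r.
Qed.

Lemma sqr_coord_le x i : x 0 i ^+ 2 <= dot x x.
Proof.
rewrite /dot (bigD1 i)//= -expr2 lerDl; apply: sumr_ge0 => j _.
by rewrite -expr2 sqr_ge0.
Qed.

(** Moreau's characterization of the projection onto a convex cone: the residual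
is orthogonal to the projection and lies in the polar cone.  Such a map is the
metric projection ([metric_projE]) and can be checked by computation. *)
Definition cone_projector (K : set 'rV[R]_d) (P : 'rV[R]_d -> 'rV[R]_d) :=
  forall y, [/\ K (P y), dot (y - P y) (P y) = 0 & forall v, K v -> dot (y - P y) v <= 0].

Section with_projector.
Variables (K : set 'rV[R]_d) (P : 'rV[R]_d -> 'rV[R]_d).
Hypothesis KP : cone_projector K P.

(** Expand [y - v = (y - P y) + (P y - v)]; the cross term is nonnegative by the
polar condition. *)
Lemma projector_dist y v : K v ->
  dot (y - P y) (y - P y) + dot (P y - v) (P y - v) <= dot (y - v) (y - v).
Proof.
move=> Kv; have [_ h0 /(_ _ Kv) hv] := KP y.
have -> : y - v = (y - P y) + (P y - v) by rewrite addrA subrK.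
move: (dotBr (P y) v (y - P y)); move: (y - P y) (P y - v) h0 hv => u b h0 hv ub.
rewrite !dotDl !dotDr [dot b u]dotC.
by lra.
Qed.

Lemma metric_projE y : metric_proj K y = P y.
Proof.
rewrite /metric_proj; case: xgetP => [x _ [Kx hx]|/(_ (P y)) []]; last first.
  have [KPy _ _] := KP y; split => // z Kz.
  rewrite -(@ler_pXn2r _ 2)// ?nnegrE ?sqrtr_ge0// !enorm_sqr.
  by have := projector_dist y Kz; have := dot_ge0 (P y - z); lra.
have [KPy _ _] := KP y.
have := hx _ KPy; rewrite -(@ler_pXn2r _ 2)// ?nnegrE ?sqrtr_ge0// !enorm_sqr => h1.
have h2 := projector_dist y Kx; have h3 := dot_ge0 (P y - x).
by apply/esym/eqP; rewrite -subr_eq0; apply/eqP/dot_eq0; lra.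
Qed.

Lemma lrt_statE y : lrt_stat K y = dot (P y) (P y).
Proof.
have [_ h0 _] := KP y.
rewrite /lrt_stat metric_projE !enorm_sqr -[X in dot X X - _](subrK (P y)).
by move: (y - P y) h0 => u h0; rewrite dotDl !dotDr [dot (P y) u]dotC h0; lra.
Qed.

Lemma lrt_stat_sup y v : K v -> 2 * dot y v - dot v v <= lrt_stat K y.
Proof.
move=> Kv; have [_ h0 _] := KP y; have := projector_dist y Kv.
have := dot_ge0 (P y - v); move: h0.
rewrite lrt_statE !(dotBl, dotBr) [dot v y]dotC [dot (P y) y]dotC ![dot (P y) v]dotC.
by lra.
Qed.

Lemma lrt_stat_dual y : 2 * dot y (P y) - dot (P y) (P y) = lrt_stat K y.
Proof. by have [_ + _] := KP y; rewrite lrt_statE dotBl; lra. Qed.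

(** The statistic is the supremum over [v] in the cone of the affine functions
[2 < y, v > - < v, v >] of [y], attained at [P y]; at [y + h] the value of the
member with [v = P y] is a lower bound. *)
Lemma lrt_stat_lb y h : lrt_stat K y + 2 * dot h (P y) <= lrt_stat K (y + h).
Proof.
have [KPy _ _] := KP y; have := lrt_stat_sup (y + h) KPy.
have := lrt_stat_dual y; rewrite dotDl.
by move: (lrt_stat K y) (lrt_stat K (y + h)) => ? ?; lra.
Qed.

Lemma lrt_stat_ub y h : lrt_stat K (y + h) <= lrt_stat K y + 2 * dot h (P (y + h)).
Proof.
have [KPy _ _] := KP (y + h); have := lrt_stat_sup y KPy.
have := lrt_stat_dual (y + h); rewrite dotDl.
by move: (lrt_stat K y) (lrt_stat K (y + h)) => ? ?; lra.
Qed.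

(** Firm nonexpansiveness, by adding the four Moreau relations at [x] and
[y]. *)
Lemma projector_monotone x y : dot (P x - P y) (P x - P y) <= dot (x - y) (P x - P y).
Proof.
have [Kx x0 hx] := KP x; have [Ky y0 hy] := KP y.
move: x0 y0 (hx _ Ky) (hy _ Kx); rewrite !(dotBl, dotBr) ![dot (P y) (P x)]dotC.
by lra.
Qed.

Lemma projector_coord_lip y (w : R) i :
  `|P (y + w *: delta_mx 0 i) 0 i - P y 0 i| <= `|w|.
Proof.
have := projector_monotone (y + w *: delta_mx 0 i) y.
rewrite addrAC subrr add0r dot_delta !mxE.
have := sqr_coord_le (P (y + w *: delta_mx 0 i) - P y) i; rewrite !mxE.
set u := _ - P y 0 i => h1 h2.
have : u ^+ 2 <= `|w| * `|u|.
  by apply: le_trans h1 _; apply: le_trans h2 _; rewrite -normrM ler_norm.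
rewrite -[u ^+ 2]real_normK ?num_real// expr2.
have [->//|u0] := eqVneq u 0; first by rewrite normr0 normr_ge0.
by rewrite ler_pM2r// normr_gt0.
Qed.

(** The two tangent bounds differ by [2 w (P (y + w e_i) - P y)_i], which is at
most [2 w ^ 2] because the projection is nonexpansive. *)
Lemma is_derive_lrt_stat y i (x : R) :
  is_derive x (1:R) (fun w : R => lrt_stat K (y + w *: delta_mx 0 i))
    (2 * P (y + x *: delta_mx 0 i) 0 i).
Proof.
set T := (fun w : R => _); set D := 2 * _.
have TD w : `|T (x + w) - T x - w * D| <= 2 * w ^+ 2.
  have e1 : y + (x + w) *: delta_mx 0 i = y + x *: delta_mx 0 i + w *: delta_mx 0 i.
    by rewrite scalerDl addrA.
  have := lrt_stat_lb (y + x *: delta_mx 0 i) (w *: delta_mx 0 i).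
  have := lrt_stat_ub (y + x *: delta_mx 0 i) (w *: delta_mx 0 i).
  have := projector_coord_lip (y + x *: delta_mx 0 i) w i.
  rewrite -e1 !dot_delta -/(T _) -/(T _) /D.
  set p := P _ 0 i; set q := P _ 0 i => pq h1 h2.
  have : `|w * (p - q)| <= w ^+ 2.
    by rewrite normrM -[w ^+ 2]real_normK ?num_real// expr2 ler_wpM2l.
  rewrite mulrBr [w * (2 * q)]mulrCA; move: h1 h2.
  move: (T _) (T _) (w * p) (w * q) (w ^+ 2) => a b c e f h1 h2.
  by rewrite !ler_norml => /andP[? ?]; apply/andP; split; lra.
suff cv : w^-1 *: (T (w *: 1 + x) - T x) @[w --> 0^'] --> D.
  split; first by apply/cvg_ex; exists D.
  by apply/cvg_lim.
apply/cvgrPdist_le => e e0; near=> w.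
have w0 : w != 0 by near: w; exact: nbhs_dnbhs_neq.
have -> : D - w^-1 *: (T (w *: 1 + x) - T x) = - (w^-1 * (T (x + w) - T x - w * D)).
  rewrite /GRing.scale/= mulr1 (addrC w x).
  by move: (T _ - T _) => A; rewrite mulrBr (mulKf w0) opprB.
rewrite normrN normrM normfV ler_pdivrMl ?normr_gt0//; apply: le_trans (TD w) _.
rewrite -[w ^+ 2]real_normK ?num_real// expr2 mulrA [leRHS]mulrC ler_wpM2r//.
have : `|w| <= e / 2.
  near: w; apply: dnbhs0_le; by rewrite divr_gt0.
by lra.
Unshelve. all: by end_near. Qed.

Lemma continuous_projector_coord y i :
  continuous (fun w : R => P (y + w *: delta_mx 0 i) 0 i).
Proof.
move=> x; apply/cvgrPdist_le => e e0; exists e => // w /= /ltW xw.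
have -> : y + w *: delta_mx 0 i = y + x *: delta_mx 0 i + (w - x) *: delta_mx 0 i.
  by rewrite -addrA -scalerDl subrKC.
rewrite distrC; apply: le_trans (projector_coord_lip _ _ _) _.
by rewrite distrC.
Qed.

End with_projector.
End projection_geometry.

Lemma sum_cauchy_schwarz (R : realType) (I : finType) (A : pred I) (x y : I -> R) :
  \sum_(i | A i) x i * y i <=
    Num.sqrt (\sum_(i | A i) x i ^+ 2) * Num.sqrt (\sum_(i | A i) y i ^+ 2).
Proof.
set X := \sum_(i | A i) x i ^+ 2; set Y := \sum_(i | A i) y i ^+ 2; set C := \sum_(i | A i) _.
have X0 : 0 <= X by apply: sumr_ge0 => i _; exact: sqr_ge0.
have Y0 : 0 <= Y by apply: sumr_ge0 => i _; exact: sqr_ge0.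
have h : 0 <= Y * (X * Y - C ^+ 2).
  have -> : Y * (X * Y - C ^+ 2) = \sum_(i | A i) (Y * x i - C * y i) ^+ 2.
    rewrite (eq_bigr (fun i => Y ^+ 2 * x i ^+ 2 - 2 * Y * C * (x i * y i) + C ^+ 2 * y i ^+ 2)).
      by rewrite big_split/= sumrB -!mulr_sumr -/X -/Y -/C; ring.
    by move=> i _; ring.
  by apply: sumr_ge0 => i _; exact: sqr_ge0.
apply: le_trans (ler_norm _) _; rewrite -sqrtrM// -sqrtr_sqr ler_wsqrtr//.
have [Yp|Yn] := ltP 0 Y; first by rewrite pmulr_rge0// in h; lra.
have Y00 : Y = 0 by apply/eqP; rewrite eq_le Yn Y0.
suff -> : C = 0 by rewrite expr0n mulr_ge0.
apply: big1 => i Ai; have /eqP := Y00.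
rewrite psumr_eq0 => [/allP/(_ i (mem_index_enum _))|j _]; last exact: sqr_ge0.
by rewrite Ai sqrf_eq0 => /eqP ->; rewrite mulr0.
Qed.

(** * The planar projection onto a sector *)

Section planar.
Context {R : realType}.
Variables c s : R.
Hypotheses (c0 : 0 < c) (s0 : 0 < s) (cs : c ^+ 2 + s ^+ 2 = 1).

(** Coordinates of [(a, r)] in the orthonormal frame made of the boundary ray
[(c, s)] of the sector and of its inner normal [(s, - c)]. *)
Definition ray_coord (a r : R) := a * c + r * s.
Definition nrm_coord (a r : R) := a * s - r * c.
Definition rayp a r := Num.max (ray_coord a r) 0.
Definition nrmp a r := Num.max (nrm_coord a r) 0.
(** [(axis_part, rad_part)] is the projection of [(a, r)] onto the quadrant spanned
by the ray and the inner normal.  For [0 <= r] this agrees with the projection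
onto the sector where [0 <= vr] and [c vr <= s v0]. *)
Definition axis_part a r := rayp a r * c + nrmp a r * s.
Definition rad_part a r := rayp a r * s - nrmp a r * c.

Lemma rayp_ge0 a r : 0 <= rayp a r. Proof. by rewrite /rayp le_max lexx orbT. Qed.
Lemma nrmp_ge0 a r : 0 <= nrmp a r. Proof. by rewrite /nrmp le_max lexx orbT. Qed.

Let ccP a : a * c * c + a * s * s = a.
Proof. by rewrite -!mulrA -!expr2 -mulrDr cs mulr1. Qed.

Lemma coord_axis a r : ray_coord a r * c + nrm_coord a r * s = a.
Proof. by rewrite /ray_coord /nrm_coord -[RHS]ccP; ring. Qed.

Lemma coord_rad a r : ray_coord a r * s - nrm_coord a r * c = r.
Proof. by rewrite /ray_coord /nrm_coord -[RHS]ccP; ring. Qed.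

(** As [r = ray_coord s - nrm_coord c] is nonnegative, [nrm_coord] cannot be
positive while [ray_coord] is nonpositive; in the other cases [rad_part] is
[0], [r], or [r] minus a nonnegative term. *)
Lemma rad_part_bounds a r : 0 <= r -> 0 <= rad_part a r <= r.
Proof.
move=> r0; have ha := coord_axis a r; have hr := coord_rad a r.
rewrite /rad_part /rayp /nrmp.
case: (leP (ray_coord a r) 0) => h1; case: (leP (nrm_coord a r) 0) => h2; rewrite ?mul0r.
- by rewrite subrr lexx r0.
- exfalso; have : r < 0.
    by rewrite -hr subr_lt0; apply: le_lt_trans (_ : 0 < _); rewrite ?mulr_le0_ge0 ?mulr_gt0// ltW.
  by rewrite ltNge r0.
- rewrite subr0; apply/andP; split; first by rewrite mulr_ge0// ltW.
  by rewrite -[leRHS]hr lerBrDr gerDl mulr_le0_ge0// ltW.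
- by rewrite hr lexx r0.
Qed.

Lemma planar_norm a r : axis_part a r ^+ 2 + rad_part a r ^+ 2 = rayp a r ^+ 2 + nrmp a r ^+ 2.
Proof.
rewrite /axis_part /rad_part; set x := rayp a r; set y := nrmp a r.
transitivity ((x ^+ 2 + y ^+ 2) * (c ^+ 2 + s ^+ 2)); first by ring.
by rewrite cs mulr1.
Qed.

Lemma axis_part_ge0 a r : 0 <= axis_part a r.
Proof. by rewrite addr_ge0// mulr_ge0 ?rayp_ge0 ?nrmp_ge0 ?ltW. Qed.

Lemma planar_in_cone a r : 0 <= r -> c * rad_part a r <= s * axis_part a r.
Proof.
move=> r0; rewrite -subr_ge0.
have -> : s * axis_part a r - c * rad_part a r = nrmp a r * (c ^+ 2 + s ^+ 2).
  by rewrite /axis_part /rad_part; ring.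
by rewrite cs mulr1 nrmp_ge0.
Qed.

Lemma pos_neg_prod (x : R) : Num.max x 0 * (x - Num.max x 0) = 0.
Proof. by case: (leP x 0) => _; rewrite ?mul0r// subrr mulr0. Qed.

Lemma planar_orth a r : (a - axis_part a r) * axis_part a r + (r - rad_part a r) * rad_part a r = 0.
Proof.
have h1 : rayp a r * (ray_coord a r - rayp a r) = 0 := pos_neg_prod _.
have h2 : nrmp a r * (nrm_coord a r - nrmp a r) = 0 := pos_neg_prod _.
have := coord_rad a r; have := coord_axis a r; rewrite /axis_part /rad_part.
move: (rayp a r) (nrmp a r) (ray_coord a r) (nrm_coord a r) h1 h2 => x y u v h1 h2 <- <-.
transitivity ((x * (u - x) + y * (v - y)) * (c ^+ 2 + s ^+ 2)); first by ring.
by rewrite h1 h2 addr0 mul0r.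
Qed.

(** Move the radial component of [v] up to the boundary ray, which is allowed since
[rad_part <= r]; on the ray the residual has nonpositive component, because
[ray_coord <= rayp]. *)
Lemma planar_polar a r v0 vr : 0 <= r -> 0 <= v0 -> 0 <= vr -> c * vr <= s * v0 ->
  (a - axis_part a r) * v0 + (r - rad_part a r) * vr <= 0.
Proof.
move=> r0 hv0 hvr hcv.
have /andP[e0 er] := rad_part_bounds a r0.
rewrite -(pmulr_rle0 _ c0).
have -> : c * ((a - axis_part a r) * v0 + (r - rad_part a r) * vr) =
  c * (a - axis_part a r) * v0 + (r - rad_part a r) * (c * vr) by ring.
have : (r - rad_part a r) * (c * vr) <= (r - rad_part a r) * (s * v0).
  by apply: ler_wpM2l => //; rewrite subr_ge0.
have : c * (a - axis_part a r) + (r - rad_part a r) * s <= 0.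
  have : ray_coord a r <= rayp a r by rewrite /rayp le_max lexx.
  have := coord_rad a r; have := coord_axis a r; rewrite /axis_part /rad_part.
  move: (rayp a r) (nrmp a r) (ray_coord a r) (nrm_coord a r) => x y u v <- <- ux.
  have -> : c * (u * c + v * s - (x * c + y * s)) + (u * s - v * c - (x * s - y * c)) * s = (u - x) * (c ^+ 2 + s ^+ 2) by ring.
  by rewrite cs mulr1 subr_le0.
by move: (_ * (a - _)) (r - _) => A B h1 h2; nra.
Qed.

End planar.

(** * Circular cones on a block of coordinates *)

Section circular_cone.
Context {R : realType} {p : nat}.
Variables (c s : R) (J : {set 'I_p.+1}).
Hypotheses (c0 : 0 < c) (s0 : 0 < s) (cs : c ^+ 2 + s ^+ 2 = 1) (J0 : ord0 \notin J).
Implicit Types y v : 'rV[R]_p.+1.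

Definition radJ y := Num.sqrt (\sum_(j in J) y 0 j ^+ 2).
Definition restJ : {set 'I_p.+1} := ~: (ord0 |: J).
(** The cone constrains only the coordinates in [ord0] and [J].  Both cones of the
theorem have this shape, and they differ only in [restJ]. *)
Definition coneJ : set 'rV[R]_p.+1 :=
  [set v | Num.sqrt (v 0 ord0 ^+ 2 + \sum_(j in J) v 0 j ^+ 2) * c <= v 0 ord0].
(** When [radJ y = 0] the ratio is [0], with the convention [x / 0 = 0], which is the
right value since all the coordinates in [J] then vanish. *)
Definition projJ y : 'rV[R]_p.+1 :=
  \row_i if i == ord0 then axis_part c s (y 0 ord0) (radJ y)
         else if i \in J then rad_part c s (y 0 ord0) (radJ y) / radJ y * y 0 i
         else y 0 i.

Lemma sum_splitJ (F : 'I_p.+1 -> R) :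
  \sum_i F i = F ord0 + \sum_(j in J) F j + \sum_(j in restJ) F j.
Proof.
rewrite (bigID (mem (ord0 |: J)))/= big_setU1//=; congr (_ + _).
by apply: eq_bigl => i; rewrite /restJ finset.in_setC.
Qed.

Lemma radJ_ge0 y : 0 <= radJ y. Proof. exact: sqrtr_ge0. Qed.

Lemma radJ_sqr y : radJ y ^+ 2 = \sum_(j in J) y 0 j ^+ 2.
Proof. by rewrite sqr_sqrtr// sumr_ge0// => j _; rewrite sqr_ge0. Qed.

Lemma projJ_0 y : projJ y 0 ord0 = axis_part c s (y 0 ord0) (radJ y).
Proof. by rewrite mxE eqxx. Qed.

Lemma neq_0J j : j \in J -> (j == ord0) = false.
Proof. by apply: contraTF => /eqP ->. Qed.

Lemma projJ_J y j : j \in J ->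
  projJ y 0 j = rad_part c s (y 0 ord0) (radJ y) / radJ y * y 0 j.
Proof. by move=> jJ; rewrite mxE neq_0J// jJ. Qed.

Lemma projJ_rest y j : j \in restJ -> projJ y 0 j = y 0 j.
Proof. by rewrite inE in_setU1 negb_or mxE => /andP[/negbTE -> /negbTE ->]. Qed.

Lemma rad_ratio y : rad_part c s (y 0 ord0) (radJ y) / radJ y * radJ y = rad_part c s (y 0 ord0) (radJ y).
Proof.
have [r0|r0] := eqVneq (radJ y) 0; last by rewrite divfK.
have := rad_part_bounds c0 s0 cs (y 0 ord0) (radJ_ge0 y).
by rewrite r0 mulr0 => /le_anti.
Qed.

Lemma rad_ratio_bounds y : 0 <= rad_part c s (y 0 ord0) (radJ y) / radJ y <= 1.
Proof.
have /andP[h1 h2] := rad_part_bounds c0 s0 cs (y 0 ord0) (radJ_ge0 y).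
have [r0|r0] := eqVneq (radJ y) 0; first by rewrite r0 invr0 mulr0 lexx ler01.
have rp : 0 < radJ y by rewrite lt_def r0 radJ_ge0.
by rewrite divr_ge0 ?radJ_ge0//= ler_pdivrMr// mul1r.
Qed.

Lemma sum_projJ_y y : \sum_(j in J) y 0 j * projJ y 0 j = radJ y * rad_part c s (y 0 ord0) (radJ y).
Proof.
rewrite -[in RHS]rad_ratio mulrCA -expr2 radJ_sqr mulr_sumr.
by apply: eq_bigr => j jJ; rewrite projJ_J// mulrCA.
Qed.

Lemma sum_projJ_sqr y : \sum_(j in J) projJ y 0 j ^+ 2 = rad_part c s (y 0 ord0) (radJ y) ^+ 2.
Proof.
rewrite -[in RHS]rad_ratio exprMn radJ_sqr mulr_sumr.
by apply: eq_bigr => j jJ; rewrite projJ_J// exprMn.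
Qed.

Lemma coneJ_coord v : coneJ v -> 0 <= v 0 ord0 /\ c * radJ v <= s * v 0 ord0.
Proof.
rewrite /coneJ/= => h.
have v0 : 0 <= v 0 ord0 by apply: le_trans h; rewrite mulr_ge0 ?sqrtr_ge0 ?ltW.
split => //.
rewrite -(@ler_pXn2r _ 2)// ?nnegrE ?mulr_ge0 ?sqrtr_ge0 ?(ltW c0) ?(ltW s0)//.
move: h; rewrite -(@ler_pXn2r _ 2)// ?nnegrE ?mulr_ge0 ?sqrtr_ge0 ?(ltW c0) ?(ltW s0)//.
rewrite !exprMn sqr_sqrtr -?radJ_sqr ?addr_ge0 ?sqr_ge0//.
have -> : s ^+ 2 = 1 - c ^+ 2 by rewrite -cs; ring.
by move: (v 0 ord0 ^+ 2) (radJ v ^+ 2) (c ^+ 2) => ? ? ?; nra.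
Qed.

(** Since [c ^ 2 + s ^ 2 = 1], comparing the norm times [c] with [v_0] amounts to comparing
[c r] with [s v_0]. *)
Lemma coneJP v : 0 <= v 0 ord0 -> c * radJ v <= s * v 0 ord0 -> coneJ v.
Proof.
move=> v0; rewrite /coneJ/= -(@ler_pXn2r _ 2)// ?nnegrE ?mulr_ge0 ?sqrtr_ge0 ?(ltW c0) ?(ltW s0)// => h.
have : (c * radJ v) ^+ 2 <= (s * v 0 ord0) ^+ 2.
  by rewrite ler_pXn2r// nnegrE mulr_ge0 ?sqrtr_ge0 ?(ltW c0) ?(ltW s0).
have q0 : 0 <= v 0 ord0 ^+ 2 + \sum_(j in J) v 0 j ^+ 2.
  by rewrite -radJ_sqr addr_ge0 ?sqr_ge0.
rewrite !exprMn (sqr_sqrtr q0) -radJ_sqr.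
have -> : s ^+ 2 = 1 - c ^+ 2 by rewrite -cs; ring.
by move: (v 0 ord0 ^+ 2) (radJ v ^+ 2) (c ^+ 2) => ? ? ?; nra.
Qed.

(** The planar facts, transferred to the block [J] by the Cauchy-Schwarz inequality:
the residual on [J] is a nonnegative multiple of [y]. *)
Lemma projJP : cone_projector coneJ projJ.
Proof.
move=> y; have r0 := radJ_ge0 y; set a := y 0 ord0.
have erad : radJ (projJ y) = rad_part c s a (radJ y).
  rewrite {1}/radJ sum_projJ_sqr sqrtr_sqr ger0_norm//.
  by have /andP[] := rad_part_bounds c0 s0 cs a r0.
split.
- apply: coneJP; rewrite projJ_0; first exact: axis_part_ge0.
  by rewrite erad planar_in_cone.
- rewrite dotBl /dot !sum_splitJ projJ_0 sum_projJ_y.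
  rewrite [X in _ + X + _ - _]mulrC.
  have -> : \sum_(j in J) projJ y 0 j * projJ y 0 j = rad_part c s a (radJ y) ^+ 2.
    by rewrite -sum_projJ_sqr; apply: eq_bigr => j _; rewrite expr2.
  have -> : \sum_(j in restJ) y 0 j * projJ y 0 j = \sum_(j in restJ) projJ y 0 j * projJ y 0 j.
    by apply: eq_bigr => j jr; rewrite projJ_rest.
  by have := planar_orth cs a (radJ y); rewrite -/a; lra.
- move=> v /coneJ_coord[v0 cv].
  rewrite dotBl /dot !sum_splitJ projJ_0.
  have -> : \sum_(j in restJ) projJ y 0 j * v 0 j = \sum_(j in restJ) y 0 j * v 0 j.
    by apply: eq_bigr => j jr; rewrite projJ_rest.
  have -> : \sum_(j in J) projJ y 0 j * v 0 j =
      rad_part c s a (radJ y) / radJ y * \sum_(j in J) y 0 j * v 0 j.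
    by rewrite mulr_sumr; apply: eq_bigr => j jJ; rewrite projJ_J// mulrA.
  have /andP[q0 q1] := rad_ratio_bounds y; rewrite -/a in q0 q1.
  (* The residual on [J] is [(1 - q) y] with [0 <= 1 - q]. *)
  have CS := sum_cauchy_schwarz (mem J) (fun j => y 0 j) (fun j => v 0 j).
  have h := planar_polar c0 s0 cs a r0 v0 (radJ_ge0 v) cv.
  have e := rad_ratio y; rewrite -/a in e.
  rewrite -e in h; move: h CS; rewrite -/(radJ y) -/(radJ v) -/a.
  move: (rad_part _ _ _ _ / _) q0 q1 => q q0 q1.
  have -> : radJ y - q * radJ y = (1 - q) * radJ y by ring.
  set S := \sum_(i | _) _; set r := radJ y; set w := radJ v => h CS.
  have : (1 - q) * S <= (1 - q) * (r * w) by apply: ler_wpM2l => //; rewrite subr_ge0.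
  move=> h1; have : (a - axis_part c s a r) * v 0 ord0 + (1 - q) * S <= 0.
    by apply: le_trans h; rewrite lerD2l -mulrA.
  by rewrite !mulrBl mul1r -/a -/r; lra.
Qed.

Lemma lrt_stat_coneJ y : lrt_stat coneJ y =
  rayp c s (y 0 ord0) (radJ y) ^+ 2 + nrmp c s (y 0 ord0) (radJ y) ^+ 2 + \sum_(j in restJ) y 0 j ^+ 2.
Proof.
rewrite (lrt_statE projJP) /dot sum_splitJ projJ_0 -expr2.
have -> : \sum_(j in J) projJ y 0 j * projJ y 0 j = rad_part c s (y 0 ord0) (radJ y) ^+ 2.
  by rewrite -sum_projJ_sqr; apply: eq_bigr => j _; rewrite expr2.
rewrite planar_norm//; congr (_ + _); apply: eq_bigr => j jr.
by rewrite projJ_rest// expr2.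
Qed.

End circular_cone.

(** * Gaussian moments *)

Section gauss_moments.
Context {R : realType} {d : nat}.
Local Notation TR := (measurableTypeR R).
Implicit Types (t : d.-tuple TR) (i j : 'I_d) (A : {set 'I_d}).

Lemma tnth_upd t i j (x : R) : tnth (upd t i x) j = if j == i then x else tnth t j.
Proof. by rewrite tnth_mktuple. Qed.

Definition sumsq A t : R := \sum_(j in A) tnth t j ^+ 2.
(** Centred, so that it is the divergence of the field [t] restricted to [A]. *)
Definition chi A t : R := sumsq A t - #|A|%:R.

Lemma sumsq_ge0 A t : 0 <= sumsq A t.
Proof. by apply: sumr_ge0 => j _; rewrite sqr_ge0. Qed.

Lemma tame_sumsq A : tame (sumsq A).
Proof. by apply: tame_sum => j _; apply: tameX; exact: tame_tnth. Qed.

Lemma tame_chi A : tame (chi A).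
Proof. by apply: tameB; [exact: tame_sumsq|exact: tame_cst]. Qed.

Lemma is_derive_tnth_upd t i j (x : R) :
  is_derive x (1:R) (fun y : R => tnth (upd t i y) j) (j == i)%:R.
Proof.
have [->|ji] := eqVneq j i.
  by under eq_fun do rewrite tnth_upd eqxx; exact: is_derive_id.
by under eq_fun do rewrite tnth_upd (negbTE ji); exact: is_derive_cst.
Qed.

Lemma is_derive_chi A t i (x : R) :
  is_derive x (1:R) (fun y : R => chi A (upd t i y)) (if i \in A then 2 * x else 0).
Proof.
rewrite /chi /sumsq.
have [iA|iA] := boolP (i \in A).
  have -> : (fun y : R => \sum_(j in A) tnth (upd t i y) j ^+ 2 - #|A|%:R) =
      (fun y : R => y ^+ 2 + (\sum_(j in A | j != i) tnth t j ^+ 2 - #|A|%:R)).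
    apply/funext => y; rewrite (bigD1 i)//= tnth_upd eqxx addrA; congr (_ + _ - _).
    by apply: eq_bigr => j /andP[_ ji]; rewrite tnth_upd (negbTE ji).
  by apply: is_derive_eq; rewrite /GRing.scale/=; lra.
have -> : (fun y : R => \sum_(j in A) tnth (upd t i y) j ^+ 2 - #|A|%:R) = cst (chi A t).
  apply/funext => y; rewrite /= /chi /sumsq; congr (_ - _).
  apply: eq_bigr => j jA; rewrite tnth_upd; case: eqP => // ji.
  by rewrite ji (negbTE iA) in jA.
exact: is_derive_cst.
Qed.

Lemma continuous_tnth_upd t i j : continuous (fun y : R => tnth (upd t i y) j).
Proof.
by move=> x; have [h _] := is_derive_tnth_upd t i j x; exact: derivable1_continuous h.
Qed.

Lemma continuous_chi A t i : continuous (fun y : R => chi A (upd t i y)).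
Proof.
by move=> x; have [h _] := is_derive_chi A t i x; exact: derivable1_continuous h.
Qed.

Lemma Ex_tnth i : Ex (fun t => tnth t i) = 0.
Proof.
rewrite -[RHS](Ex_cst (R := R) d 0).
transitivity (Ex (fun t => tnth t i * 1)); first by apply: eq_Ex => t; rewrite mulr1.
apply: Ex_ibp.
- exact: tame_cst.
- exact: tame_cst.
- by move=> t x; exact: is_derive_cst.
- by move=> t x; exact: cvg_cst.
Qed.

Lemma Ex_tnthM i j : Ex (fun t => tnth t i * tnth t j) = (j == i)%:R.
Proof.
rewrite -[RHS](Ex_cst d); apply: Ex_ibp.
- exact: tame_tnth.
- exact: tame_cst.
- by move=> t x; exact: is_derive_tnth_upd.
- by move=> t x; exact: cvg_cst.
Qed.

Lemma Ex_tnth2 i : Ex (fun t => tnth t i ^+ 2) = 1.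
Proof.
transitivity (Ex (fun t => tnth t i * tnth t i)); last by rewrite Ex_tnthM eqxx.
by apply: eq_Ex => t; rewrite expr2.
Qed.

Lemma Ex_tnth4 i : Ex (fun t => tnth t i ^+ 4) = 3.
Proof.
transitivity (Ex (fun t => tnth t i * tnth t i ^+ 3)); first by apply: eq_Ex => t; rewrite -exprS.
transitivity (Ex (fun t => 3 * tnth t i ^+ 2)); last first.
  by rewrite ExZ ?Ex_tnth2 ?mulr1//; apply: tameX; exact: tame_tnth.
apply: Ex_ibp.
- by apply: tameX; exact: tame_tnth.
- by apply/tameZ/tameX; exact: tame_tnth.
- move=> t x; have dx := is_derive_tnth_upd t i i x; rewrite eqxx in dx.
  by apply: is_derive_eq; rewrite tnth_upd eqxx /GRing.scale/=; lra.
- move=> t x; apply: cvgM; first exact: cvg_cst.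
  by under eq_fun do rewrite expr2; apply: cvgM; exact: continuous_tnth_upd.
Qed.

Lemma Ex_sumsq A : Ex (sumsq A) = #|A|%:R.
Proof.
rewrite /sumsq Ex_sum => [|j _]; last by apply: tameX; exact: tame_tnth.
by rewrite (eq_bigr (fun=> 1)) ?sumr_const// => j _; rewrite Ex_tnth2.
Qed.

Lemma Ex_chi A : Ex (chi A) = 0.
Proof. by rewrite /chi ExB ?Ex_cst ?Ex_sumsq ?subrr//; [exact: tame_sumsq|exact: tame_cst]. Qed.

(** Integrate by parts against each factor [tnth t j] of one copy of [chi]. *)
Lemma Ex_chi2 A : Ex (fun t => chi A t ^+ 2) = 2 * #|A|%:R.
Proof.
transitivity (Ex (fun t => \sum_(j in A) (tnth t j * (tnth t j * chi A t) - chi A t))).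
  apply: eq_Ex => t; rewrite expr2 {1}/chi /sumsq -sumr_const -sumrB mulr_suml.
  by apply: eq_bigr => j _; ring.
have tj j : tame (fun t => tnth t j * chi A t) by apply: tameM; [exact: tame_tnth|exact: tame_chi].
rewrite Ex_sum => [|j _]; last first.
  by apply: tameB; [apply: tameM => //; exact: tame_tnth|exact: tame_chi].
rewrite (eq_bigr (fun=> 2)) => [|j jA]; first by rewrite sumr_const mulr_natr.
rewrite ExB//; last 2 first.
- by apply: tameM => //; exact: tame_tnth.
- exact: tame_chi.
have -> : Ex (fun t => tnth t j * (tnth t j * chi A t)) =
    Ex (fun t => chi A t + 2 * tnth t j ^+ 2).
  apply: Ex_ibp => //.
  - by apply: tameD; [exact: tame_chi|apply/tameZ/tameX; exact: tame_tnth].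
  - move=> t x; have dx := is_derive_tnth_upd t j j x; have dc := is_derive_chi A t j x.
    rewrite eqxx in dx; rewrite jA in dc.
    by apply: is_derive_eq; rewrite tnth_upd eqxx /GRing.scale/=; lra.
  - move=> t x; apply: cvgD; first exact: continuous_chi.
    apply: cvgM; first exact: cvg_cst.
    by under eq_fun do rewrite expr2; apply: cvgM; exact: continuous_tnth_upd.
rewrite ExD ?ExZ ?Ex_chi ?Ex_tnth2; first by lra.
- by apply: tameX; exact: tame_tnth.
- exact: tame_chi.
- by apply/tameZ/tameX; exact: tame_tnth.
Qed.

Lemma Ex_tnth_chi A i : i \notin A -> Ex (fun t => tnth t i * chi A t) = 0.
Proof.
move=> iA; rewrite -[RHS](Ex_cst d); apply: Ex_ibp.
- exact: tame_chi.
- exact: tame_cst.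
- by move=> t x; have := is_derive_chi A t i x; rewrite (negbTE iA).
- by move=> t x; exact: cvg_cst.
Qed.

(** Integrate by parts in the coordinate [i], on which [chi A] does not depend. *)
Lemma Ex_tnth2_chi2 A i : i \notin A -> Ex (fun t => tnth t i ^+ 2 * chi A t ^+ 2) = 2 * #|A|%:R.
Proof.
move=> iA; rewrite -Ex_chi2.
transitivity (Ex (fun t => tnth t i * (tnth t i * chi A t ^+ 2))).
  by apply: eq_Ex => t; rewrite mulrA expr2.
apply: Ex_ibp.
- by apply: tameM; [exact: tame_tnth|apply: tameX; exact: tame_chi].
- by apply: tameX; exact: tame_chi.
- move=> t x; have dx := is_derive_tnth_upd t i i x; have dc := is_derive_chi A t i x.
  rewrite eqxx in dx; rewrite (negbTE iA) in dc.
  by apply: is_derive_eq; rewrite tnth_upd eqxx /GRing.scale/=; lra.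
- by move=> t x; under eq_fun do rewrite expr2; apply: cvgM; exact: continuous_chi.
Qed.

Lemma obs0E t i : obs 0 t 0 i = tnth t i.
Proof. by rewrite !mxE add0r. Qed.

Lemma obs_upd t i (x : R) : obs 0 (upd t i x) = obs 0 (upd t i 0) + x *: delta_mx 0 i.
Proof.
apply/rowP => j; rewrite !mxE eqxx !tnth_upd /=.
by case: eqP => _; rewrite ?mulr1 ?mulr0 !add0r ?addr0.
Qed.

End gauss_moments.

(** * The Stein identity for the test statistic *)

Section cone_statistic.
Context {R : realType} {p : nat}.
Local Notation TR := (measurableTypeR R).
Variables (c s : R) (J : {set 'I_p.+1}).
Hypotheses (c0 : 0 < c) (s0 : 0 < s) (cs : c ^+ 2 + s ^+ 2 = 1) (J0 : ord0 \notin J).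
Implicit Types (t : p.+1.-tuple TR) (mu : 'rV[R]_p.+1).

Local Notation K := (coneJ c J).
Local Notation P := (projJ c s J).
Local Notation m := (#|J|%:R : R).

Lemma tame_obs mu i : tame (fun t => obs mu t 0 i).
Proof.
apply: (@tame_eq _ _ (fun t => mu 0 i + tnth t i)); first by move=> t; rewrite !mxE.
by apply: tameD; [exact: tame_cst|exact: tame_tnth].
Qed.

Lemma tame_radJ mu : tame (fun t => radJ J (obs mu t)).
Proof. by apply/tame_sqrt/tame_sum => j _; apply/tameX; exact: tame_obs. Qed.

Lemma tame_rayp mu : tame (fun t => rayp c s (obs mu t 0 ord0) (radJ J (obs mu t))).
Proof.
apply: tame_max0; apply: tameD; apply: tameM; try exact: tame_cst.
  exact: tame_obs.
exact: tame_radJ.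
Qed.

Lemma tame_nrmp mu : tame (fun t => nrmp c s (obs mu t 0 ord0) (radJ J (obs mu t))).
Proof.
apply: tame_max0; apply: tameB; apply: tameM; try exact: tame_cst.
  exact: tame_obs.
exact: tame_radJ.
Qed.

Lemma tame_axis_part mu : tame (fun t => axis_part c s (obs mu t 0 ord0) (radJ J (obs mu t))).
Proof. by apply: tameD; apply: tameM; try exact: tame_cst; [exact: tame_rayp|exact: tame_nrmp]. Qed.

Lemma tame_rad_part mu : tame (fun t => rad_part c s (obs mu t 0 ord0) (radJ J (obs mu t))).
Proof. by apply: tameB; apply: tameM; try exact: tame_cst; [exact: tame_rayp|exact: tame_nrmp]. Qed.

Lemma tame_lrt_stat mu : tame (fun t => lrt_stat K (obs mu t)).
Proof.
apply: (@tame_eq _ _ (fun t => rayp c s (obs mu t 0 ord0) (radJ J (obs mu t)) ^+ 2 +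
  nrmp c s (obs mu t 0 ord0) (radJ J (obs mu t)) ^+ 2 + \sum_(j in restJ J) obs mu t 0 j ^+ 2)).
  by move=> t; rewrite (lrt_stat_coneJ c0 s0 cs J0).
apply: tameD; first by apply: tameD; apply: tameX; [exact: tame_rayp|exact: tame_nrmp].
by apply: tame_sum => j _; apply/tameX; exact: tame_obs.
Qed.

(** Growth is clear from the ratio bounds.  The inverse of the radius is
rewritten as a power only because the power function is measurable. *)
Lemma tame_projJ mu i : tame (fun t => P (obs mu t) 0 i).
Proof.
rewrite (_ : (fun t => _) = (fun t => if i == ord0 then axis_part c s (obs mu t 0 ord0) (radJ J (obs mu t))
  else if i \in J then rad_part c s (obs mu t 0 ord0) (radJ J (obs mu t)) * (radJ J (obs mu t)) `^ (-1) * obs mu t 0 i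
  else obs mu t 0 i)); last first.
  by apply/funext => t; rewrite !mxE powR_inv1// radJ_ge0.
case: (i == ord0); first exact: tame_axis_part.
case: (i \in J); last exact: tame_obs.
apply: tame_le (tame_norm (tame_obs mu i)) _.
  have [mf _] := tame_rad_part mu; have [mg _] := tame_radJ mu; have [mh _] := tame_obs mu i.
  apply: measurable_funM => //; apply: measurable_funM => //.
  have mp : measurable_fun [set: TR] ((@powR R ^~ (-1)) : TR -> TR) by exact: measurable_powR.
  exact: measurableT_comp mp mg.
move=> t; rewrite powR_inv1 ?radJ_ge0//.
have /andP[q0 q1] := rad_ratio_bounds J c0 s0 cs (obs mu t).
by rewrite normrM (ger0_norm q0) ler_piMl.
Qed.

Lemma is_derive_lrt_upd t i (x : R) :
  is_derive x (1:R) (fun y : R => lrt_stat K (obs 0 (upd t i y))) (2 * P (obs 0 (upd t i x)) 0 i).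
Proof.
under eq_fun do rewrite obs_upd; rewrite [obs 0 (upd t i x)]obs_upd.
exact: is_derive_lrt_stat (projJP c0 s0 cs J0) _ _ _.
Qed.

Lemma continuous_projJ_upd t i : continuous (fun y : R => P (obs 0 (upd t i y)) 0 i).
Proof.
under eq_fun do rewrite obs_upd.
exact: continuous_projector_coord (projJP c0 s0 cs J0) _ _.
Qed.

Definition lin_coef : R := 2 * s * c * Num.sqrt m.
(** The linearization of the centred statistic; see [remainder_le]. *)
Definition linpart t : R := s ^+ 2 * chi J t + lin_coef * tnth t ord0.
(** The Stein kernel of [linpart]: the inner product of the gradient [2 P] of the
statistic with the field of which [linpart] is the divergence. *)
Definition kerpart t : R := 2 * (lin_coef * P (obs 0 t) 0 ord0 +
  s ^+ 2 * \sum_(j in J) tnth t j * P (obs 0 t) 0 j).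

Lemma tame_linpart : tame linpart.
Proof. by apply: tameD; apply: tameZ; [exact: tame_chi|exact: tame_tnth]. Qed.

Lemma tame_kerpart : tame kerpart.
Proof.
apply: tameZ; apply: tameD; apply: tameZ; first exact: tame_projJ.
by apply: tame_sum => j _; apply: tameM; [exact: tame_tnth|exact: tame_projJ].
Qed.

(** Gaussian integration by parts, one coordinate at a time: [linpart] is the
divergence of the field with component [lin_coef] along [ord0] and
[s ^ 2 t_j] along [j] in [J]. *)
Lemma stein_identity (phi phi' : R -> R) (B B' : R) :
  (forall x : R, is_derive x (1:R) phi (phi' x)) -> continuous phi' ->
  (forall x, `|phi x| <= B) -> (forall x, `|phi' x| <= B') ->
  Ex (fun t => phi (lrt_stat K (obs 0 t)) * linpart t) =
  Ex (fun t => phi' (lrt_stat K (obs 0 t)) * kerpart t).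
Proof.
move=> dphi cphi' bphi bphi'.
have cphi : continuous phi.
  by move=> x; have [h _] := dphi x; exact: derivable1_continuous h.
pose T t := lrt_stat K (obs 0 t).
have tT : tame T by exact: tame_lrt_stat.
have tp : tame (fun t => phi (T t)).
  by apply: tame_comp_bounded tT _ bphi; exact: continuous_measurable_fun.
have tp' : tame (fun t => phi' (T t)).
  by apply: tame_comp_bounded tT _ bphi'; exact: continuous_measurable_fun.
have dT t i (x : R) : is_derive x (1:R) (fun y : R => phi (T (upd t i y)))
    (phi' (T (upd t i x)) * (2 * P (obs 0 (upd t i x)) 0 i)).
  have dTx := is_derive_lrt_upd t i x.
  exact: (@is_derive1_comp R phi (fun y => T (upd t i y)) x _ _ (dphi _) dTx).
have cT t i : continuous (fun y : R => T (upd t i y)).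
  by move=> x; have [h _] := is_derive_lrt_upd t i x; exact: derivable1_continuous h.
have cphT t i : continuous (fun y : R => phi (T (upd t i y))).
  by move=> x; have [h _] := dT t i x; exact: derivable1_continuous h.
have cph'T t i : continuous (fun y : R => phi' (T (upd t i y))).
  by move=> x; apply: (continuous_comp (cT t i x)); exact: cphi'.
have tpi i : tame (fun t => phi' (T t) * (2 * P (obs 0 t) 0 i)).
  by apply: tameM => //; apply: tameZ; exact: tame_projJ.
have e0 : Ex (fun t => tnth t ord0 * phi (T t)) = Ex (fun t => phi' (T t) * (2 * P (obs 0 t) 0 ord0)).
  apply: Ex_ibp => //.
  move=> t x; apply: cvgM; first exact: cph'T.
  by apply: cvgM; [exact: cvg_cst|exact: continuous_projJ_upd].
have ttp i : tame (fun t => tnth t i * phi (T t)) by apply: tameM => //; exact: tame_tnth.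
have ttpi i : tame (fun t => tnth t i * (phi' (T t) * (2 * P (obs 0 t) 0 i))).
  by apply: tameM => //; exact: tame_tnth.
have ej j : Ex (fun t => tnth t j * (tnth t j * phi (T t)) - phi (T t)) =
    Ex (fun t => tnth t j * (phi' (T t) * (2 * P (obs 0 t) 0 j))).
  rewrite ExB//; last by apply: tameM => //; exact: tame_tnth.
  have -> : Ex (fun t => tnth t j * (tnth t j * phi (T t))) =
      Ex (fun t => phi (T t) + tnth t j * (phi' (T t) * (2 * P (obs 0 t) 0 j))).
    apply: Ex_ibp => //.
    - exact: tameD.
    - move=> t x; have dx := is_derive_tnth_upd t j j x; rewrite eqxx in dx.
      have dp := dT t j x.
      by apply: is_derive_eq; rewrite /GRing.scale/=; ring.
    - move=> t x; apply: cvgD; first exact: cphT.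
      apply: cvgM; first exact: continuous_tnth_upd.
      apply: cvgM; first exact: cph'T.
      by apply: cvgM; [exact: cvg_cst|exact: continuous_projJ_upd].
  by rewrite ExD// addrAC subrr add0r.
transitivity (Ex (fun t => s ^+ 2 * (\sum_(j in J) (tnth t j * (tnth t j * phi (T t)) - phi (T t))) +
   lin_coef * (tnth t ord0 * phi (T t)))).
  apply: eq_Ex => t; rewrite /linpart -/(T t).
  have -> : \sum_(j in J) (tnth t j * (tnth t j * phi (T t)) - phi (T t)) = chi J t * phi (T t).
    rewrite sumrB sumr_const /chi /sumsq mulrBl mulr_suml mulr_natl; congr (_ - _).
    by apply: eq_bigr => j _; ring.
  by ring.
have tj j : tame (fun t => tnth t j * (tnth t j * phi (T t)) - phi (T t)).
  by apply: tameB => //; apply: tameM => //; exact: tame_tnth.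
rewrite ExD; last 2 first.
- by apply: tameZ; exact: tame_sum.
- exact: tameZ.
rewrite !ExZ//; last exact: tame_sum.
rewrite Ex_sum// (eq_bigr _ (fun j _ => ej j)) -Ex_sum// e0 -!ExZ//; last exact: tame_sum.
rewrite -ExD; last 2 first.
- by apply: tameZ; exact: tame_sum.
- exact: tameZ.
apply: eq_Ex => t; rewrite /kerpart -/(T t) (mulrDr 2) mulrDr addrC; congr (_ + _); first by ring.
rewrite mulrCA [in RHS]mulrCA; rewrite !mulr_sumr.
by apply: eq_bigr => j _; ring.
Qed.

End cone_statistic.

(** * Linearization of the planar projection *)

Section planar_approximation.
Context {R : realType}.
Variables c s : R.
Hypotheses (c0 : 0 < c) (s0 : 0 < s) (cs : c ^+ 2 + s ^+ 2 = 1).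

Lemma cos_le1 : c <= 1. Proof. by move: cs c0 (sqr_ge0 s) => cs' c0' ?; nra. Qed.
Lemma sin_le1 : s <= 1. Proof. by move: cs s0 (sqr_ge0 c) => cs' s0' ?; nra. Qed.

Lemma rayp_approx a r : 0 <= r -> 0 <= rayp c s a r - ray_coord c s a r <= `|a|.
Proof.
move=> r0; have c1 := cos_le1; rewrite /rayp.
case: (leP (ray_coord c s a r) 0) => h; last by rewrite subrr lexx normr_ge0.
rewrite sub0r oppr_ge0 h /= /ray_coord.
have : - a <= `|a| by rewrite -normrN ler_norm.
have := normr_ge0 a; have : 0 <= r * s by rewrite mulr_ge0// ltW.
by move: c0 => c0' *; nra.
Qed.

Lemma nrmp_approx a r : 0 <= r -> nrmp c s a r <= `|a|.
Proof.
move=> r0; have s1 := sin_le1; rewrite /nrmp.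
case: (leP (nrm_coord c s a r) 0) => h; first exact: normr_ge0.
rewrite /nrm_coord; have : 0 <= r * c by rewrite mulr_ge0// ltW.
by move: s0 (ler_norm a) (normr_ge0 a) => s0' *; nra.
Qed.

(** Each positive part that differs from its linear value does so by at most
[|a|]: replacing [ray_coord] by its positive part matters only if
[a c + r s < 0], and [nrm_coord] is positive only if [r c < a s]. *)
Lemma planar_norm_approx a r : 0 <= r ->
  `|rayp c s a r ^+ 2 + nrmp c s a r ^+ 2 - ray_coord c s a r ^+ 2| <= a ^+ 2.
Proof.
move=> r0; have := nrmp_approx a r0; have := nrmp_ge0 c s a r.
have /andP[] := rayp_approx a r0; rewrite -[a ^+ 2]real_normK ?num_real//.
have := normr_ge0 a; rewrite /rayp ler_norml.
move: (nrmp c s a r) (`|a|) (ray_coord c s a r) => n b u.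
case: (leP u 0) => h b0 h1 h2 h3 h4; apply/andP; split; nra.
Qed.

End planar_approximation.

(** * Moments of the test statistic and the Stein bound *)

Section cone_moments.
Context {R : realType} {p : nat}.
Local Notation TR := (measurableTypeR R).
Variables (c s : R) (J : {set 'I_p.+1}).
Hypotheses (c0 : 0 < c) (s0 : 0 < s) (cs : c ^+ 2 + s ^+ 2 = 1) (J0 : ord0 \notin J).
Hypotheses (Jpos : (0 < #|J|)%N) (rest1 : (#|restJ J| <= 1)%N).
Implicit Types (t : p.+1.-tuple TR).

Local Notation K := (coneJ c J).
Local Notation P := (projJ c s J).
Local Notation m := (#|J|%:R : R).
Local Notation q := (Num.sqrt m).
Local Notation T := (fun t => lrt_stat K (obs 0 t)).
Local Notation L := (linpart c s J).
Local Notation W := (kerpart c s J).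

Lemma q_ge1 : 1 <= q.
Proof. by rewrite -[leLHS]sqrtr1 ler_wsqrtr// ler1n. Qed.

Lemma q_gt0 : 0 < q. Proof. exact: lt_le_trans q_ge1. Qed.

Lemma q_sqr : q ^+ 2 = m. Proof. by rewrite sqr_sqrtr. Qed.

Lemma m_gt0 : 0 < m. Proof. by rewrite ltr0n. Qed.

Lemma radJ_obs_sqr t : radJ J (obs 0 t) ^+ 2 = sumsq J t.
Proof. by rewrite radJ_sqr; apply: eq_bigr => j _; rewrite obs0E. Qed.

(** Concentration of the radius: [r ^ 2 - m = (r - q) (r + q)] with [r + q >= q]. *)
Lemma radJ_dev t : q * `|radJ J (obs 0 t) - q| <= `|chi J t|.
Proof.
have -> : chi J t = (radJ J (obs 0 t) - q) * (radJ J (obs 0 t) + q).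
  by rewrite -subr_sqr q_sqr radJ_obs_sqr.
have h : 0 < radJ J (obs 0 t) + q by rewrite ltr_wpDl ?radJ_ge0 ?q_gt0.
by rewrite normrM mulrC (gtr0_norm h) ler_wpM2l// lerDr radJ_ge0.
Qed.

Lemma radJ_dev_sqr t : m * (radJ J (obs 0 t) - q) ^+ 2 <= chi J t ^+ 2.
Proof.
have -> : m * (radJ J (obs 0 t) - q) ^+ 2 = (q * (radJ J (obs 0 t) - q)) ^+ 2 by rewrite exprMn q_sqr.
rewrite -[leLHS]real_normK ?num_real// -[leRHS]real_normK ?num_real//.
rewrite ler_pXn2r ?nnegrE// normrM (gtr0_norm q_gt0); exact: radJ_dev.
Qed.

Definition remainder t : R := T t - s ^+ 2 * m - L t.

Lemma tame_remainder : tame remainder.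
Proof.
apply: tameB; last exact: tame_linpart.
by apply: tameB; [exact: (tame_lrt_stat c0 s0 cs J0)|exact: tame_cst].
Qed.

(** Replace the statistic by [ray_coord ^ 2] plus the rest and expand
[(a c + r s) ^ 2]; the cross term [2 s c a r] is linearized at [r = q]. *)
Lemma remainder_le t :
  `|remainder t| <= 2 * tnth t ord0 ^+ 2 + sumsq (restJ J) t + `|tnth t ord0| * `|radJ J (obs 0 t) - q|.
Proof.
have r0 := radJ_ge0 J (obs 0 t).
have := planar_norm_approx c0 s0 cs (tnth t ord0) r0.
have c1 := cos_le1 c0 cs; have s1 := sin_le1 s0 cs.
rewrite /remainder (lrt_stat_coneJ c0 s0 cs J0) obs0E.
have -> : \sum_(j in restJ J) obs 0 t 0 j ^+ 2 = sumsq (restJ J) t.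
  by apply: eq_bigr => j _; rewrite obs0E.
set A := rayp _ _ _ _ ^+ 2 + _; set a := tnth t ord0; set r := radJ _ _ in r0 *.
set Z := sumsq _ t => h.
have -> : A + Z - s ^+ 2 * m - L t = (A - ray_coord c s a r ^+ 2) + Z + (c ^+ 2 * a ^+ 2 + 2 * s * c * (a * (r - q))).
  have e : chi J t = r ^+ 2 - m by rewrite /chi -radJ_obs_sqr.
  have cc : c ^+ 2 = 1 - s ^+ 2 by rewrite -cs; ring.
  rewrite /linpart /lin_coef e -/a /ray_coord; ring.
have Z0 : 0 <= Z by exact: sumsq_ge0.
(* [2 s c <= c ^ 2 + s ^ 2]. *)
have sc1 : 2 * s * c <= 1 by move: cs (sqr_ge0 (s - c)) => cs' *; nra.
have sc0 : 0 <= 2 * s * c by rewrite !mulr_ge0// ltW.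
have c21 : c ^+ 2 <= 1 by move: cs (sqr_ge0 s) => cs' *; lra.
apply: le_trans (ler_normD _ _) _.
apply: (@le_trans _ _ ((a ^+ 2 + Z) + (a ^+ 2 + `|a| * `|r - q|))); last by lra.
apply: lerD; first by apply: le_trans (ler_normD _ _) _; rewrite lerD// ger0_norm.
apply: le_trans (ler_normD _ _) _; apply: lerD.
  have e : 0 <= c ^+ 2 * a ^+ 2 by rewrite mulr_ge0 ?sqr_ge0.
  by rewrite (ger0_norm e) ler_piMl ?sqr_ge0.
by rewrite normrM (ger0_norm sc0) normrM ler_piMl// mulr_ge0.
Qed.

Lemma Ex_sumsq_rest2 : Ex (fun t => sumsq (restJ J) t ^+ 2) <= 6.
Proof.
have k1 : (#|restJ J|%:R : R) <= 1 by rewrite lern1.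
apply: (@le_trans _ _ (Ex (fun t => 2 * chi (restJ J) t ^+ 2 + 2))).
  apply: le_Ex.
  - by apply: tameX; exact: tame_sumsq.
  - by apply: tameD; [apply/tameZ/tameX; exact: tame_chi|exact: tame_cst].
  - move=> t; have -> : sumsq (restJ J) t = chi (restJ J) t + #|restJ J|%:R by rewrite /chi subrK.
    have := ler0n R #|restJ J|; move: (chi _ t) (_%:R) k1 => x k k1 k0.
    by have := sqr_ge0 (x - k); nra.
have tc : tame (fun t => chi (restJ J) t ^+ 2) by apply/tameX; exact: tame_chi.
rewrite ExD ?Ex_cst ?ExZ ?Ex_chi2//; last 2 first.
- exact: tameZ.
- exact: tame_cst.
by lra.
Qed.

(** The bound does not grow with [m], because [a] and [r - q] have bounded
moments. *)
Lemma Ex_remainder2 : Ex (fun t => remainder t ^+ 2) <= 60.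
Proof.
have ta4 : tame (fun t => tnth t ord0 ^+ 4) by apply/tameX; exact: tame_tnth.
have tZ : tame (fun t => sumsq (restJ J) t ^+ 2) by apply/tameX; exact: tame_sumsq.
have tac : tame (fun t => tnth t ord0 ^+ 2 * chi J t ^+ 2).
  by apply: tameM; apply: tameX; [exact: tame_tnth|exact: tame_chi].
apply: (@le_trans _ _ (Ex (fun t => 12 * tnth t ord0 ^+ 4 + 3 * sumsq (restJ J) t ^+ 2
    + (3 / m) * (tnth t ord0 ^+ 2 * chi J t ^+ 2)))).
  apply: le_Ex.
  - by apply: tameX; exact: tame_remainder.
  - by apply: tameD; [apply: tameD|]; exact: tameZ.
  move=> t; have h := remainder_le t; have h2 := radJ_dev_sqr t.
  have h3 : tnth t ord0 ^+ 2 * (radJ J (obs 0 t) - q) ^+ 2 <= m^-1 * (tnth t ord0 ^+ 2 * chi J t ^+ 2).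
    rewrite [leRHS]mulrCA ler_wpM2l ?sqr_ge0// -(ler_pM2l m_gt0) mulVKf//.
    by rewrite gt_eqF// m_gt0.
  rewrite -[remainder t ^+ 2]real_normK ?num_real//.
  apply: (@le_trans _ _ ((2 * tnth t ord0 ^+ 2 + sumsq (restJ J) t + `|tnth t ord0| * `|radJ J (obs 0 t) - q|) ^+ 2)).
    by rewrite ler_pXn2r ?nnegrE//; exact: le_trans (normr_ge0 _) h.
  have -> : 3 / m * (tnth t ord0 ^+ 2 * chi J t ^+ 2) = 3 * (m^-1 * (tnth t ord0 ^+ 2 * chi J t ^+ 2)) by ring.
  move: h3; rewrite -[(_ - q) ^+ 2]real_normK ?num_real//.
  have -> : tnth t ord0 ^+ 4 = (tnth t ord0 ^+ 2) ^+ 2 by rewrite -exprM.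
  rewrite -[tnth t ord0 ^+ 2]real_normK ?num_real// -exprMn.
  move: (_ * _) (`|tnth t ord0| ^+ 2) (sumsq _ t) (m^-1 * _) => x y z w xw.
  by have := sqr_ge0 (x - 2 * y); have := sqr_ge0 (x - z); have := sqr_ge0 (2 * y - z); nra.
rewrite ExD; last 2 first.
- by apply: tameD; exact: tameZ.
- exact: tameZ.
rewrite ExD; try exact: tameZ.
rewrite !ExZ// Ex_tnth4 Ex_tnth2_chi2//.
have -> : 3 / m * (2 * m) = 6 by field; rewrite gt_eqF// m_gt0.
by have := Ex_sumsq_rest2; lra.
Qed.

(** The variance of [linpart] divided by [m]. *)
Definition lin_var : R := 2 * s ^+ 4 + 4 * s ^+ 2 * c ^+ 2.

Lemma tau2_gt0 : 0 < lin_var.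
Proof. by rewrite /lin_var ltr_wpDr ?mulr_gt0 ?exprn_gt0// !mulr_ge0 ?exprn_ge0 ?ltW. Qed.

Lemma tau2_le : lin_var <= 6.
Proof.
have c21 : c ^+ 2 <= 1 by move: cs (sqr_ge0 s) => cs' *; lra.
have s21 : s ^+ 2 <= 1 by move: cs (sqr_ge0 c) => cs' *; lra.
rewrite /lin_var (exprM s 2 2); have := sqr_ge0 s; have := sqr_ge0 c.
by move: (c ^+ 2) (s ^+ 2) c21 s21 => x y *; nra.
Qed.

Lemma Ex_linpart : Ex L = 0.
Proof.
rewrite /linpart ExD ?ExZ ?Ex_chi ?Ex_tnth ?mulr0 ?addr0//; try exact: tame_chi; try exact: tame_tnth.
  by apply: tameZ; exact: tame_chi.
by apply: tameZ; exact: tame_tnth.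
Qed.

Lemma Ex_linpart2 : Ex (fun t => L t ^+ 2) = m * lin_var.
Proof.
have ta2 : tame (fun t => tnth t ord0 ^+ 2) by apply/tameX; exact: tame_tnth.
have tc2 : tame (fun t => chi J t ^+ 2) by apply/tameX; exact: tame_chi.
have tac : tame (fun t => tnth t ord0 * chi J t).
  by apply: tameM; [exact: tame_tnth|exact: tame_chi].
transitivity (Ex (fun t => s ^+ 4 * chi J t ^+ 2 + (2 * s ^+ 2 * lin_coef c s J) * (tnth t ord0 * chi J t)
   + lin_coef c s J ^+ 2 * tnth t ord0 ^+ 2)).
  by apply: eq_Ex => t; rewrite /linpart; ring.
rewrite ExD; last 2 first.
- by apply: tameD; exact: tameZ.
- exact: tameZ.
rewrite ExD; try exact: tameZ.
rewrite !ExZ// Ex_chi2 Ex_tnth2 Ex_tnth_chi// /lin_coef /lin_var.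
by rewrite !exprMn q_sqr; ring.
Qed.

Let mean := Ex T.
Let rho := Ex remainder.
Let V := Ex (fun t => (T t - mean) ^+ 2).

Let tT : tame T. Proof. exact: (tame_lrt_stat c0 s0 cs J0). Qed.
Let tL : tame L. Proof. exact: tame_linpart. Qed.
Let tR : tame remainder. Proof. exact: tame_remainder. Qed.

Lemma mean_remainder : mean = s ^+ 2 * m + rho.
Proof.
rewrite /mean (@eq_Ex _ _ _ (fun t => s ^+ 2 * m + L t + remainder t)); last first.
  by move=> t; rewrite /remainder; ring.
rewrite ExD//; last by apply: tameD => //; exact: tame_cst.
by rewrite ExD// ?Ex_cst ?Ex_linpart ?addr0//; exact: tame_cst.
Qed.

(** The remainder recentred at the exact mean of the statistic, which is the
centring used by the test. *)
Definition cremainder t : R := T t - mean - L t.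

Lemma cremainderE t : cremainder t = remainder t - rho.
Proof. by rewrite /cremainder /remainder mean_remainder; ring. Qed.

Lemma tame_cremainder : tame cremainder.
Proof. by apply: tameB => //; apply: tameB => //; exact: tame_cst. Qed.

Let tR1 := tame_cremainder.

Lemma Ex_cremainder2 : Ex (fun t => cremainder t ^+ 2) <= 60.
Proof.
apply: le_trans Ex_remainder2.
have tr2 : tame (fun t => remainder t ^+ 2) by exact: tameX.
rewrite (@eq_Ex _ _ _ (fun t => remainder t ^+ 2 - (2 * rho) * remainder t + rho ^+ 2)); last first.
  by move=> t; rewrite cremainderE; ring.
rewrite ExD ?Ex_cst; last 2 first.
- by apply: tameB => //; exact: tameZ.
- exact: tame_cst.
rewrite ExB ?ExZ//; last exact: tameZ.
by rewrite -/rho; have := sqr_ge0 rho; lra.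
Qed.

Lemma Ex_abs_cremainder : Ex (fun t => `|cremainder t|) <= 31.
Proof.
have t2 : tame (fun t => cremainder t ^+ 2) by exact: tameX.
apply: (@le_trans _ _ (Ex (fun t => 2^-1 * cremainder t ^+ 2 + 2^-1))).
  apply: le_Ex; first exact: tame_norm.
    by apply: tameD; [exact: tameZ|exact: tame_cst].
  move=> t; have := sqr_ge0 (`|cremainder t| - 1).
  by rewrite -[cremainder t ^+ 2]real_normK ?num_real//; nra.
rewrite ExD ?Ex_cst ?ExZ//; last 2 first.
- exact: tameZ.
- exact: tame_cst.
by have := Ex_cremainder2; lra.
Qed.

(** The difference of squares is [2 L e + e ^ 2] with [e] the recentred remainder,
and [2 |L e| <= L ^ 2 / q + q e ^ 2] balances [E L ^ 2 = O(m)] against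
[E e ^ 2 = O(1)]. *)
Lemma variance_approx : `|V - m * lin_var| <= 126 * q.
Proof.
have q0 := q_gt0; have q1 := q_ge1.
have tV : tame (fun t => (T t - mean) ^+ 2) by apply/tameX/tameB => //; exact: tame_cst.
have tL2 : tame (fun t => L t ^+ 2) by exact: tameX.
have tR2 : tame (fun t => cremainder t ^+ 2) by exact: tameX.
rewrite -Ex_linpart2 -ExB//.
apply: le_trans (le_norm_Ex _) _; first exact: tameB.
apply: (@le_trans _ _ (Ex (fun t => q^-1 * L t ^+ 2 + (q + 1) * cremainder t ^+ 2))).
  apply: le_Ex.
  - exact/tame_norm/tameB.
  - by apply: tameD; exact: tameZ.
  move=> t; have -> : T t - mean = L t + cremainder t by rewrite /cremainder; ring.
  have -> : (L t + cremainder t) ^+ 2 - L t ^+ 2 = 2 * L t * cremainder t + cremainder t ^+ 2 by ring.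
  move: (L t) (cremainder t) => x y.
  apply: le_trans (ler_normD _ _) _; rewrite [`|y ^+ 2|]ger0_norm ?sqr_ge0// [in leRHS]mulrDl mul1r addrA lerD2r.
  rewrite -(ler_pM2l q0) mulrDr mulrA mulfV ?gt_eqF// mul1r !normrM (ger0_norm (ler0n R 2)).
  rewrite -[x ^+ 2]real_normK ?num_real// -[y ^+ 2]real_normK ?num_real//.
  by have := sqr_ge0 (`|x| - q * `|y|); nra.
rewrite ExD ?ExZ//; try exact: tameZ.
rewrite Ex_linpart2.
have -> : q^-1 * (m * lin_var) = q * lin_var.
  by apply: (mulfI (lt0r_neq0 q0)); rewrite mulVKf ?lt0r_neq0// [RHS]mulrA -expr2 q_sqr.
by have := Ex_cremainder2; have := tau2_le; move: (Ex _) => e; nra.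
Qed.

(** Substitute the frame coordinates for the projection: at [a = 0] and [r = q] the
kernel equals [m lin_var], and each deviation is linear in [a], [r - q] or
[chi]. *)
Lemma kerpart_le t : `|W t - m * lin_var| <= (8 * q + 6 * radJ J (obs 0 t)) * `|tnth t ord0| + 6 * `|chi J t|.
Proof.
have q0 := q_gt0; have r0 := radJ_ge0 J (obs 0 t).
have c1 := cos_le1 c0 cs; have s1 := sin_le1 s0 cs.
have -> : W t = 2 * (lin_coef c s J * axis_part c s (tnth t ord0) (radJ J (obs 0 t)) +
    s ^+ 2 * (radJ J (obs 0 t) * rad_part c s (tnth t ord0) (radJ J (obs 0 t)))).
  rewrite /kerpart projJ_0 obs0E; congr (2 * (_ + _ * _)).
  have := sum_projJ_y c0 s0 cs J0 (obs 0 t); rewrite obs0E => <-.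
  by apply: eq_bigr => j _; rewrite obs0E.
have hr := radJ_dev t.
have hray := rayp_approx c0 s0 cs (tnth t ord0) r0.
have hn0 := nrmp_ge0 c s (tnth t ord0) (radJ J (obs 0 t)).
have hn1 := nrmp_approx c0 s0 cs (tnth t ord0) r0.
have chiE : chi J t = radJ J (obs 0 t) ^+ 2 - q ^+ 2 by rewrite radJ_obs_sqr q_sqr.
rewrite /axis_part /rad_part /lin_coef /lin_var; have qs := q_sqr.
move: (radJ J (obs 0 t)) r0 hr hray hn0 hn1 chiE => r r0 hr hray hn0 hn1 chiE.
rewrite /ray_coord in hray; move: (tnth t ord0) (chi J t) hray hn0 hn1 chiE hr => a X.
move: (rayp c s a r) (nrmp c s a r) => x y /andP[hx0 hx1] hy0 hy1 chiE hr.
move: q q0 hr chiE qs => k k0 hr chiE qs; rewrite -qs.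
have s20 : 0 <= s ^+ 2 by exact: sqr_ge0.
have c20 : 0 <= c ^+ 2 by exact: sqr_ge0.
have scl : s * c <= 1 / 2 by move: cs (sqr_ge0 (s - c)) => cs' *; nra.
have sc0 : 0 <= s * c by rewrite mulr_ge0// ltW.
have s21 : s ^+ 2 <= 1 by rewrite -cs lerDr.
have c21 : c ^+ 2 <= 1 by rewrite -cs lerDl.
(* The first four terms are the defects of the positive parts, the fifth is linear in [a], the last two carry the deviation of the radius. *)
have e : 2 * (2 * s * c * k * (x * c + y * s) + s ^+ 2 * (r * (x * s - y * c))) -
  k ^+ 2 * (2 * s ^+ 4 + 4 * s ^+ 2 * c ^+ 2) =
  (4 * k * (s * c) * c) * (x - (a * c + r * s)) + (4 * k * (s * c) * s) * y
  + (2 * r * s ^+ 2 * s) * (x - (a * c + r * s)) - (2 * r * s ^+ 2 * c) * y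
  + (4 * k * (s * c) * c ^+ 2 + 2 * s ^+ 2 * (s * c) * r) * a
  + 4 * (s * c) ^+ 2 * (k * (r - k)) + 2 * (s ^+ 2) ^+ 2 * X.
  by rewrite chiE; ring.
rewrite e {e}.
have b1 : `|(4 * k * (s * c) * c) * (x - (a * c + r * s))| <= 2 * k * `|a|.
  rewrite normrM (ger0_norm hx0) ger0_norm; last by rewrite !mulr_ge0// ltW.
  apply: ler_pM => //; first by rewrite !mulr_ge0// ltW.
  have : k * (s * c) * c <= k * (s * c) by rewrite ler_piMr// mulr_ge0// ltW.
  have : k * (s * c) <= k * (1 / 2) by rewrite ler_pM2l.
  by lra.
have b2 : `|(4 * k * (s * c) * s) * y| <= 2 * k * `|a|.
  rewrite normrM (ger0_norm hy0) ger0_norm; last by rewrite !mulr_ge0// ltW.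
  apply: ler_pM => //; first by rewrite !mulr_ge0// ltW.
  have : k * (s * c) * s <= k * (s * c) by rewrite ler_piMr// mulr_ge0// ltW.
  have : k * (s * c) <= k * (1 / 2) by rewrite ler_pM2l.
  by lra.
have rs1 : r * s ^+ 2 <= r by rewrite ler_piMr.
have rs0 : 0 <= r * s ^+ 2 by rewrite mulr_ge0.
have b3 : `|(2 * r * s ^+ 2 * s) * (x - (a * c + r * s))| <= 2 * r * `|a|.
  rewrite normrM (ger0_norm hx0) ger0_norm; last by rewrite !mulr_ge0// ltW.
  apply: ler_pM => //; first by rewrite !mulr_ge0// ltW.
  have : r * s ^+ 2 * s <= r * s ^+ 2 by rewrite ler_piMr.
  by lra.
have b4 : `|(2 * r * s ^+ 2 * c) * y| <= 2 * r * `|a|.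
  rewrite normrM (ger0_norm hy0) ger0_norm; last by rewrite !mulr_ge0// ltW.
  apply: ler_pM => //; first by rewrite !mulr_ge0// ltW.
  have : r * s ^+ 2 * c <= r * s ^+ 2 by rewrite ler_piMr.
  by lra.
have b5 : `|(4 * k * (s * c) * c ^+ 2 + 2 * s ^+ 2 * (s * c) * r) * a| <= (2 * k + r) * `|a|.
  have u1 : k * (s * c) * c ^+ 2 <= k * (s * c) by rewrite ler_piMr// mulr_ge0// ltW.
  have u2 : k * (s * c) <= k * (1 / 2) by rewrite ler_pM2l.
  have u3 : (r * s ^+ 2) * (s * c) <= (r * s ^+ 2) * (1 / 2) by rewrite ler_wpM2l.
  have u4 : 0 <= k * (s * c) * c ^+ 2 by rewrite !mulr_ge0// ltW.
  have u5 : 0 <= (r * s ^+ 2) * (s * c) by rewrite mulr_ge0.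
  rewrite normrM ler_wpM2r// ger0_norm; first by move: u1 u2 u3 rs1; nra.
  by move: u4 u5; nra.
have b6 : `|4 * (s * c) ^+ 2 * (k * (r - k))| <= `|X|.
  have v1 : 0 <= 4 * (s * c) ^+ 2 by rewrite mulr_ge0 ?sqr_ge0.
  have v2 : 4 * (s * c) ^+ 2 <= 1 by nra.
  rewrite normrM (ger0_norm v1) normrM (gtr0_norm k0).
  by apply: le_trans hr; rewrite ler_piMl// mulr_ge0// ltW.
have b7 : `|2 * (s ^+ 2) ^+ 2 * X| <= 2 * `|X|.
  rewrite normrM ger0_norm; last by rewrite mulr_ge0// sqr_ge0.
  by rewrite ler_wpM2r//; nra.
apply: le_trans (ler_normD _ _) _; have h6 := normr_ge0 X; have h7 := normr_ge0 a.
apply: le_trans (lerD (ler_normD _ _) b7) _.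
apply: le_trans (lerD (lerD (ler_normD _ _) b6) (lexx _)) _.
apply: le_trans (lerD (lerD (lerD (ler_normB _ _) b5) (lexx _)) (lexx _)) _.
apply: le_trans (lerD (lerD (lerD (lerD (ler_normD _ _) b4) (lexx _)) (lexx _)) (lexx _)) _.
apply: le_trans (lerD (lerD (lerD (lerD (lerD (ler_normD _ _) b3) (lexx _)) (lexx _)) (lexx _)) (lexx _)) _.
have : 0 <= k * `|a| by rewrite mulr_ge0// ltW.
have : 0 <= r * `|a| by rewrite mulr_ge0.
by move: b1 b2; rewrite !mulrDl; lra.
Qed.

(** By the inequality of the means with weight [q], each product in [kerpart_le] has
expectation [O(q)]. *)
Lemma Ex_kerpart_approx : Ex (fun t => `|W t - m * lin_var|) <= 23 * q.
Proof.
have q0 := q_gt0.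
have tW : tame W := tame_kerpart J c0 s0 cs.
have ta2 : tame (fun t => tnth t ord0 ^+ 2) by apply/tameX; exact: tame_tnth.
have tc2 : tame (fun t => chi J t ^+ 2) by apply/tameX; exact: tame_chi.
have tS : tame (sumsq J) := tame_sumsq J.
apply: (@le_trans _ _ (Ex (fun t => 7 * q + 7 * q * tnth t ord0 ^+ 2 + 3 / q * sumsq J t + 3 / q * chi J t ^+ 2))).
  apply: le_Ex.
  - by apply/tame_norm/tameB => //; exact: tame_cst.
  - by do 2 (apply: tameD; last exact: tameZ); apply: tameD; [exact: tame_cst|exact: tameZ].
  move=> t; apply: le_trans (kerpart_le t) _.
  have r0 := radJ_ge0 J (obs 0 t); rewrite -radJ_obs_sqr.
  rewrite -[tnth t ord0 ^+ 2]real_normK ?num_real// -[chi J t ^+ 2]real_normK ?num_real//.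
  move: (radJ _ _) (`|tnth t ord0|) (`|chi J t|) r0 (normr_ge0 (tnth t ord0)) (normr_ge0 (chi J t)).
  move: q q0 => k k0 r a x r0 a0 x0.
  have h1 : 2 * (r * a) <= r ^+ 2 / k + k * a ^+ 2.
    have -> : r ^+ 2 / k + k * a ^+ 2 = (r ^+ 2 + (k * a) ^+ 2) / k by field; rewrite gt_eqF.
    by rewrite ler_pdivlMr//; have := sqr_ge0 (r - k * a); nra.
  have h2 : 2 * x <= x ^+ 2 / k + k.
    have -> : x ^+ 2 / k + k = (x ^+ 2 + k ^+ 2) / k by field; rewrite gt_eqF.
    by rewrite ler_pdivlMr//; have := sqr_ge0 (x - k); nra.
  have h3 : 2 * (k * a) <= k + k * a ^+ 2 by have := sqr_ge0 (a - 1); nra.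
  have -> : 3 / k * r ^+ 2 = 3 * (r ^+ 2 / k) by ring.
  have -> : 3 / k * x ^+ 2 = 3 * (x ^+ 2 / k) by ring.
  by move: h1 h2 h3; move: (r ^+ 2 / k) (x ^+ 2 / k) (a ^+ 2) => u v w; nra.
rewrite ExD; last 2 first.
- by apply: tameD; [apply: tameD; [exact: tame_cst|exact: tameZ]|exact: tameZ].
- exact: tameZ.
rewrite ExD; last 2 first.
- by apply: tameD; [exact: tame_cst|exact: tameZ].
- exact: tameZ.
rewrite ExD ?Ex_cst ?ExZ//; last 2 first.
- exact: tame_cst.
- exact: tameZ.
rewrite Ex_tnth2 Ex_chi2 Ex_sumsq.
have e : q^-1 * m = q by apply: (mulfI (lt0r_neq0 q0)); rewrite mulVKf ?lt0r_neq0// -expr2 q_sqr.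
have -> : 3 / q * m = 3 * q by rewrite -mulrA e.
have -> : 3 / q * (2 * m) = 6 * q by rewrite mulrCA -[3 / q * m]mulrA e; ring.
by lra.
Qed.

(** For the solution [f] of the Stein equation, [E (f' - F f)(F)] at the
standardized statistic [F] is compared with the Stein identity: what is left is
the fluctuation of the kernel around the variance and the recentred
remainder. *)
Lemma stein_test_bound h : 0 < V -> test_fun h ->
  `|Ex (fun t => h ((T t - mean) / Num.sqrt V)) - \int[normal_prob (0:R) 1]_x h x| <=
  2 * (Ex (fun t => `|V - W t|) / V) + (1 + (normal_pdf (0:R) 1 1)^-1) * (31 / Num.sqrt V).
Proof.
move=> V0 [ch h01]; set sg := Num.sqrt V; have sg0 : 0 < sg by rewrite sqrtr_gt0.
have sgV : sg ^+ 2 = V by rewrite sqr_sqrtr// ltW.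
have [f [f' [df cf' eqf bf bf']]] := stein_solution ch h01.
move: eqf; set Nh := (\int[normal_prob (0:R) 1]_t h t)%R => eqf.
set B := 1 + _ in bf *.
have cf : continuous f.
  by move=> x; have [d _] := df x; exact: derivable1_continuous d.
pose F t := (T t - mean) / sg.
have tW : tame W := tame_kerpart J c0 s0 cs.
have tF : tame F.
  apply: (@tame_eq _ _ (fun t => sg^-1 * (T t - mean))); first by move=> t; rewrite mulrC.
  by apply: tameZ; apply: tameB => //; exact: tame_cst.
have tfF : tame (fun t => f (F t)).
  by apply: tame_comp_bounded tF _ bf; exact: continuous_measurable_fun.
have tf'F : tame (fun t => f' (F t)).
  by apply: tame_comp_bounded tF _ bf'; exact: continuous_measurable_fun.
have thF : tame (fun t => h (F t)).
  apply: (tame_comp_bounded (K := 1) tF); first exact: continuous_measurable_fun.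
  by move=> x; have /andP[h0 h1] := h01 x; rewrite ger0_norm.
pose phi x := f ((x - mean) / sg); pose phi' x := f' ((x - mean) / sg) / sg.
have dphi (x : R) : is_derive x (1:R) phi (phi' x).
  have da : is_derive x (1:R) (fun y : R => (y - mean) / sg) sg^-1.
    by apply: is_derive_eq; rewrite /GRing.scale/=; lra.
  exact: (@is_derive1_comp R f (fun y => (y - mean) / sg) x _ _ (df _) da).
have cphi' : continuous phi'.
  move=> x; apply: cvgM; last exact: cvg_cst.
  apply: (@continuous_comp _ _ _ (fun y : R => (y - mean) / sg) f').
    by apply: cvgM; [apply: cvgB; [exact: cvg_id|exact: cvg_cst]|exact: cvg_cst].
  exact: cf'.
have := @stein_identity _ _ c s J c0 s0 cs J0 phi phi' B (2 / sg) dphi cphi' _ _.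
move=> /(_ (fun x => bf _)) /(_ _) H.
have {}H : Ex (fun t => f (F t) * L t) = Ex (fun t => f' (F t) / sg * W t).
  apply: H => x; rewrite /phi' normrM normfV (gtr0_norm sg0).
  by rewrite ler_wpM2r ?invr_ge0 ?(ltW sg0).
have tfL : tame (fun t => f (F t) * L t) by exact: tameM.
have tfW : tame (fun t => f' (F t) / sg * W t).
  by apply: tameM => //; apply: tameM => //; exact: tame_cst.
have tVW : tame (fun t => V - W t) by apply: tameB => //; exact: tame_cst.
have /= -> : Ex (fun t => h ((T t - mean) / sg)) - Nh =
   Ex (fun t => V^-1 * (f' (F t) * (V - W t)) - sg^-1 * (f (F t) * cremainder t)).
  transitivity (Ex (fun t => h (F t) - Nh) + sg^-1 * (Ex (fun t => f (F t) * L t) - Ex (fun t => f' (F t) / sg * W t))).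
    by rewrite H subrr mulr0 addr0 ExB ?Ex_cst//; exact: tame_cst.
  rewrite -ExB// -ExZ; last exact: tameB.
  rewrite -ExD; last 2 first.
  - by apply: tameB => //; exact: tame_cst.
  - by apply: tameZ; exact: tameB.
  apply: eq_Ex => t; rewrite -eqf /F /cremainder -sgV.
  by move: (f _) (f' _) => u v; field; rewrite gt_eqF.
have tR1' : tame cremainder := tame_cremainder.
apply: le_trans (le_norm_Ex _) _.
  by apply: tameB; apply: tameZ; exact: tameM.
apply: (@le_trans _ _ (Ex (fun t => 2 / V * `|V - W t| + B / sg * `|cremainder t|))).
  apply: le_Ex.
  - by apply/tame_norm/tameB; apply: tameZ; exact: tameM.
  - by apply: tameD; apply/tameZ/tame_norm.
  move=> t; apply: le_trans (ler_normB _ _) _; apply: lerD.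
    rewrite normrM normfV (gtr0_norm V0) normrM mulrCA mulrA ler_wpM2r//.
    by rewrite ler_wpM2r ?invr_ge0 ?(ltW V0).
  rewrite normrM normfV (gtr0_norm sg0) normrM mulrCA mulrA ler_wpM2r//.
  by rewrite ler_wpM2r ?invr_ge0 ?(ltW sg0).
rewrite ExD ?ExZ; last 4 first.
- exact: tame_norm.
- exact: tame_norm.
- by apply/tameZ/tame_norm.
- by apply/tameZ/tame_norm.
apply: lerD; first by rewrite -mulrA [V^-1 * _]mulrC.
rewrite -mulrA; apply: ler_wpM2l; first by apply: le_trans (bf 0).
by rewrite mulrC ler_wpM2r ?invr_ge0 ?(ltW sg0) ?Ex_abs_cremainder.
Qed.

(** The threshold on [q] makes the error [126 q] of [variance_approx] at most half
of the main term. *)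
Lemma variance_ge : 252 / lin_var <= q -> m * lin_var / 2 <= V.
Proof.
move=> hq; have := variance_approx; rewrite ler_norml => /andP[h _].
have t0 := tau2_gt0; have q0 := q_gt0.
have : 252 <= q * lin_var by rewrite -ler_pdivrMr.
move=> hk; have : 0 <= q * (q * lin_var - 252) by rewrite mulr_ge0 ?(ltW q0) ?subr_ge0.
have -> : q * (q * lin_var - 252) = m * lin_var - 252 * q.
  by rewrite mulrBr mulrA -expr2 q_sqr; congr (_ - _); rewrite mulrC.
by lra.
Qed.

(** With [V >= m lin_var / 2], the two terms of [stein_test_bound] are of order
[1 / q]; the fluctuation is at most [(126 + 23) q] by [variance_approx] and
[Ex_kerpart_approx]. *)
Definition stein_const : R :=
  596 / lin_var + (1 + (normal_pdf (0:R) 1 1)^-1) * (31 / Num.sqrt (lin_var / 2)).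

Lemma stein_const_gt0 : 0 < stein_const.
Proof.
have t0 := tau2_gt0; apply: ltr_pwDl; first by apply: divr_gt0 t0; rewrite ltr0n.
apply: mulr_ge0; first by apply: addr_ge0 => //; rewrite invr_ge0 normal_pdf_ge0.
by apply: divr_ge0 => //; exact: sqrtr_ge0.
Qed.

Lemma stein_test_rate h : 252 / lin_var <= q -> test_fun h ->
  `|Ex (fun t => h ((T t - mean) / Num.sqrt V)) - \int[normal_prob (0:R) 1]_x h x| <=
  stein_const / q.
Proof.
move=> hq th; have Vge := variance_ge hq.
have q0 := q_gt0; have t0 := tau2_gt0; have m0 := m_gt0.
have V1 : 0 < m * lin_var / 2 by rewrite !mulr_gt0.
have V0 : 0 < V by exact: lt_le_trans Vge.
apply: le_trans (stein_test_bound V0 th) _.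
rewrite /stein_const [leRHS]mulrDl; apply: lerD.
  have h1 : Ex (fun t => `|V - W t|) <= 149 * q.
    have tW : tame W := tame_kerpart J c0 s0 cs.
    have tWm : tame (fun t => `|W t - m * lin_var|) by apply/tame_norm/tameB => //; exact: tame_cst.
    apply: (@le_trans _ _ (Ex (fun t => 126 * q + `|W t - m * lin_var|))).
      apply: le_Ex.
      - by apply/tame_norm/tameB => //; exact: tame_cst.
      - by apply: tameD => //; exact: tame_cst.
      - move=> t; have -> : V - W t = (V - m * lin_var) - (W t - m * lin_var) by ring.
        by apply: le_trans (ler_normB _ _) _; rewrite lerD2r variance_approx.
    rewrite ExD ?Ex_cst//; last exact: tame_cst.
    by have := Ex_kerpart_approx; lra.
  rewrite -mulrA -ler_pdivlMl//; rewrite ler_pdivrMr//.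
  apply: le_trans h1 _.
  (* [596 = 4 * 149]: a factor 2 from the bound on [f'] and a factor 2 from the lower bound on the variance. *)
  apply: (@le_trans _ _ (2^-1 * (596 / lin_var / q) * (m * lin_var / 2))).
    have -> : 2^-1 * (596 / lin_var / q) * (m * lin_var / 2) = 149 * (m / q).
      by field; rewrite !gt_eqF.
    by rewrite -[X in _ * (X / _)]q_sqr expr2 mulfK ?lexx// gt_eqF.
  rewrite [596 * (lin_var^-1 / q)]mulrA; apply: ler_wpM2l Vge.
  by rewrite !mulr_ge0 ?invr_ge0 ?(ltW q0) ?(ltW t0) ?ler0n.
rewrite -mulrA; apply: ler_wpM2l; first by rewrite addr_ge0// invr_ge0 normal_pdf_ge0.
rewrite -mulrA ler_wpM2l// -invfM lef_pV2 ?posrE ?mulr_gt0 ?sqrtr_gt0 ?divr_gt0//.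
rewrite -sqrtrM; last by rewrite divr_ge0// ltW.
by apply: ler_wsqrtr; apply: le_trans Vge; rewrite mulrC mulrA.
Qed.

End cone_moments.

(** * Normal tails and quantiles *)

Section normal_tail.
Context {R : realType}.
Local Notation TR := (measurableTypeR R).
Local Notation mu := (@lebesgue_measure R).
Local Notation gam := (normal_prob (0:R) 1).
Local Notation pdf := (normal_pdf (0:R) 1).

Lemma normal_prob_oray (x : R) : gam `]x, +oo[ = (gtail x)%:E.
Proof.
rewrite -gtailE /normal_prob; apply: integral_itv_obnd_cbnd.
by apply/measurable_EFinP/measurable_funTS; exact: measurable_normal_pdf.
Qed.

Lemma normal_prob_olray (x : R) : gam `]-oo, x[ = (gtail (- x))%:E.
Proof.
rewrite -gtailE -normal_prob_lray /normal_prob; apply: integral_itv_bndo_bndc.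
by apply/measurable_EFinP/measurable_funTS; exact: measurable_normal_pdf.
Qed.

Lemma gtailN (x : R) : gtail (- x) = 1 - gtail x.
Proof.
apply: EFin_inj; rewrite EFinB -normal_prob_olray -gtailE.
by rewrite -probability_setC//= setCitvr.
Qed.

Lemma normal_prob_itv (x y : R) : x <= y ->
  gam `[x, y[ = (gtail x - gtail y)%:E.
Proof.
move=> xy; rewrite EFinB -!gtailE.
rewrite (_ : `[x, y[%classic = (`[x, +oo[ `\` `[y, +oo[ : set TR)); last first.
  apply/seteqP; split => z /=; rewrite !in_itv/= !andbT.
    by move=> /andP[-> zy]; split => //; apply/negP; rewrite -ltNge.
  by move=> [-> /negP]; rewrite -ltNge.
rewrite measureD//=; last by rewrite -ge0_fin_numE// fin_num_measure.
congr (_ - gam _)%E; apply/seteqP; split => z /=; rewrite !in_itv/= !andbT; first by case.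
by move=> yz; split => //; exact: le_trans yz.
Qed.

Lemma gtail_le (x y : R) : x <= y -> gtail y <= gtail x.
Proof.
by move=> xy; rewrite -subr_ge0 -lee_fin -normal_prob_itv.
Qed.

Lemma normal_prob_itv_le (x y k : R) : x <= y ->
  (forall z, pdf z <= k) -> (gam `[x, y[ <= (k * (y - x))%:E)%E.
Proof.
move=> xy pk; rewrite /normal_prob.
apply: (@le_trans _ _ (\int[mu]_(t in `[x, y[) (cst k%:E) t)%E).
  apply: ge0_le_integral => //.
  - by move=> t _; rewrite lee_fin normal_pdf_ge0.
  - by apply/measurable_EFinP/measurable_funTS; exact: measurable_normal_pdf.
  - by move=> t _; rewrite lee_fin.
rewrite integral_cst//= lebesgue_measure_itv/= lte_fin; case: ltP => [_|yx].
  by rewrite -EFinB -EFinM.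
by rewrite mule0 lee_fin mulr_ge0 ?subr_ge0// (le_trans (normal_pdf_ge0 0 1 0)).
Qed.

Lemma pdf_le0 (z : R) : pdf z <= pdf 0.
Proof.
rewrite !pdfE ler_wpM2l ?invr_ge0 ?sqrtr_ge0// ler_expR expr0n/= oppr0 mul0r.
by rewrite mulNr oppr_le0 divr_ge0 ?sqr_ge0.
Qed.

Lemma pdf_le (z w : R) : `|z| <= w -> pdf w <= pdf z.
Proof.
move=> zw; rewrite !pdfE ler_wpM2l ?invr_ge0 ?sqrtr_ge0// ler_expR.
rewrite ler_wpM2r ?invr_ge0// lerN2 -real_normK ?num_real//.
by rewrite ler_sqr ?nnegrE// (le_trans _ zw).
Qed.

Lemma gtail_lip (x y : R) : `|gtail x - gtail y| <= pdf 0 * `|x - y|.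
Proof.
wlog xy : x y / x <= y => [hw|].
  by have [|/ltW] := leP x y; [exact: hw|rewrite distrC [`|x - y|]distrC; exact: hw].
rewrite ger0_norm ?subr_ge0 ?gtail_le// -lee_fin -normal_prob_itv//.
rewrite distrC ger0_norm ?subr_ge0//; apply: normal_prob_itv_le => // z.
exact: pdf_le0.
Qed.

Lemma continuous_gtail : continuous (gtail : R -> R).
Proof.
move=> x; apply/cvgrPdist_le => e e0.
near=> y; apply: le_trans (gtail_lip _ _) _.
rewrite -ler_pdivlMl ?pdf_gt0//.
near: y; apply: cvgr_dist_le; first exact: cvg_id.
by rewrite mulr_gt0 ?invr_gt0 ?pdf_gt0.
Unshelve. all: by end_near. Qed.

Lemma gtail0 : gtail (0 : R) = 2^-1.
Proof. by have := gtailN 0; rewrite oppr0; lra. Qed.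

Lemma gtail_small (e : R) : 0 < e -> exists2 M, 0 < M & gtail M <= e.
Proof.
move=> e0; exists (pdf 0 / e); first by rewrite divr_gt0 ?pdf_gt0.
have M0 : 0 < pdf 0 / e by rewrite divr_gt0 ?pdf_gt0.
have := gtail_mills (ltW M0); move=> h; have := le_trans h (pdf_le0 _).
by rewrite mulrAC ler_pdivrMr// ler_pM2l ?pdf_gt0.
Qed.

(** The tail is continuous and takes all values in [(0, 1)], so the defining
equation of the quantile has a solution. *)
Lemma normal_quantileP (a : R) : 0 < a < 1 -> gtail (normal_quantile a) = a.
Proof.
move=> /andP[a0 a1].
suff [z hz] : exists z : R, gam `[z, +oo[ = a%:E.
  by rewrite /gtail /normal_quantile; case: xgetP => [w _ /= ->//|/(_ z)].
have [M M0 hM] := gtail_small a0.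
have [N N0 hN] : exists2 N, 0 < N & gtail N <= 1 - a by apply: gtail_small; rewrite subr_gt0.
have NM : - N <= M by apply: (@le_trans _ _ 0); [rewrite oppr_le0 ltW|exact: ltW].
have [] := @IVT _ gtail (- N) M a NM.
- by apply: continuous_subspaceT; exact: continuous_gtail.
- have h : a <= gtail (- N) by rewrite gtailN; lra.
  by rewrite ge_min le_max hM h orbT.
- by move=> z _ hz; exists z; rewrite gtailE hz.
Qed.

Lemma normal_quantile_gt0 (a : R) : 0 < a < 1 -> 0 < normal_quantile (a / 2).
Proof.
move=> /andP[a0 a1]; rewrite ltNge; apply/negP => z0.
have := gtail_le z0; rewrite gtail0 normal_quantileP; last by apply/andP; split; lra.
by lra.
Qed.

Lemma normal_two_sided (z : R) : 0 <= z ->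
  gam [set x : TR | z < `|x|] = (2 * gtail z)%:E.
Proof.
move=> z0; rewrite (_ : [set x : TR | z < `|x|] = (`]z, +oo[ `|` `]-oo, - z[ : set TR)).
  rewrite measureU//=.
  - by rewrite normal_prob_oray normal_prob_olray opprK -EFinD mulr2n mulrDl mul1r.
  - apply/seteqP; split => // x /=; rewrite !in_itv/= andbT => -[h1 h2].
    by have := lt_trans h1 h2; move: z0; clear; lra.
by apply/seteqP; split => x /=; rewrite !in_itv/= andbT ltrNr ltr_normr; [move=> /orP|move=> ?; apply/orP].
Qed.

Lemma normal_prob_itv_ge (a b M : R) : a <= b -> - M <= a -> b <= M ->
  (((b - a) * pdf M)%:E <= gam `[a, b])%E.
Proof.
move=> ab Ma bM; rewrite /normal_prob.
apply: (@le_trans _ _ (\int[mu]_(t in `[a, b]) (cst (pdf M)%:E) t)%E).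
  rewrite integral_cst//= lebesgue_measure_itv/= lte_fin; case: ltP => [_|yx].
    by rewrite -EFinB -EFinM mulrC.
  by rewrite mule0 lee_fin mulr_le0_ge0 ?subr_le0 ?normal_pdf_ge0.
apply: ge0_le_integral => //.
- by move=> t _; rewrite lee_fin normal_pdf_ge0.
- by apply/measurable_EFinP/measurable_funTS; exact: measurable_normal_pdf.
- move=> t /=; rewrite in_itv/= => /andP[h1 h2]; rewrite lee_fin; apply: pdf_le.
  by rewrite ler_norml (le_trans Ma h1) (le_trans h2 bM).
Qed.

End normal_tail.

(** * Rejection probabilities of a nearly normal statistic *)

Section law_of_statistic.
Context {R : realType} {d : nat}.
Local Notation TR := (measurableTypeR R).
Local Notation gam := (normal_prob (0:R) 1).
Local Notation pdf := (normal_pdf (0:R) 1).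

Section pushforward_law.
Variable f : d.-tuple TR -> R.
Hypothesis mf : measurable_fun [set: d.-tuple TR] (f : d.-tuple TR -> TR).

Let mf_mixin := isMeasurableFun.Build _ _ _ _ (f : d.-tuple TR -> TR) mf.
Let rv : {mfun d.-tuple TR >-> TR} := HB.pack (f : d.-tuple TR -> TR) mf_mixin.

Lemma tv_le1 : (tv_dist (pushforward (std_gauss d) f) gam <= 1%:E)%E.
Proof.
apply: ge_ereal_sup => _ [B mB <-].
have p1 : (0 <= distribution (std_gauss d) rv B <= 1)%E by rewrite measure_ge0 probability_le1.
have p2 : (0 <= gam B <= 1)%E by rewrite measure_ge0 probability_le1.
change (`|distribution (std_gauss d) rv B - gam B| <= 1)%E.
move: (distribution _ _ _) (gam B) p1 p2 => [x||] [y||] //= /andP[h1 h2] /andP[h3 h4] //.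
move: h1 h2 h3 h4; rewrite !lee_fin => ? ? ? ?.
by rewrite ler_norml; apply/andP; split; lra.
Qed.

Lemma tv_le_test (e : R) :
  (forall h, test_fun h -> `|Ex (fun t => h (f t)) - \int[gam]_x h x| <= e) ->
  (tv_dist (pushforward (std_gauss d) f) gam <= e%:E)%E.
Proof.
move=> H; apply: (@tv_test_fun _ (distribution (std_gauss d) rv) gam e) => h th.
suff -> : (\int[distribution (std_gauss d) rv]_x h x)%R = Ex (fun t => h (f t)) by exact: H.
rewrite /Ex /Rintegral; congr fine.
rewrite (@ge0_integral_distribution _ _ _ _ _ (std_gauss d) rv (EFin \o h))//.
  by apply/measurable_EFinP; exact: measurable_test_fun.
by move=> x; rewrite lee_fin; have /andP[] := th.2 x.
Qed.

Lemma Ex_indic_pushforward (B : set TR) : measurable B ->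
  (Ex (fun t => \1_B (f t)))%:E = pushforward (std_gauss d) f B.
Proof.
move=> mB; have mfB : measurable (f @^-1` B) by rewrite -[X in measurable X]setTI; exact: mf.
have e : (\int[std_gauss d]_t (\1_B (f t))%:E)%E = std_gauss d (f @^-1` B).
  by rewrite (integral_indic _ measurableT mfB) setIT.
by rewrite /Ex /Rintegral e fineK// fin_num_measure.
Qed.

Lemma tv_indic (B : set TR) (e : R) : measurable B ->
  (tv_dist (pushforward (std_gauss d) f) gam <= e%:E)%E ->
  `|Ex (fun t => \1_B (f t)) - fine (gam B)| <= e.
Proof.
move=> mB tv; rewrite -lee_fin; apply: le_trans tv.
apply: ereal_sup_ubound; exists B => //.
by rewrite -Ex_indic_pushforward// -[in LHS](@fineK _ (gam B)) ?fin_num_measure.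
Qed.

End pushforward_law.

Lemma measurable_reject (z : R) : measurable [set x : TR | z < `|x|].
Proof.
rewrite -[X in measurable X]setTI.
rewrite (_ : [set x : TR | z < `|x|] = (fun x : TR => `|x|) @^-1` `]z, +oo[%classic); last first.
  by apply/seteqP; split => x /=; rewrite in_itv/= andbT.
by apply: (@normr_measurable R).
Qed.

Lemma reject_indic (F : d.-tuple TR -> R) (z : R) :
  (fun t => (z < `|F t|)%R%:R) = (fun t => \1_[set x : TR | z < `|x|] (F t)) :> (_ -> R).
Proof. by apply/funext => t; rewrite indicE mem_setE. Qed.

Lemma tame_indic (F : d.-tuple TR -> R) (B : set TR) : tame F -> measurable B ->
  tame (fun t => \1_B (F t) : R).
Proof.
move=> tF mB; apply: (@tame_comp_bounded _ _ F \1_B 1) => //.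
by move=> x; rewrite indicE; case: (_ \in _); rewrite ?normr1 ?normr0.
Qed.

Lemma tame_reject (F : d.-tuple TR -> R) (z : R) : tame F ->
  tame (fun t => (z < `|F t|)%R%:R : R).
Proof. by move=> tF; rewrite reject_indic; apply: tame_indic => //; exact: measurable_reject. Qed.

Lemma Ex_size (F : d.-tuple TR -> R) (z e : R) : 0 <= z -> tame F ->
  (tv_dist (pushforward (std_gauss d) F) gam <= e%:E)%E ->
  `|Ex (fun t => (z < `|F t|)%R%:R) - 2 * gtail z| <= e.
Proof.
move=> z0 tF tv; rewrite reject_indic.
by have := tv_indic tF.1 (measurable_reject z) tv; rewrite normal_two_sided.
Qed.

(** Let [F] be within [E] of a translate by [delta] of the nearly normal [F0].  If
[F0 + delta] lies in [[- z / 2, z / 2]], rejection forces [E >= z / 2], which is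
charged to Markov's inequality.  The interval has normal mass at least its
length [z] times the least density on it. *)
Lemma Ex_reject_le (F0 F E : d.-tuple TR -> R) (z delta D e : R) : 0 < z ->
  tame F0 -> tame F -> tame E ->
  (tv_dist (pushforward (std_gauss d) F0) gam <= e%:E)%E ->
  `|delta| <= D -> (forall t, `|F t - F0 t - delta| <= E t) ->
  Ex (fun t => (z < `|F t|)%R%:R) <= 1 - z * pdf (D + z) + e + 2 / z * Ex E.
Proof.
move=> z0 tF0 tF tE tv dD FE.
(* [F0] in [B] means that [F0 + delta] is at most [z / 2] in absolute value. *)
pose B : set TR := `[- (z / 2) - delta, z / 2 - delta]%classic.
have mB : measurable B by exact: measurable_itv.
have hB : z * pdf (D + z) <= fine (gam B).
  rewrite -lee_fin fineK ?fin_num_measure//.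
  have -> : z * pdf (D + z) = (z / 2 - delta - (- (z / 2) - delta)) * pdf (D + z) by field.
  by move: dD; rewrite ler_norml => /andP[d1 d2]; apply: normal_prob_itv_ge; lra.
have h1 := tv_indic tF0.1 mB tv; move: h1; rewrite ler_norml => /andP[h1 _].
have tB : tame (fun t => \1_B (F0 t) : R).
  exact: tame_indic.
have : Ex (fun t => (z < `|F t|)%R%:R) <= Ex (fun t => (1 - \1_B (F0 t)) + 2 / z * E t).
  apply: le_Ex; first exact: tame_reject.
    by apply: tameD; [apply: tameB => //; exact: tame_cst|exact: tameZ].
  move=> t; have E0 : 0 <= E t by exact: le_trans (FE t).
  have E1 : 0 <= 2 / z * E t by rewrite mulr_ge0// divr_ge0// ltW.
  rewrite indicE; have [FB|FB] := boolP (F0 t \in B); last first.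
    by case: (z < _) => /=; lra.
  case: ltP => /= hz; last by lra.
  rewrite subrr add0r mulrAC ler_pdivlMr// mul1r.
  move: FB; rewrite inE /B/= in_itv/= => /andP[b1 b2].
  by move: hz (FE t); rewrite ltr_normr ler_norml => /orP[] hz /andP[? ?]; lra.
rewrite ExD ?ExB ?ExZ ?Ex_cst//; last 3 first.
- exact: tame_cst.
- by apply: tameB => //; exact: tame_cst.
- exact: tameZ.
by lra.
Qed.

(** Acceptance forces [X <= z - a < 0]; this is Chebyshev's inequality. *)
Lemma Ex_reject_ge (F X : d.-tuple TR -> R) (z a : R) : z < a -> tame F -> tame X ->
  (forall t, a + X t <= F t) ->
  1 - Ex (fun t => X t ^+ 2) / (a - z) ^+ 2 <= Ex (fun t => (z < `|F t|)%R%:R).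
Proof.
move=> za tF tX FX; have az : 0 < (a - z) ^+ 2 by rewrite exprn_gt0// subr_gt0.
have tr := tame_reject z tF.
have -> : 1 - Ex (fun t => X t ^+ 2) / (a - z) ^+ 2 = Ex (fun t => 1 - ((a - z) ^+ 2)^-1 * X t ^+ 2).
  rewrite ExB ?Ex_cst ?ExZ; last 2 first.
  - exact: tame_cst.
  - by apply: tameZ; exact: tameX.
  - by rewrite mulrC.
  - exact: tameX.
apply: le_Ex => //.
  by apply: tameB; [exact: tame_cst|apply: tameZ; exact: tameX].
move=> t; have Y0 : 0 <= ((a - z) ^+ 2)^-1 * X t ^+ 2.
  by rewrite mulr_ge0 ?sqr_ge0// invr_ge0 ltW.
have [Fz|Fz] := ltP => /=; first by lra.
rewrite subr_le0 mulrC ler_pdivlMr// mul1r.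
have Xz : X t <= z - a by have := FX t; move: Fz; rewrite ler_norml => /andP[_ ?]; lra.
by rewrite -sqrrN opprB; move: Xz za; move: (X t) => x; nra.
Qed.

End law_of_statistic.

(** * The calibrated test *)

Section calibrated_test.
Context {R : realType} {d : nat}.
Local Notation TR := (measurableTypeR R).
Variable K : set 'rV[R]_d.
Local Notation T := (fun t : d.-tuple TR => lrt_stat K (obs 0 t)).

Lemma lrt_mean0E : lrt_mean0 K = Ex T.
Proof. by rewrite /lrt_mean0 unlock. Qed.

Lemma lrt_sd0E : lrt_sd0 K = Num.sqrt (Ex (fun t => (T t - Ex T) ^+ 2)).
Proof. by rewrite /lrt_sd0 /variance covariance.unlock unlock. Qed.

Lemma power_tsE alpha mu : power_ts K alpha mu =
  Ex (fun t : d.-tuple TR => (normal_quantile (alpha / 2) < `|lrt_std K (obs mu t)|)%R%:R).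
Proof. by rewrite /power_ts unlock. Qed.

Lemma tame_lrt_std mu : tame (fun t : d.-tuple TR => lrt_stat K (obs mu t)) ->
  tame (fun t : d.-tuple TR => lrt_std K (obs mu t)).
Proof.
move=> tT; rewrite /lrt_std.
apply: (@tame_eq _ _ (fun t => (lrt_sd0 K)^-1 * (lrt_stat K (obs mu t) - lrt_mean0 K))).
  by move=> t; rewrite mulrC.
by apply: tameZ; apply: tameB => //; exact: tame_cst.
Qed.

Lemma size_error alpha e : 0 < alpha < 1 -> tame T -> (tv_lrt_normal K <= e%:E)%E ->
  `|power_ts K alpha 0 - alpha| <= e.
Proof.
move=> a01 tT tv; rewrite power_tsE.
have z0 := normal_quantile_gt0 a01.
have := @Ex_size _ _ (fun t => lrt_std K (obs 0 t)) _ _ (ltW z0) (tame_lrt_std tT) tv.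
rewrite normal_quantileP; last by move: a01 => /andP[? ?]; apply/andP; split; lra.
by have -> : 2 * (alpha / 2) = alpha by field.
Qed.

End calibrated_test.

Lemma increment_bound (R : realType) (u v b x n r g lam b2 g2 : R) :
  u + 2 * (b + x) <= v -> v <= u + 2 * (b + x) + 2 * n ->
  2 * `|b| <= 1 + b2 -> 2 * `|g| <= lam + g2 ->
  `|v + (2 * g + r) - u - (2 * x + r)| <= 1 + b2 + 2 * n + lam + g2.
Proof.
move=> h1 h2 h3 h4; have := ler_norm b; have := ler_norm (- b).
have := ler_norm g; have := ler_norm (- g); rewrite !normrN.
by move=> *; rewrite ler_norml; apply/andP; split; lra.
Qed.

(** * Power bounds for a fixed dimension *)

Section cone_test_bounds.
Context {R : realType} {p : nat}.
Local Notation TR := (measurableTypeR R).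
Local Notation gam := (normal_prob (0:R) 1).
Local Notation pdf := (normal_pdf (0:R) 1).
Variables (c s : R) (J : {set 'I_p.+1}).
Hypotheses (c0 : 0 < c) (s0 : 0 < s) (cs : c ^+ 2 + s ^+ 2 = 1) (J0 : ord0 \notin J).
Hypotheses (Jpos : (0 < #|J|)%N) (rest1 : (#|restJ J| <= 1)%N).
Implicit Types (t : p.+1.-tuple TR) (mu : 'rV[R]_p.+1).
Local Notation K := (coneJ c J).
Local Notation P := (projJ c s J).
Local Notation m := (#|J|%:R : R).
Local Notation q := (Num.sqrt m).
Local Notation T := (fun t => lrt_stat K (obs 0 t)).
Local Notation tau := (lin_var c s).
Local Notation sd := (lrt_sd0 K).

Let KP : cone_projector K P := projJP c0 s0 cs J0.
Let q0 : 0 < q := q_gt0 Jpos.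
Let t0 : 0 < tau := tau2_gt0 c0 s0.

Let tT mu : tame (fun t => lrt_stat K (obs mu t)) := tame_lrt_stat c0 s0 cs J0 mu.
Let tF mu : tame (fun t => lrt_std K (obs mu t)) := tame_lrt_std (tT mu).

Lemma tv_rate : 252 / tau <= q -> (tv_lrt_normal K <= (stein_const c s / q)%:E)%E.
Proof.
move=> hq; apply: (tv_le_test (tF 0).1) => h th.
have := stein_test_rate c0 s0 cs J0 Jpos rest1 hq th.
by rewrite /lrt_std lrt_mean0E lrt_sd0E.
Qed.

(** The mean vector with the unconstrained coordinates set to 0: these act
additively on the statistic and are better treated exactly, since the
tangent bounds would lose their square [rest_sqr]. *)
Definition axial_part mu : 'rV[R]_p.+1 := \row_i (if i \in restJ J then 0 else mu 0 i).
Definition axial_sqr mu : R := mu 0 ord0 ^+ 2 + \sum_(j in J) mu 0 j ^+ 2.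
Definition rest_sqr mu : R := \sum_(j in restJ J) mu 0 j ^+ 2.
Definition rest_noise mu t : R := \sum_(j in restJ J) mu 0 j * tnth t j.
(** The first-order effect of the axial part of the mean, recentred at the value it
has when [a = 0] and [r = q]. *)
Definition axial_noise mu t : R := dot (axial_part mu) (P (obs 0 t)) - s * c * q * mu 0 ord0.

Lemma obsE mu t j : obs mu t 0 j = mu 0 j + tnth t j.
Proof. by rewrite /obs !mxE. Qed.

Lemma axial_part_rest mu j : j \in restJ J -> axial_part mu 0 j = 0.
Proof. by move=> jr; rewrite mxE jr. Qed.

Lemma axial_part_0 mu : axial_part mu 0 ord0 = mu 0 ord0.
Proof. by rewrite mxE finset.in_setC !inE eqxx. Qed.

Lemma axial_part_J mu j : j \in J -> axial_part mu 0 j = mu 0 j.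
Proof. by move=> jJ; rewrite mxE finset.in_setC !inE jJ orbT. Qed.

Lemma dot_axial_part mu y : dot (axial_part mu) y = mu 0 ord0 * y 0 ord0 + \sum_(j in J) mu 0 j * y 0 j.
Proof.
rewrite /dot (sum_splitJ J0) axial_part_0 [X in _ + X]big1 ?addr0.
  by congr (_ + _); apply: eq_bigr => j jJ; rewrite axial_part_J.
by move=> j jr; rewrite axial_part_rest// mul0r.
Qed.

Lemma axial_sqrE mu : axial_sqr mu = dot (axial_part mu) (axial_part mu).
Proof.
rewrite /axial_sqr dot_axial_part axial_part_0 -expr2; congr (_ + _).
by apply: eq_bigr => j jJ; rewrite axial_part_J// expr2.
Qed.

Lemma lrt_stat_axial mu t : lrt_stat K (obs mu t) =
  lrt_stat K (obs (axial_part mu) t) + (2 * rest_noise mu t + rest_sqr mu).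
Proof.
rewrite !(lrt_stat_coneJ c0 s0 cs J0).
have -> : radJ J (obs (axial_part mu) t) = radJ J (obs mu t).
  by rewrite /radJ; congr Num.sqrt; apply: eq_bigr => j jJ; rewrite !obsE axial_part_J.
rewrite -[RHS]addrA !obsE axial_part_0; congr (_ + _).
rewrite /rest_noise /rest_sqr mulr_sumr -!big_split/=; apply: eq_bigr => j jr.
by rewrite !obsE axial_part_rest// add0r; ring.
Qed.

Lemma lrt_axial_lb mu t : T t + 2 * dot (axial_part mu) (P (obs 0 t)) <= lrt_stat K (obs (axial_part mu) t).
Proof.
have := lrt_stat_lb KP (obs 0 t) (axial_part mu).
by have -> : obs 0 t + axial_part mu = obs (axial_part mu) t by rewrite /obs add0r addrC.
Qed.

Lemma dot_monotone_le (h u : 'rV[R]_p.+1) : dot u u <= dot h u -> dot h u <= dot h h.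
Proof.
have := dot_ge0 (h - u); rewrite dotBl !dotBr (dotC u h).
by move: (dot u u) (dot h u) (dot h h) => x y z; lra.
Qed.

(** The upper tangent is taken at the shifted point; monotonicity of the projection
bounds the change of slope. *)
Lemma lrt_axial_ub mu t : lrt_stat K (obs (axial_part mu) t) <=
  T t + 2 * dot (axial_part mu) (P (obs 0 t)) + 2 * axial_sqr mu.
Proof.
set h := axial_part mu.
have e : obs 0 t + h = obs h t by rewrite /obs add0r addrC.
have h1 := lrt_stat_ub KP (obs 0 t) h; rewrite e in h1.
apply: (le_trans h1); rewrite -[leRHS]addrA lerD2l -mulrDr ler_pM2l// -lerBlDl -dotBr.
have h2 := projector_monotone KP (obs h t) (obs 0 t).
have e2 : obs h t - obs 0 t = h by rewrite -e addrC addKr.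
rewrite e2 in h2; rewrite axial_sqrE -/h.
exact: dot_monotone_le.
Qed.

Lemma tame_axial_noise mu : tame (axial_noise mu).
Proof.
apply: tameB; last exact: tame_cst.
by apply: tame_sum => i _; apply: tameZ; exact: tame_projJ.
Qed.

Lemma tame_rest_noise mu : tame (rest_noise mu).
Proof.
by apply: tame_sum => i _; apply: tameZ; exact: tame_tnth.
Qed.

(** On [J] the projection shrinks [t] by a factor in [[0, 1]]; on the axis it is
[s c r] up to [3 |a|]. *)
Lemma axial_noise_le mu t : `|axial_noise mu t| <=
  `|mu 0 ord0| * (3 * `|tnth t ord0| + `|radJ J (obs 0 t) - q|) + `|\sum_(j in J) mu 0 j * tnth t j|.
Proof.
set S := \sum_(j in J) mu 0 j * tnth t j.
set r := radJ J (obs 0 t); set a := tnth t ord0.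
set k := rad_part c s a r / r.
have r0 : 0 <= r by exact: sqrtr_ge0.
have -> : axial_noise mu t = mu 0 ord0 * (axis_part c s a r - s * c * q) + k * S.
  rewrite /axial_noise dot_axial_part projJ_0 obs0E -/r -/a mulr_sumr.
  rewrite (eq_bigr (fun j => k * (mu 0 j * tnth t j))); first by ring.
  by move=> j jJ; rewrite projJ_J// !obs0E -/r -/a -/k; ring.
have /andP[k0 k1] : 0 <= k <= 1.
  by have := rad_ratio_bounds J c0 s0 cs (obs 0 t); rewrite obs0E.
apply: le_trans (ler_normD _ _) _; rewrite [`|k * S|]normrM normrM; apply: lerD; last first.
  by rewrite (ger0_norm k0) ler_piMl.
apply: ler_wpM2l => //.
have c1 := cos_le1 c0 cs; have s1 := sin_le1 s0 cs.
have /andP[h1 h2] := rayp_approx c0 s0 cs a r0.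
have h3 := nrmp_approx c0 s0 cs a r0; have h4 := nrmp_ge0 c s a r.
have -> : axis_part c s a r - s * c * q =
    (rayp c s a r - ray_coord c s a r) * c + nrmp c s a r * s + a * c * c + s * c * (r - q).
  by rewrite /axis_part /ray_coord; ring.
have g1 : `|(rayp c s a r - ray_coord c s a r) * c| <= `|a|.
  by rewrite normrM (ger0_norm h1) (gtr0_norm c0) (le_trans _ h2)// ler_piMr.
have g2 : `|nrmp c s a r * s| <= `|a|.
  by rewrite normrM (ger0_norm h4) (gtr0_norm s0) (le_trans _ h3)// ler_piMr.
have g3 : `|a * c * c| <= `|a|.
  by rewrite -mulrA normrM ler_piMr// normrM (gtr0_norm c0) mulr_ile1// ltW.
have g4 : `|s * c * (r - q)| <= `|r - q|.
  by rewrite normrM ler_piMl// normrM (gtr0_norm c0) (gtr0_norm s0) mulr_ile1// ltW.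
move: g1 g2 g3 g4; rewrite !ler_norml => /andP[? ?] /andP[? ?] /andP[? ?] /andP[? ?].
by apply/andP; split; lra.
Qed.

Lemma Ex_linear_sqr mu (A : {set 'I_p.+1}) :
  Ex (fun t => (\sum_(j in A) mu 0 j * tnth t j) ^+ 2) = \sum_(j in A) mu 0 j ^+ 2.
Proof.
have -> : (fun t => (\sum_(j in A) mu 0 j * tnth t j) ^+ 2) =
    (fun t => \sum_(i in A) \sum_(j in A) (mu 0 i * mu 0 j) * (tnth t i * tnth t j)).
  apply/funext => t; rewrite expr2 mulr_suml; apply: eq_bigr => i _.
  by rewrite mulr_sumr; apply: eq_bigr => j _; ring.
have tij i j : tame (fun t => (mu 0 i * mu 0 j) * (tnth t i * tnth t j)).
  by apply: tameZ; apply: tameM; exact: tame_tnth.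
rewrite Ex_sum; last by move=> i _; apply: tame_sum.
apply: eq_bigr => i iA; rewrite Ex_sum//.
rewrite (bigD1 i)//= big1 ?addr0 => [|j /andP[_ ji]].
  by rewrite ExZ ?Ex_tnthM ?eqxx ?mulr1 ?expr2//; apply: tameM; exact: tame_tnth.
by rewrite ExZ ?Ex_tnthM ?(negbTE ji) ?mulr0//; apply: tameM; exact: tame_tnth.
Qed.

Lemma Ex_axial_noise2 mu : Ex (fun t => axial_noise mu t ^+ 2) <= 44 * axial_sqr mu.
Proof.
set S := fun t => \sum_(j in J) mu 0 j * tnth t j.
set k := mu 0 ord0 ^+ 2.
have tS : tame S by apply: tame_sum => j _; apply: tameZ; exact: tame_tnth.
have ta : tame (fun t => tnth t ord0 ^+ 2) by apply: tameX; exact: tame_tnth.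
have tX : tame (fun t => chi J t ^+ 2) by apply: tameX; exact: tame_chi.
apply: (@le_trans _ _ (Ex (fun t => k * (36 * tnth t ord0 ^+ 2 + 4 * m^-1 * chi J t ^+ 2) + 2 * S t ^+ 2))).
  apply: le_Ex.
  - by apply: tameX; exact: tame_axial_noise.
  - by apply: tameD; [apply: tameZ; apply: tameD; apply: tameZ|apply: tameZ; apply: tameX].
  - move=> t; have h := axial_noise_le mu t; rewrite -/(S t) in h.
    have h2 := radJ_dev_sqr Jpos t.
    have m0 : 0 < m by rewrite ltr0n.
    have h3 : (radJ J (obs 0 t) - q) ^+ 2 <= m^-1 * chi J t ^+ 2 by rewrite ler_pdivlMl.
    rewrite -[leLHS]real_normK ?num_real//.
    apply: le_trans (_ : (`|mu 0 ord0| * (3 * `|tnth t ord0| + `|radJ J (obs 0 t) - q|) + `|S t|) ^+ 2 <= _).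
      by rewrite ler_sqr ?nnegrE// (le_trans _ h).
    rewrite -mulrA /k -[mu 0 ord0 ^+ 2]real_normK ?num_real// -[S t ^+ 2]real_normK ?num_real//.
    rewrite -[tnth t ord0 ^+ 2]real_normK ?num_real//.
    rewrite -[(_ - q) ^+ 2]real_normK ?num_real// in h3.
    move: h3; move: `|mu 0 ord0| `|tnth t ord0| `|radJ J (obs 0 t) - q| `|S t| (m^-1 * chi J t ^+ 2) => u v w x y h3.
    have h4 : u ^+ 2 * w ^+ 2 <= u ^+ 2 * y by rewrite ler_wpM2l// sqr_ge0.
    have h5 := sqr_ge0 (u * (3 * v + w) - x); have h6 := sqr_ge0 (u * (3 * v - w)).
    have -> : (u * (3 * v + w) + x) ^+ 2 = 2 * (u * (3 * v + w)) ^+ 2 + 2 * x ^+ 2 - (u * (3 * v + w) - x) ^+ 2.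
      by ring.
    have -> : (u * (3 * v + w)) ^+ 2 = 18 * (u ^+ 2 * v ^+ 2) + 2 * (u ^+ 2 * w ^+ 2) - (u * (3 * v - w)) ^+ 2.
      by ring.
    by lra.
rewrite ExD; last 2 first.
- by apply: tameZ; apply: tameD; apply: tameZ.
- by apply: tameZ; apply: tameX.
rewrite !ExZ//; last 2 first.
- exact: tameX.
- by apply: tameD; apply: tameZ.
rewrite ExD; try exact: tameZ.
rewrite !ExZ// Ex_tnth2 Ex_chi2 Ex_linear_sqr /axial_sqr -/k.
have m0 : m != 0 by rewrite pnatr_eq0 -lt0n.
have -> : 4 * m^-1 * (2 * m) = 8 by field.
have h : 0 <= \sum_(j in J) mu 0 j ^+ 2 by apply: sumr_ge0 => j _; exact: sqr_ge0.
have k0 : 0 <= k by exact: sqr_ge0.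
by move: (\sum_(j in J) _) h => y h; lra.
Qed.

Lemma axial_sqr_ge0 mu : 0 <= axial_sqr mu.
Proof. by rewrite axial_sqrE dot_ge0. Qed.

Lemma rest_sqr_ge0 mu : 0 <= rest_sqr mu.
Proof. by apply: sumr_ge0 => j _; exact: sqr_ge0. Qed.

Lemma axis_le_axial mu : `|mu 0 ord0| <= Num.sqrt (axial_sqr mu).
Proof.
rewrite -[leLHS]sqrtr_sqr ler_wsqrtr//.
by rewrite lerDl; apply: sumr_ge0 => j _; exact: sqr_ge0.
Qed.

(** The standard deviation of the statistic is at least [sd_lower * q], by
[variance_ge]. *)
Definition sd_lower : R := Num.sqrt (tau / 2).

Lemma sd_lower_gt0 : 0 < sd_lower.
Proof. by rewrite sqrtr_gt0 divr_gt0. Qed.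

Lemma sd_ge : 252 / tau <= q -> sd_lower * q <= sd.
Proof.
move=> hq; rewrite lrt_sd0E /sd_lower -sqrtrM; last by rewrite divr_ge0 ?(ltW t0).
apply: ler_wsqrtr; have := variance_ge c0 s0 cs J0 Jpos rest1 hq.
by apply: le_trans; rewrite mulrC mulrA.
Qed.

Lemma sd_le : sd <= 12 * q.
Proof.
rewrite lrt_sd0E -[leRHS]ger0_norm; last by rewrite mulr_ge0// ltW.
rewrite -sqrtr_sqr; apply: ler_wsqrtr.
have aux (V x w : R) : 1 <= x -> w <= 6 -> V - x ^+ 2 * w <= 126 * x -> V <= (12 * x) ^+ 2.
  move=> x1 w6 h; have : x ^+ 2 * w <= x ^+ 2 * 6 by rewrite ler_wpM2l// sqr_ge0.
  by nra.
apply: (aux _ _ tau (q_ge1 Jpos) (tau2_le cs)); rewrite q_sqr.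
by have := variance_approx c0 s0 cs J0 Jpos rest1; rewrite ler_norml => /andP[_].
Qed.

Lemma Ex_lrt_std2 : 0 < sd -> Ex (fun t => lrt_std K (obs 0 t) ^+ 2) = 1.
Proof.
move=> s1; have sV := lrt_sd0E K.
have -> : (fun t => lrt_std K (obs 0 t) ^+ 2) =
    (fun t => (sd ^+ 2)^-1 * (lrt_stat K (obs 0 t) - Ex T) ^+ 2).
  by apply/funext => t; rewrite /lrt_std lrt_mean0E expr_div_n mulrC.
rewrite ExZ; last by apply: tameX; apply: tameB => //; exact: tame_cst.
rewrite {1}sV sqr_sqrtr; last by apply: Ex_ge0 => t; exact: sqr_ge0.
by rewrite mulVf// gt_eqF//; rewrite -sqrtr_gt0 -sV.
Qed.

Let shift mu := (2 * (s * c * q * mu 0 ord0) + rest_sqr mu) / sd.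

(** Apply [Ex_reject_le] with the shift [(2 s c q mu_0 + rest_sqr) / sd].  The free
parameter [lam] balances the noise of the unconstrained coordinate, by
[2 |g| <= lam + g ^ 2 / lam]. *)
Lemma power_le mu alpha lam D z : z = normal_quantile (alpha / 2) -> 0 < alpha < 1 -> 252 / tau <= q -> 0 < lam ->
  (2 * Num.sqrt (axial_sqr mu) + rest_sqr mu / q) / sd_lower <= D ->
  power_ts K alpha mu <= 1 - z * pdf (D + z) + stein_const c s / q +
    2 / z * ((1 + 46 * axial_sqr mu + lam + rest_sqr mu / lam) / (sd_lower * q)).
Proof.
move=> zE a01 hq l0 hD; have z0 : 0 < z by rewrite zE; exact: normal_quantile_gt0.
have k0 := sd_lower_gt0; have kq := sd_ge hq.
have kq0 : 0 < sd_lower * q by rewrite mulr_gt0.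
have s1 : 0 < sd by exact: lt_le_trans kq.
have n0 := axial_sqr_ge0 mu; have r0 := rest_sqr_ge0 mu.
pose E t := sd^-1 * (1 + axial_noise mu t ^+ 2 + 2 * axial_sqr mu + lam + lam^-1 * rest_noise mu t ^+ 2).
have tA : tame (fun t => axial_noise mu t ^+ 2) by apply: tameX; exact: tame_axial_noise.
have tN : tame (fun t => lam^-1 * rest_noise mu t ^+ 2).
  by apply: tameZ; apply: tameX; exact: tame_rest_noise.
have tE1 : tame (fun t => 1 + axial_noise mu t ^+ 2) by apply: tameD => //; exact: tame_cst.
have tE2 : tame (fun t => 1 + axial_noise mu t ^+ 2 + 2 * axial_sqr mu).
  by apply: tameD => //; exact: tame_cst.
have tE3 : tame (fun t => 1 + axial_noise mu t ^+ 2 + 2 * axial_sqr mu + lam).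
  by apply: tameD => //; exact: tame_cst.
have tE4 := tameD tE3 tN.
have tE : tame E by exact: tameZ.
(* [s c <= 1] and [|mu_0|] is at most the axial norm. *)
have dD : `|shift mu| <= D.
  apply: le_trans hD; rewrite /shift normrM [`|sd^-1|]gtr0_norm ?invr_gt0//.
  have h1 : `|2 * (s * c * q * mu 0 ord0) + rest_sqr mu| <= q * (2 * Num.sqrt (axial_sqr mu) + rest_sqr mu / q).
    have -> : q * (2 * Num.sqrt (axial_sqr mu) + rest_sqr mu / q) = 2 * (q * Num.sqrt (axial_sqr mu)) + rest_sqr mu.
      by field; rewrite gt_eqF.
    apply: le_trans (ler_normD _ _) _; rewrite (ger0_norm r0) lerD2r normrM ger0_norm//.
    rewrite ler_wpM2l// normrM [`|s * c * q|]gtr0_norm ?mulr_gt0//.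
    apply: ler_pM => //; [by rewrite ltW ?mulr_gt0| |exact: axis_le_axial].
    rewrite ler_piMl ?(ltW q0)//.
    by rewrite mulr_ile1 ?(ltW s0) ?(ltW c0)// ?(sin_le1 s0 cs) ?(cos_le1 c0 cs).
  rewrite ler_pdivrMr//; apply: (le_trans h1).
  set Y := 2 * _ + _; have Y0 : 0 <= Y.
    by rewrite addr_ge0// ?mulr_ge0 ?invr_ge0 ?sqrtr_ge0 ?(ltW q0).
  have -> : q * Y = Y / sd_lower * (sd_lower * q) by field; rewrite gt_eqF.
  by rewrite ler_wpM2l// divr_ge0// ltW.
have FE t : `|lrt_std K (obs mu t) - lrt_std K (obs 0 t) - shift mu| <= E t.
  have -> : lrt_std K (obs mu t) - lrt_std K (obs 0 t) - shift mu =
      sd^-1 * (lrt_stat K (obs mu t) - lrt_stat K (obs 0 t) -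
        (2 * (s * c * q * mu 0 ord0) + rest_sqr mu)).
    by rewrite /lrt_std /shift; move: (lrt_stat K _) (lrt_stat K _) => x y; field; rewrite gt_eqF.
  rewrite normrM gtr0_norm ?invr_gt0// ler_wpM2l ?invr_ge0 ?(ltW s1)//.
  have h1 := lrt_axial_lb mu t; have h2 := lrt_axial_ub mu t.
  have h3 := lrt_stat_axial mu t.
  have h4 : dot (axial_part mu) (P (obs 0 t)) = axial_noise mu t + s * c * q * mu 0 ord0.
    by rewrite /axial_noise subrK.
  rewrite h4 in h1 h2; rewrite h3.
  have h5 : 2 * `|rest_noise mu t| <= lam + lam^-1 * rest_noise mu t ^+ 2.
    rewrite -[rest_noise mu t ^+ 2]real_normK ?num_real// -subr_ge0.
    have -> : lam + lam^-1 * `|rest_noise mu t| ^+ 2 - 2 * `|rest_noise mu t| =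
      lam^-1 * (lam - `|rest_noise mu t|) ^+ 2 by field; rewrite gt_eqF.
    by rewrite mulr_ge0 ?sqr_ge0// invr_ge0 ltW.
  have h6 : 2 * `|axial_noise mu t| <= 1 + axial_noise mu t ^+ 2.
    rewrite -[axial_noise mu t ^+ 2]real_normK ?num_real// -subr_ge0.
    have -> : 1 + `|axial_noise mu t| ^+ 2 - 2 * `|axial_noise mu t| = (1 - `|axial_noise mu t|) ^+ 2 by ring.
    exact: sqr_ge0.
  exact: increment_bound h1 h2 h6 h5.
have := Ex_reject_le z0 (tF 0) (tF mu) tE (tv_rate hq) dD FE.
rewrite power_tsE -zE => h; apply: (le_trans h); rewrite lerD2l.
apply: ler_wpM2l; first by rewrite divr_ge0// ltW.
rewrite /E ExZ// mulrC.
rewrite ExD// ExD//; last exact: tame_cst.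
rewrite ExD//; last exact: tame_cst.
rewrite ExD//; last exact: tame_cst.
rewrite !Ex_cst ExZ; last by apply: tameX; exact: tame_rest_noise.
rewrite /rest_noise Ex_linear_sqr -/(rest_sqr mu).
have h1 := Ex_axial_noise2 mu.
apply: ler_pM.
- by rewrite !addr_ge0 ?mulr_ge0 ?invr_ge0 ?(ltW l0)//; apply: Ex_ge0 => t; exact: sqr_ge0.
- by rewrite invr_ge0 ltW.
- by rewrite [lam^-1 * _]mulrC lerD2r lerD2r; move: h1; move: (Ex _) (axial_sqr _) => x y; lra.
- by rewrite lef_pV2 ?posrE.
Qed.

(** Comes from [4 E X ^ 2 / b ^ 2], where [X] is the centred noise of [power_ge]. *)
Definition power_const : R := 12 + 12 * (176 * (6 / (s * c ^+ 2)) ^+ 2 + 48) / sd_lower ^+ 2.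

(** [b] is a lower bound for the shift, using that the axial coordinate of a mean
in the cone is at least [c] times the axial norm, and [sd <= 12 q].  The noise
has second moment [O(1 + b ^ 2 / q)], so Chebyshev's inequality applies. *)
Lemma power_ge mu alpha b : 0 < alpha < 1 -> 252 / tau <= q -> K mu ->
  b = (2 * (s * c ^+ 2 * Num.sqrt (axial_sqr mu)) + rest_sqr mu / q) / 12 ->
  1 <= b -> 2 * normal_quantile (alpha / 2) <= b ->
  1 - power_const * (b^-1 + q^-1) <= power_ts K alpha mu.
Proof.
move=> a01 hq Kmu bE b1; set z := normal_quantile _ => zb.
have z0 : 0 < z := normal_quantile_gt0 a01.
have k0 := sd_lower_gt0; have kq := sd_ge hq.
have kq0 : 0 < sd_lower * q by rewrite mulr_gt0.
have s1 : 0 < sd by exact: lt_le_trans kq.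
have n0 := axial_sqr_ge0 mu; have r0 := rest_sqr_ge0 mu.
have q1 : 1 <= q := q_ge1 Jpos.
have b0 : 0 < b by exact: lt_le_trans b1.
pose X t := lrt_std K (obs 0 t) + (sd^-1 * (2 * axial_noise mu t) + sd^-1 * (2 * rest_noise mu t)).
have tA := tame_axial_noise mu; have tN := tame_rest_noise mu.
have tX : tame X.
  by apply: tameD (tF 0) _; apply: tameD; apply: tameZ; apply: tameZ.
have FX t : shift mu + X t <= lrt_std K (obs mu t).
  have -> : shift mu + X t = (lrt_stat K (obs 0 t) + 2 * dot (axial_part mu) (P (obs 0 t)) +
      (2 * rest_noise mu t + rest_sqr mu) - lrt_mean0 K) / sd.
    rewrite /shift /X /lrt_std /axial_noise; move: (lrt_stat K _) (dot _ _) => x y; field.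
    by rewrite gt_eqF.
  rewrite /lrt_std ler_pM2r ?invr_gt0// lerD2r (lrt_stat_axial mu) lerD2r.
  exact: lrt_axial_lb.
have mu0 : c * Num.sqrt (axial_sqr mu) <= mu 0 ord0 by rewrite mulrC.
have sb : b <= shift mu.
  rewrite bE /shift ler_pdivlMr// mulrAC ler_pdivrMr//.
  apply: (@le_trans _ _ ((2 * (s * c ^+ 2 * Num.sqrt (axial_sqr mu)) + rest_sqr mu / q) * (12 * q))).
    rewrite ler_wpM2l ?sd_le// addr_ge0// ?mulr_ge0 ?invr_ge0 ?sqrtr_ge0 ?sqr_ge0//; exact: ltW.
  have -> : (2 * (s * c ^+ 2 * Num.sqrt (axial_sqr mu)) + rest_sqr mu / q) * (12 * q) =
      (2 * (s * c * q * (c * Num.sqrt (axial_sqr mu))) + rest_sqr mu) * 12 by field; rewrite gt_eqF.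
  rewrite ler_pM2r// lerD2r ler_pM2l//.
  by rewrite ler_wpM2l// !mulr_ge0// ltW.
have za : z < shift mu by apply: lt_le_trans sb; apply: lt_le_trans zb; lra.
have := Ex_reject_ge za (tF mu) tX FX.
rewrite power_tsE -/z; apply: le_trans; rewrite lerD2l lerN2.
have EX2 : Ex (fun t => X t ^+ 2) <= 3 * (1 + (176 * axial_sqr mu + 4 * rest_sqr mu) / sd ^+ 2).
  have tF2 : tame (fun t => lrt_std K (obs 0 t) ^+ 2) by apply: tameX; exact: tF.
  have tA2 : tame (fun t => axial_noise mu t ^+ 2) by exact: tameX.
  have tN2 : tame (fun t => rest_noise mu t ^+ 2) by exact: tameX.
  (* [(x + y + w) ^ 2 <= 3 (x ^ 2 + y ^ 2 + w ^ 2)]. *)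
  apply: (@le_trans _ _ (Ex (fun t => 3 * lrt_std K (obs 0 t) ^+ 2 + (12 / sd ^+ 2 * axial_noise mu t ^+ 2 +
     12 / sd ^+ 2 * rest_noise mu t ^+ 2)))).
    apply: le_Ex; first exact: tameX.
      by apply: tameD; [exact: tameZ|apply: tameD; exact: tameZ].
    move=> t; rewrite /X -exprVn.
    move: (lrt_std K _) (axial_noise _ _) (rest_noise _ _) => x y w.
    rewrite -subr_ge0.
    have -> : 3 * x ^+ 2 + (12 * sd^-1 ^+ 2 * y ^+ 2 + 12 * sd^-1 ^+ 2 * w ^+ 2) -
       (x + (sd^-1 * (2 * y) + sd^-1 * (2 * w))) ^+ 2 =
       (x - sd^-1 * (2 * y)) ^+ 2 + (x - sd^-1 * (2 * w)) ^+ 2 + (sd^-1 * (2 * y) - sd^-1 * (2 * w)) ^+ 2.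
      by ring.
    by rewrite !addr_ge0// sqr_ge0.
  rewrite ExD; [|exact: tameZ|by apply: tameD; exact: tameZ].
  rewrite ExD; [|exact: tameZ|exact: tameZ].
  rewrite !ExZ// Ex_lrt_std2// /rest_noise Ex_linear_sqr -/(rest_sqr mu).
  have := Ex_axial_noise2 mu; rewrite -exprVn.
  have : 0 <= sd^-1 ^+ 2 by exact: sqr_ge0.
  move: (sd^-1 ^+ 2) (Ex _) (axial_sqr mu) (rest_sqr mu) => w x y v w0 h.
  have := ler_wpM2l w0 h; lra.
have N1 : axial_sqr mu <= (6 / (s * c ^+ 2)) ^+ 2 * b ^+ 2.
  rewrite -exprMn -[leLHS]sqr_sqrtr// ler_sqr ?nnegrE ?sqrtr_ge0//; last first.
    by apply: mulr_ge0 (ltW b0); apply: divr_ge0 => //; rewrite mulr_ge0 ?sqr_ge0// ltW.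
  have sc0 : 0 < s * c ^+ 2 by rewrite mulr_gt0// exprn_gt0.
  rewrite mulrAC ler_pdivlMr// [leLHS]mulrC.
  have : 0 <= rest_sqr mu / q by rewrite divr_ge0 ?(ltW q0).
  by move: bE; move: (s * c ^+ 2 * Num.sqrt _) (rest_sqr mu / q) => x y; lra.
have N2 : rest_sqr mu <= 12 * b ^+ 2 * q.
  rewrite -ler_pdivrMr//.
  apply: (@le_trans _ _ (12 * b)); last by rewrite ler_pM2l// ler_eXnr.
  have : 0 <= s * c ^+ 2 * Num.sqrt (axial_sqr mu) by rewrite !mulr_ge0 ?sqrtr_ge0 ?sqr_ge0 ?(ltW s0) ?(ltW c0).
  by move: bE; move: (s * c ^+ 2 * Num.sqrt _) (rest_sqr mu / q) => x y; lra.
have bz : (b / 2) ^+ 2 <= (shift mu - z) ^+ 2.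
  by rewrite ler_sqr ?nnegrE; lra.
have b20 : 0 < (b / 2) ^+ 2 by rewrite exprn_gt0// divr_gt0.
apply: (@le_trans _ _ (Ex (fun t => X t ^+ 2) / (b / 2) ^+ 2)).
  rewrite ler_wpM2l ?lef_pV2 ?posrE// ?(lt_le_trans b20)//.
  by apply: Ex_ge0 => t; exact: sqr_ge0.
rewrite ler_pdivrMr//; apply: (le_trans EX2).
have k20 : 0 < sd_lower ^+ 2 by rewrite exprn_gt0.
set k1 := (6 / (s * c ^+ 2)) ^+ 2 in N1 *.
have k10 : 0 <= k1 by exact: sqr_ge0.
have h1 : (176 * axial_sqr mu + 4 * rest_sqr mu) / sd ^+ 2 <= (176 * k1 + 48) / sd_lower ^+ 2 * (b ^+ 2 / q).
  have -> : (176 * k1 + 48) / sd_lower ^+ 2 * (b ^+ 2 / q) = ((176 * k1 + 48) * b ^+ 2 * q) / (sd_lower * q) ^+ 2.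
    by field; rewrite !gt_eqF.
  apply: ler_pM.
  - by rewrite addr_ge0 ?mulr_ge0.
  - by rewrite invr_ge0 sqr_ge0.
  - have : k1 * b ^+ 2 <= k1 * b ^+ 2 * q by rewrite ler_peMr// mulr_ge0// sqr_ge0.
    by move: N1 N2; move: (axial_sqr mu) (rest_sqr mu) (b ^+ 2) => x y w; lra.
  - by rewrite lef_pV2 ?posrE ?exprn_gt0// ler_sqr ?nnegrE ?(ltW s1) ?(ltW kq0).
apply: (@le_trans _ _ (3 * (1 + (176 * k1 + 48) / sd_lower ^+ 2 * (b ^+ 2 / q)))).
  by rewrite ler_pM2l// lerD2l.
rewrite /power_const -/k1 -[12 * _ / _]mulrA; set g := (176 * k1 + 48) / _.
have g0 : 0 <= g.
  by apply: divr_ge0 (ltW k20); apply: addr_ge0 (ler0n _ _); exact: mulr_ge0 (ler0n _ _) k10.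
have -> : (12 + 12 * g) * (b^-1 + q^-1) * (b / 2) ^+ 2 = 3 * (b + b ^+ 2 / q + g * b + g * (b ^+ 2 / q)).
  by field; rewrite !gt_eqF.
rewrite ler_pM2l// lerD2r.
have : 0 <= b ^+ 2 / q by rewrite divr_ge0 ?sqr_ge0 ?(ltW q0).
have : 0 <= g * b by rewrite mulr_ge0// ltW.
by move: (b ^+ 2 / q) (g * b) => x y; lra.
Qed.

End cone_test_bounds.

(** * Rates in the dimension *)

Section rates.
Context {R : realType}.

Lemma near_sqrt_ge (B : R) : \forall m \near \oo, B <= Num.sqrt m%:R.
Proof.
near=> m; apply: le_trans (ler_norm _) _; rewrite -sqrtr_sqr ler_wsqrtr//.
by near: m; exact: nbhs_infty_ger.
Unshelve. all: by end_near. Qed.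

Lemma near_sqrt2_ge (B : R) : \forall m \near \oo, B <= Num.sqrt (Num.sqrt m%:R).
Proof.
near=> m; apply: le_trans (ler_norm _) _; rewrite -sqrtr_sqr ler_wsqrtr//.
by near: m; exact: near_sqrt_ge.
Unshelve. all: by end_near. Qed.

Lemma sqrt_shift_le m : (0 < m)%N -> Num.sqrt m.+2%:R <= 2 * Num.sqrt m%:R :> R.
Proof.
move=> m0; have {1}-> : 2 = Num.sqrt (2 ^+ 2) :> R by rewrite sqrtr_sqr ger0_norm.
rewrite -sqrtrM ?sqr_ge0// ler_wsqrtr// -natrX -natrM ler_nat; case: m m0 => // k _.
by change (2 ^ 2)%N with 4%N; rewrite -(addn2 k.+1) mulSn leq_add2l mulnS.
Qed.

Lemma sqrt_shift_leD m : Num.sqrt m.+2%:R <= Num.sqrt m%:R + 2 :> R.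
Proof.
have q0 := sqrtr_ge0 (m%:R : R).
rewrite -[leRHS]ger0_norm ?addr_ge0// -sqrtr_sqr ler_wsqrtr// sqrrD sqr_sqrtr//.
rewrite -addn2 natrD -addrA lerD2l; nra.
Qed.

Lemma rate_cvg (f : nat -> R) a C : (forall m, `|f m - a| <= C / Num.sqrt m.+2%:R) ->
  f m @[m --> \oo] --> a.
Proof.
move=> H; apply/cvgrPdist_le => e e0; near=> m.
rewrite distrC; apply: le_trans (H m) _.
rewrite ler_pdivrMr ?sqrtr_gt0// -ler_pdivrMl//.
apply: (@le_trans _ _ (Num.sqrt m%:R)); last by rewrite ler_wsqrtr// ler_nat -addn2 leq_addr.
by near: m; exact: near_sqrt_ge.
Unshelve. all: by end_near. Qed.

Lemma rate_bigO (f : nat -> R) a C : (forall m, `|f m - a| <= C / Num.sqrt m.+2%:R) ->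
  (fun m => f m - a) =O_\oo (fun m => (Num.sqrt m.+2%:R)^-1).
Proof.
move=> H; apply/eqOP; near=> k; near=> m.
apply: le_trans (H m) _; rewrite [`|_^-1|]ger0_norm ?invr_ge0 ?sqrtr_ge0//.
by rewrite ler_wpM2r ?invr_ge0 ?sqrtr_ge0//; near: k; exact: nbhs_pinfty_ge.
Unshelve. all: by end_near. Qed.

End rates.

(** * Asymptotics along a family of cones *)

Section cone_family.
Context {R : realType}.
Local Notation pdf := (normal_pdf (0:R) 1).
Variables c s : R.
Hypotheses (c0 : 0 < c) (s0 : 0 < s) (cs : c ^+ 2 + s ^+ 2 = 1).
Variables (p : nat -> nat) (J : forall m, {set 'I_(p m).+1}).
Hypotheses (J0 : forall m, ord0 \notin J m) (cardJ : forall m, #|J m| = m).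
Hypothesis (rest1 : forall m, (#|restJ (J m)| <= 1)%N).
Local Notation K m := (coneJ c (J m)).
Local Notation tau := (lin_var c s).

Let t0 : 0 < tau := tau2_gt0 c0 s0.

(** The Stein bound holds beyond a threshold on [m]; below it, the trivial bound 1 is
covered by the second summand. *)
Definition rate_const : R := 2 * stein_const c s + (252 / tau + 2).

Lemma rate_const_gt0 : 0 < rate_const.
Proof.
have sc0 := stein_const_gt0 c0 s0; apply: addr_gt0; first exact: mulr_gt0.
have h : 0 < 252 / tau by apply: divr_gt0 t0; rewrite ltr0n.
by apply: addr_gt0 h _; rewrite ltr0n.
Qed.

Lemma tv_family m : (tv_lrt_normal (K m) <= (rate_const / Num.sqrt m.+2%:R)%:E)%E.
Proof.
have sc0 := stein_const_gt0 c0 s0; have k0 : 0 < 252 / tau by apply: divr_gt0 t0; rewrite ltr0n.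
have sq0 : 0 < Num.sqrt m.+2%:R :> R by rewrite sqrtr_gt0.
have [hq|hq] := leP (252 / tau) (Num.sqrt m%:R).
  have m0 : (0 < m)%N.
    by rewrite lt0n; apply/negP => /eqP mz; move: hq; rewrite mz sqrtr0 leNgt k0.
  have Jpos : (0 < #|J m|)%N by rewrite cardJ.
  have := tv_rate c0 s0 cs (J0 m) Jpos (rest1 m); rewrite cardJ => /(_ hq) h.
  apply: (le_trans h); rewrite lee_fin ler_pdivrMr ?sqrtr_gt0 ?ltr0n//.
  rewrite mulrAC ler_pdivlMr//.
  apply: (@le_trans _ _ (stein_const c s * (2 * Num.sqrt m%:R))).
    by rewrite ler_wpM2l ?(ltW sc0) ?sqrt_shift_le.
  rewrite mulrA; apply: ler_wpM2r; first exact: sqrtr_ge0.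
  have k2 : 0 <= 252 / tau + 2 by apply: addr_ge0 (ltW k0) _; rewrite ler0n.
  by rewrite /rate_const mulrC lerDl.
apply: le_trans (tv_le1 (tame_lrt_std (tame_lrt_stat c0 s0 cs (J0 m) 0)).1) _.
rewrite lee_fin ler_pdivlMr// mul1r; apply: le_trans (sqrt_shift_leD _) _.
rewrite /rate_const; apply: (@le_trans _ _ (252 / tau + 2)); first by rewrite lerD2r ltW.
by rewrite lerDr mulr_ge0// ltW.
Qed.

Lemma size_family alpha m : 0 < alpha < 1 ->
  `|power_ts (K m) alpha 0 - alpha| <= rate_const / Num.sqrt m.+2%:R.
Proof.
by move=> a01; apply: size_error => //; [exact: (tame_lrt_stat c0 s0 cs (J0 m))|exact: tv_family].
Qed.

Variables (alpha : R) (mu : forall m, 'rV[R]_(p m).+1).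
Hypothesis a01 : 0 < alpha < 1.
Local Notation N m := (axial_sqr (J m) (mu m)).
Local Notation N2 m := (rest_sqr (J m) (mu m)).
Local Notation z := (normal_quantile (alpha / 2)).
Local Notation q m := (Num.sqrt m%:R : R).

Definition signal_large (M : R) m :=
  M <= Num.sqrt (N m) \/ M <= Num.sqrt (N2 m) / (m.+2%:R `^ 4^-1).

Let z0 : 0 < z := normal_quantile_gt0 a01.
Let k0 : 0 < sd_lower c s := sd_lower_gt0 c0 s0.

Lemma powR14_sqr m : (m.+2%:R `^ 4^-1) ^+ 2 = Num.sqrt m.+2%:R :> R.
Proof.
rewrite -powR_mulrn ?powR_ge0// -powRrM -powR12_sqrt//.
by congr (_ `^ _); field.
Qed.

Lemma power_ts_le1 m : power_ts (K m) alpha (mu m) <= 1.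
Proof.
rewrite power_tsE -[leRHS](@Ex_cst R (p m).+1 1); apply: le_Ex.
- by apply: tame_reject; apply: tame_lrt_std; exact: (tame_lrt_stat c0 s0 cs (J0 m)).
- exact: tame_cst.
- by move=> t; rewrite lern1; case: (_ < _).
Qed.

Lemma power_const_ge0 : 0 <= power_const c s.
Proof.
apply: addr_ge0 (ler0n _ _) _; apply: divr_ge0 (sqr_ge0 _); apply: mulr_ge0 (ler0n _ _) _.
by apply: addr_ge0 (ler0n _ _); apply: mulr_ge0 (ler0n _ _) (sqr_ge0 _).
Qed.

Lemma power_cvg1 : (forall m, K m (mu m)) ->
  (forall M, \forall m \near \oo, signal_large M m) ->
  power_ts (K m) alpha (mu m) @[m --> \oo] --> (1 : R).
Proof.
move=> Kmu H; apply/cvgrPdist_le => e e0.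
have D0 := power_const_ge0; set D := power_const c s in D0.
have De0 : 0 <= 2 * D / e by rewrite divr_ge0 ?mulr_ge0// ltW.
(* At [b >= B] and [q >= B] the bound of [power_ge] is at most [e], and its side conditions hold. *)
pose B := 1 + 2 * z + 2 * D / e.
have B1 : 1 <= B by rewrite /B -addrA lerDl addr_ge0// mulr_ge0// ltW.
have B0 : 0 < B by exact: lt_le_trans B1.
have sc0 : 0 < s * c ^+ 2 by rewrite mulr_gt0// exprn_gt0.
(* Either alternative at level [M] forces [b >= B]; the second one enters through its square, whence [M >= 1]. *)
pose M := 1 + 6 * B / (s * c ^+ 2) + 12 * B.
have M2 : 0 <= 6 * B / (s * c ^+ 2) by rewrite divr_ge0 ?(ltW sc0)// mulr_ge0// ltW.
near=> m.
have m0 : (0 < m)%N by near: m; exists 1%N.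
have hq : 252 / tau <= q m by near: m; exact: near_sqrt_ge.
have hq2 : B <= q m by near: m; exact: near_sqrt_ge.
have hS : signal_large M m by near: m; exact: H.
have Jpos : (0 < #|J m|)%N by rewrite cardJ.
rewrite ger0_norm ?subr_ge0 ?power_ts_le1//.
pose b := (2 * (s * c ^+ 2 * Num.sqrt (N m)) + N2 m / q m) / 12.
have n0 : 0 <= N2 m := rest_sqr_ge0 (J m) (mu m).
have qm0 : 0 < q m by rewrite sqrtr_gt0 ltr0n.
have bB : B <= b.
  rewrite /b ler_pdivlMr//.
  have h1 : 0 <= N2 m / q m by rewrite divr_ge0// ltW.
  have h2 : 0 <= s * c ^+ 2 * Num.sqrt (N m) by rewrite mulr_ge0 ?sqrtr_ge0// ltW.
  case: hS => hS.
    have h3 : 6 * B <= s * c ^+ 2 * Num.sqrt (N m).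
      rewrite mulrC -ler_pdivrMl//; apply: le_trans hS.
      by rewrite mulrC /M mulrAC; move: M2 B0; lra.
    by move: h3 h1; lra.
  have h3 : M * M <= N2 m / q m.
    rewrite ler_pdivlMr//; move: hS; rewrite ler_pdivlMr ?powR_gt0// => hS.
    have M0 : 0 <= M by rewrite /M; move: M2 B0; lra.
    have h4 : (M * m.+2%:R `^ 4^-1) ^+ 2 <= N2 m.
      rewrite -[leRHS]sqr_sqrtr// ler_sqr ?nnegrE ?sqrtr_ge0//.
      by rewrite mulr_ge0// powR_ge0.
    apply: le_trans h4; rewrite exprMn powR14_sqr expr2 ler_wpM2l ?mulr_ge0//.
    by rewrite ler_wsqrtr// ler_nat -addn2 leq_addr.
  have h4 : M <= M * M by rewrite ler_peMr /M; move: M2 B0; lra.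
  have h5 : 12 * B <= M by rewrite /M; move: M2; lra.
  by move: h3 h4 h2 h5; lra.
have b1 : 1 <= b by exact: le_trans bB.
have zb : 2 * z <= b by apply: le_trans bB; rewrite /B; move: De0; lra.
have := @power_ge R _ c s (J m) c0 s0 cs (J0 m) Jpos (rest1 m) (mu m) alpha b a01.
rewrite cardJ => /(_ hq (Kmu m) erefl b1 zb); rewrite -/D => hp.
rewrite lerBlDr -lerBlDl in hp *.
have hB x : B <= x -> D * x^-1 <= e / 2.
  move=> Bx; have x0 : 0 < x by exact: lt_le_trans Bx.
  rewrite ler_pdivrMr// mulrAC ler_pdivlMr//.
  have : 2 * D / e <= x by apply: le_trans Bx; rewrite /B; move: z0; lra.
  by rewrite ler_pdivrMr//; rewrite (mulrC D) (mulrC e).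
apply: le_trans (_ : D * (b^-1 + (q m)^-1) <= e).
  by move: hp; lra.
by rewrite mulrDr; have := hB _ bB; have := hB _ hq2; lra.
Unshelve. all: by end_near. Qed.

(** At an index where both signals are below the level, [power_le] keeps the power below
[1 - z pdf (D + z) / 2], with [D] depending on the level only. *)
Lemma power_cvg1_signal : power_ts (K m) alpha (mu m) @[m --> \oo] --> (1 : R) ->
  forall M, \forall m \near \oo, signal_large M m.
Proof.
move=> cv M.
pose M1 := `|M| + 1; have M1M : M <= M1 by rewrite /M1; have := ler_norm M; lra.
have M10 : 0 < M1 by rewrite /M1 ltr_wpDl.
pose D := (2 * M1 + 2 * M1 ^+ 2) / sd_lower c s.
pose eta := z * pdf (D + z).
have eta0 : 0 < eta by rewrite mulr_gt0// pdf_gt0.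
have sc0 := stein_const_gt0 c0 s0.
pose G := stein_const c s + 2 / z * ((2 + 46 * M1 ^+ 2 + 2 * M1 ^+ 2) / sd_lower c s).
have G0 : 0 <= G.
  apply: addr_ge0; first exact: ltW.
  apply: mulr_ge0; first by rewrite divr_ge0// ltW.
  have M2 : 0 <= M1 ^+ 2 by exact: sqr_ge0.
  by apply: divr_ge0 (ltW k0); move: M2; lra.
have e20 : 0 < eta / 2 by rewrite divr_gt0.
near=> m.
have m0 : (0 < m)%N by near: m; exists 1%N.
have hq : 252 / tau <= q m by near: m; exact: near_sqrt_ge.
have hq1 : 1 <= Num.sqrt (q m) by near: m; exact: near_sqrt2_ge.
have hq2 : 2 * G / eta <= Num.sqrt (q m) by near: m; exact: near_sqrt2_ge.
have hp : 1 - eta / 2 < power_ts (K m) alpha (mu m).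
  have : `|1 - power_ts (K m) alpha (mu m)| < eta / 2.
    by near: m; move/cvgrPdist_lt : cv; exact.
  by rewrite ltr_norml => /andP[_]; lra.
have Jpos : (0 < #|J m|)%N by rewrite cardJ.
have qm0 : 0 < q m by rewrite sqrtr_gt0 ltr0n.
have lq : Num.sqrt (q m) ^+ 2 = q m by rewrite sqr_sqrtr// ltW.
have l0 : 0 < Num.sqrt (q m) by rewrite sqrtr_gt0.
have n0 : 0 <= N2 m := rest_sqr_ge0 (J m) (mu m).
have n1 : 0 <= N m := axial_sqr_ge0 (J0 m) (mu m).
apply: contrapT => /not_orP[/negP]; rewrite -ltNge => hA /negP; rewrite -ltNge => hB.
have hN : Num.sqrt (N m) <= M1 by apply: ltW; exact: lt_le_trans hA M1M.
have hN' : N m <= M1 ^+ 2.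
  by rewrite -[leLHS]sqr_sqrtr// ler_sqr ?nnegrE ?sqrtr_ge0// ltW.
have hN2 : N2 m <= 2 * M1 ^+ 2 * q m.
  move: hB; rewrite ltr_pdivrMr ?powR_gt0// => hB.
  have h : Num.sqrt (N2 m) <= M1 * m.+2%:R `^ 4^-1.
    by apply: le_trans (ltW hB) _; rewrite ler_wpM2r// powR_ge0.
  have : N2 m <= (M1 * m.+2%:R `^ 4^-1) ^+ 2.
    rewrite -[leLHS]sqr_sqrtr// ler_sqr ?nnegrE ?sqrtr_ge0//.
    by rewrite mulr_ge0 ?powR_ge0// ltW.
  rewrite exprMn powR14_sqr => h2; apply: (le_trans h2).
  rewrite -mulrA mulrCA ler_wpM2l ?sqr_ge0//; exact: sqrt_shift_le.
have hD : (2 * Num.sqrt (N m) + N2 m / q m) / sd_lower c s <= D.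
  rewrite /D ler_wpM2r ?invr_ge0 ?(ltW k0)//; apply: lerD; first by rewrite ler_pM2l.
  by rewrite ler_pdivrMr.
(* [lam = sqrt q] makes both noise terms [O(sqrt q)], against [q] in the denominator. *)
have := @power_le R _ c s (J m) c0 s0 cs (J0 m) Jpos (rest1 m) (mu m) alpha (Num.sqrt (q m)) D z erefl a01.
rewrite cardJ => /(_ hq l0 hD) h.
have hG : stein_const c s / q m + 2 / z * ((1 + 46 * N m + Num.sqrt (q m) + N2 m / Num.sqrt (q m)) /
    (sd_lower c s * q m)) <= G / Num.sqrt (q m).
  have l1 : Num.sqrt (q m) <= q m by rewrite -[leRHS]lq expr2 ler_peMr// ltW.
  rewrite /G [leRHS]mulrDl; apply: lerD.
    by rewrite ler_pM2l// lef_pV2 ?posrE.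
  have aux (y l w : R) : 0 < l -> l ^+ 2 = w ->
      2 / z * (y / sd_lower c s) / l = 2 / z * ((y * l) / (sd_lower c s * w)).
    by move=> l0' <-; field; rewrite !gt_eqF.
  rewrite (aux _ _ _ l0 lq); apply: ler_wpM2l; first by rewrite divr_ge0// ltW.
  apply: ler_wpM2r; first by rewrite invr_ge0 mulr_ge0// ltW.
  have h1 : N2 m / Num.sqrt (q m) <= 2 * M1 ^+ 2 * Num.sqrt (q m).
    by rewrite ler_pdivrMr// -[leRHS]mulrA -expr2 lq.
  have h2 : 46 * N m <= 46 * M1 ^+ 2 * Num.sqrt (q m).
    apply: (@le_trans _ _ (46 * M1 ^+ 2)); first by rewrite ler_pM2l.
    by rewrite ler_peMr// mulr_ge0// sqr_ge0.
  by move: h1 h2 hq1; lra.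
have hG2 : G / Num.sqrt (q m) <= eta / 2.
  rewrite ler_pdivrMr//; move: hq2; rewrite ler_pdivrMr//.
  by move: (Num.sqrt (q m)) => x; lra.
by move: h hG hG2 hp; rewrite -/eta; lra.
Unshelve. all: by end_near. Qed.

End cone_family.

(** * The two cones of the theorem *)

Section circular_cones.
Context {R : realType}.

Definition tail_idx m : {set 'I_m.+1} := ~: [set ord0].
Definition mid_idx m : {set 'I_(m + 1).+1} := ~: [set ord0; ord_max].

Lemma ord0_tail m : ord0 \notin tail_idx m.
Proof. by rewrite finset.in_setC !inE eqxx. Qed.

Lemma ord0_mid m : ord0 \notin mid_idx m.
Proof. by rewrite finset.in_setC !inE eqxx. Qed.

Lemma card_tail m : #|tail_idx m| = m.
Proof. by have := cardsC1 (ord0 : 'I_m.+1); rewrite card_ord. Qed.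

Lemma ord0_neq_max m : (ord0 : 'I_(m + 1).+1) != ord_max.
Proof. by rewrite -val_eqE/= addn1. Qed.

Lemma card_mid m : #|mid_idx m| = m.
Proof.
have := cardsC [set ord0; ord_max : 'I_(m + 1).+1].
by rewrite cards2 ord0_neq_max card_ord -/(mid_idx m) [in RHS]addn1 => -[].
Qed.

Lemma restJ_tail m : restJ (tail_idx m) = finset.set0.
Proof. by apply/setP => i; rewrite /restJ finset.in_setC !inE; case: eqP. Qed.

Lemma restJ_mid m : restJ (mid_idx m) = [set ord_max]%SET.
Proof.
apply/setP => i; rewrite /restJ finset.in_setC !inE negb_or !negbK.
case: eqP => [->|_] //=; exact/esym/negbTE/ord0_neq_max.
Qed.

Lemma enorm_tail m (v : 'rV[R]_m.+1) :
  enorm v = Num.sqrt (v 0 ord0 ^+ 2 + \sum_(j in tail_idx m) v 0 j ^+ 2).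
Proof.
by rewrite /enorm (sum_splitJ (ord0_tail m)) restJ_tail [X in _ + X]big_set0 addr0.
Qed.

(** The indices of the left block of [lsubmx] are [ord0] and [mid_idx]. *)
Lemma enorm_mid m (v : 'rV[R]_(m.+1 + 1)) :
  enorm (lsubmx v) = Num.sqrt ((v : 'rV_(m + 1).+1) 0 ord0 ^+ 2 + \sum_(j in mid_idx m) (v : 'rV_(m + 1).+1) 0 j ^+ 2).
Proof.
rewrite /enorm; congr Num.sqrt.
(* Add the last coordinate on both sides: either sum becomes the sum over all coordinates. *)
apply: (@addIr _ ((v : 'rV_(m + 1).+1) 0 ord_max ^+ 2)).
have := sum_splitJ (ord0_mid m) (fun j => (v : 'rV_(m + 1).+1) 0 j ^+ 2).
rewrite restJ_mid big_set1 => <-.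
rewrite (@big_split_ord _ _ _ m.+1 1 predT (fun j => v 0 j ^+ 2)) big_ord1; congr (_ + _).
  by apply: eq_bigr => i _; rewrite mxE.
by congr (v 0 _ ^+ 2); apply/val_inj; rewrite /= addn0 addn1.
Qed.

Lemma circ_coneE omega m : @circ_cone R omega m = coneJ (cos omega) (tail_idx m).
Proof. by apply/seteqP; split => v; rewrite /circ_cone /coneJ/= enorm_tail. Qed.

Lemma prod_circ_coneE omega m : @prod_circ_cone R omega m =
  (coneJ (cos omega) (mid_idx m) : set 'rV_(m + 1).+1).
Proof.
have e (v : 'rV[R]_(m.+1 + 1)) : lsubmx v 0 0 = (v : 'rV_(m + 1).+1) 0 ord0.
  by rewrite mxE; congr (v _ _); exact/val_inj.
by apply/seteqP; split => v; rewrite /prod_circ_cone /circ_cone /coneJ/= enorm_mid e.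
Qed.

End circular_cones.

Theorem theorem4p6 (R : realType) (omega : R)
    (omega_gt0 : 0 < omega) (omega_lt : omega < pi / 2) :
  [/\ exists2 C : R, 0 < C & forall m : nat,
        (tv_lrt_normal (@circ_cone R omega m)
           <= (C / Num.sqrt m.+2%:R)%:E)%E /\
        (tv_lrt_normal (@prod_circ_cone R omega m)
           <= (C / Num.sqrt m.+2%:R)%:E)%E,
      forall alpha : R, 0 < alpha < 1 ->
        [/\ power_ts (@circ_cone R omega m) alpha 0 @[m --> \oo] --> alpha,
            (fun m => power_ts (@circ_cone R omega m) alpha 0 - alpha)
              =O_\oo (fun m => (Num.sqrt m.+2%:R)^-1),
            power_ts (@prod_circ_cone R omega m) alpha 0 @[m --> \oo] --> alpha
          & (fun m => power_ts (@prod_circ_cone R omega m) alpha 0 - alpha)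
              =O_\oo (fun m => (Num.sqrt m.+2%:R)^-1)],
      forall alpha : R, 0 < alpha < 1 ->
        forall mu : (forall m : nat, 'rV[R]_m.+1),
        (forall m, circ_cone omega (mu m)) ->
        (power_ts (@circ_cone R omega m) alpha (mu m) @[m --> \oo] --> (1 : R))
        <-> dominates (fun m => enorm (mu m)) (fun=> 1)
    & forall alpha : R, 0 < alpha < 1 ->
        forall mu : (forall m : nat, 'rV[R]_(m.+1 + 1)),
        (forall m, prod_circ_cone omega (mu m)) ->
        (power_ts (@prod_circ_cone R omega m) alpha (mu m) @[m --> \oo]
           --> (1 : R))
        <-> dominates_either
              (fun m => enorm (lsubmx (mu m))) (fun=> 1)
              (fun m => `|rsubmx (mu m) 0 0|) (fun m => m.+2%:R `^ 4^-1)].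
Proof.
set c := cos omega; set s := sin omega.
have c0 : 0 < c.
  by apply: cos_gt0_pihalf; rewrite omega_lt andbT; apply: lt_trans omega_gt0; rewrite oppr_lt0 divr_gt0// pi_gt0.
have s0 : 0 < s.
  by apply: sin_gt0_pihalf; rewrite omega_gt0.
have cs : c ^+ 2 + s ^+ 2 = 1 by exact: cos2Dsin2.
have rest_tail m : (#|restJ (tail_idx m)| <= 1)%N by rewrite restJ_tail cards0.
have rest_mid m : (#|restJ (mid_idx m)| <= 1)%N by rewrite restJ_mid cards1.
have size1 alpha m : 0 < alpha < 1 -> `|power_ts (@circ_cone R omega m) alpha 0 - alpha| <= rate_const c s / Num.sqrt m.+2%:R.
  by move=> a01; rewrite circ_coneE; exact: (size_family c0 s0 cs ord0_tail card_tail rest_tail m a01).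
have size2 alpha m : 0 < alpha < 1 -> `|power_ts (@prod_circ_cone R omega m) alpha 0 - alpha| <= rate_const c s / Num.sqrt m.+2%:R.
  by move=> a01; rewrite prod_circ_coneE; exact: (size_family c0 s0 cs ord0_mid card_mid rest_mid m a01).
split.
- exists (rate_const c s); first exact: rate_const_gt0.
  move=> m; rewrite circ_coneE prod_circ_coneE; split.
    exact: (tv_family c0 s0 cs ord0_tail card_tail rest_tail m).
  exact: (tv_family c0 s0 cs ord0_mid card_mid rest_mid m).
- by move=> alpha a01; split; first [exact: (rate_cvg (fun m => size1 alpha m a01))
    |exact: (rate_bigO (fun m => size1 alpha m a01))
    |exact: (rate_cvg (fun m => size2 alpha m a01))
    |exact: (rate_bigO (fun m => size2 alpha m a01))].
- move=> alpha a01 mu Kmu.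
  have e1 m : Num.sqrt (axial_sqr (tail_idx m) (mu m)) = enorm (mu m) by rewrite enorm_tail.
  have e2 m : rest_sqr (tail_idx m) (mu m) = 0 by rewrite /rest_sqr restJ_tail big_set0.
  have -> : (fun m => power_ts (@circ_cone R omega m) alpha (mu m)) =
      (fun m => power_ts (coneJ c (tail_idx m)) alpha (mu m)).
    by apply/funext => m; rewrite circ_coneE.
  rewrite /dominates cvgryPge; split => [cv M|H].
    have := power_cvg1_signal c0 s0 cs ord0_tail card_tail rest_tail a01 cv (`|M| + 1).
    apply: filterS => m; rewrite /signal_large e1 e2 sqrtr0 mul0r divr1 => -[|h].
      by apply: le_trans; rewrite (le_trans (ler_norm M))// lerDl.
    by exfalso; have := normr_ge0 M; lra.
  apply: (power_cvg1 c0 s0 cs ord0_tail card_tail rest_tail a01).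
    by move=> m; have := Kmu m; rewrite circ_coneE.
  by move=> M; apply: filterS (H M) => m; rewrite divr1 => h; left; rewrite e1.
- move=> alpha a01 mu Kmu.
  have e1 m : Num.sqrt (axial_sqr (mid_idx m) (mu m)) = enorm (lsubmx (mu m)) by rewrite enorm_mid.
  have e2 m : Num.sqrt (rest_sqr (mid_idx m) (mu m)) = `|rsubmx (mu m) 0 0|.
    rewrite /rest_sqr restJ_mid big_set1 sqrtr_sqr mxE; congr `|mu m _ _|.
    by apply/val_inj; rewrite /= addn0 addn1.
  have -> : (fun m => power_ts (@prod_circ_cone R omega m) alpha (mu m)) =
      (fun m => power_ts (coneJ c (mid_idx m)) alpha (mu m)).
    by apply/funext => m; rewrite prod_circ_coneE.
  split => [cv M|H].
    have := power_cvg1_signal c0 s0 cs ord0_mid card_mid rest_mid a01 cv M.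
    by apply: filterS => m; rewrite /signal_large e1 e2 divr1.
  apply: (power_cvg1 c0 s0 cs ord0_mid card_mid rest_mid a01).
    by move=> m; have := Kmu m; rewrite prod_circ_coneE.
  by move=> M; apply: filterS (H M) => m; rewrite /signal_large e1 e2 divr1.
Qed.
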